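(* There exist constants $C, h_0>0$ such that for every $h\in(0,h_0]$ and every $N\in\mathbb N$ we have $\lambda^{(2)}_{h,N}\geq C$.
   Context: Fix $\mu>1$. For $N\in\mathbb N$ let $V_N:\mathbb R^N\to[0,\infty)$, $V_N(x)=\sum_{k=1}^N\frac14(x_k^2-1)^2+\frac{\mu}{8\sin^2(\pi/N)}\sum_{k=1}^N(x_k-x_{k+1})^2$, with the convention $x_{N+1}:=x_1$. Let $C_b^\infty(\mathbb R^N)$ be the space of smooth real functions on $\mathbb R^N$ bounded together with all their derivatives. For $h>0$ and $f\in C_b^\infty(\mathbb R^N)$ set $\mathcal E_{h,N}[f]=hN\int_{\mathbb R^N}|\nabla f|^2e^{-V_N/(hN)}dx$. For a finite-dimensional linear subspace $S\subset C_b^\infty(\mathbb R^N)$ let $\kappa^{(S)}_{h,N}=\sup\{\mathcal E_{h,N}[f]: f\in S,\ \int f^2e^{-V_N/(hN)}dx=1\}$, and for $j\in\mathbb N_0$ let $\lambda^{(j)}_{h,N}=\inf\{\kappa^{(S)}_{h,N}: S\subset C_b^\infty(\mathbb R^N)\text{ linear subspace},\ \dim S=j+1\}$. *)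

(* Defs.v *)
From HB Require Import structures.
From mathcomp Require Import all_boot all_order all_algebra.
From mathcomp Require Import all_classical all_reals all_analysis.
Set Implicit Arguments. Unset Strict Implicit. Unset Printing Implicit Defensive.
Import Order.TTheory GRing.Theory Num.Theory.
Import numFieldNormedType.Exports.
Local Open Scope classical_set_scope.
Local Open Scope ring_scope.

Section Defs.
Variable R : realType.

(* Iterated Lebesgue integral over R^n (first coordinate outermost).
   For the nonnegative integrands used below, by Tonelli this is the
   Lebesgue integral over R^n. *)
Fixpoint iter_int (n : nat) (G : seq R -> \bar R) : \bar R :=
  match n with
  | 0 => G [::]
  | n'.+1 => (\int[@lebesgue_measure R]_x iter_int n' (fun s => G (x :: s)))%E
  end.

Definition intRN (N : nat) (F : 'rV[R]_N -> \bar R) : \bar R :=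
  iter_int N (fun s => F (\row_(i < N) nth 0 s i)).

Definition evec (N : nat) (i : 'I_N) : 'rV[R]_N := delta_mx 0 i.
Definition partial (N : nat) (i : 'I_N) (f : 'rV[R]_N -> R) : 'rV[R]_N -> R :=
  fun x => derive f x (evec i).

Definition iter_partial (N : nat) (s : seq 'I_N) (f : 'rV[R]_N -> R) :=
  foldr (fun i g => partial i g) f s.

Definition Cb_inf (N : nat) (f : 'rV[R]_N -> R) : Prop :=
  forall s : seq 'I_N,
    (forall x, differentiable (iter_partial s f) x) /\
    (exists M : R, forall x, `|iter_partial s f x| <= M).

Definition grad_sq (N : nat) (f : 'rV[R]_N -> R) (x : 'rV[R]_N) : R :=
  \sum_(i < N) (partial i f x) ^+ 2.

(* V_N, with x_{N+1} := x_1 (ordS is the cyclic successor on 'I_N) *)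
Definition V_N (mu : R) (N : nat) (x : 'rV[R]_N) : R :=
  \sum_(k < N) (4^-1 * (x 0 k ^+ 2 - 1) ^+ 2)
  + mu / (8 * (sin (pi / N%:R)) ^+ 2) * \sum_(k < N) (x 0 k - x 0 (ordS k)) ^+ 2.

Definition weight (mu h : R) (N : nat) (x : 'rV[R]_N) : R :=
  expR (- (V_N mu x / (h * N%:R))).

Definition energy (mu h : R) (N : nat) (f : 'rV[R]_N -> R) : \bar R :=
  ((h * N%:R)%:E * intRN (fun x => (grad_sq f x * weight mu h x)%:E))%E.

Definition wnorm2 (mu h : R) (N : nat) (f : 'rV[R]_N -> R) : \bar R :=
  intRN (fun x => (f x ^+ 2 * weight mu h x)%:E).

Definition span_fun (N m : nat) (g : 'I_m -> 'rV[R]_N -> R) : set ('rV[R]_N -> R) :=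
  [set f | exists c : 'I_m -> R, forall x, f x = \sum_(k < m) c k * g k x].

Definition lin_indep (N m : nat) (g : 'I_m -> 'rV[R]_N -> R) : Prop :=
  forall c : 'I_m -> R, (forall x, \sum_(k < m) c k * g k x = 0) -> forall k, c k = 0.

Definition kappa (mu h : R) (N : nat) (S : set ('rV[R]_N -> R)) : \bar R :=
  ereal_sup [set energy mu h f | f in [set f | S f /\ wnorm2 mu h f = 1%E]].

Definition subspaces_dim (N m : nat) : set (set ('rV[R]_N -> R)) :=
  [set S | exists g : 'I_m -> 'rV[R]_N -> R,
      (forall k, Cb_inf (g k)) /\ lin_indep g /\ S = span_fun g].

Definition lambda (mu h : R) (N j : nat) : \bar R :=
  ereal_inf [set kappa mu h S | S in subspaces_dim (N:=N) j.+1].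

End Defs.

(* Main.v *)
(** Let m be the mean of x, s = min (mu - 1) (1/4) and c = 1 + s.  Up to constants
    the Gibbs weight exp (-V/(hN)) is the sum over a grid of tilts t, of step of order
    sqrt h, of the weights G_t = exp (-(V + (N c/2) (m - t)^2)/(hN)).  By the sharp
    discrete Wirtinger inequality and mu > 1, the exponent of G_t is strongly convex
    uniformly in N and t, so the Prekopa-Leindler inequality yields a Poincare
    inequality for G_t with constant of order hN.

    The mean F_t of f under G_t varies slowly: |F_t' - F_t|^2 <= B Var_t f when
    |t' - t| is of order sqrt h.  The mass of G_t is comparable, uniformly in N and h,
    to exp (-psi t/h) for a double well psi with minima at 1 and -1 (the Gaussian
    fluctuations around the constant vectors are controlled by a discrete Sobolev
    inequality).  A discrete Hardy inequality along the grid then bounds the sum of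
    mass_t F_t^2 by the sum of the variances as soon as F_1 = F_(-1) = 0.  These are two
    linear constraints on f, hence satisfied by a nonzero element of every
    three-dimensional space. *)
Require Import Defs.
From HB Require Import structures.
From mathcomp Require Import all_boot all_order all_algebra.
From mathcomp Require Import all_classical all_reals all_analysis.
From mathcomp Require Import measurable_realfun.
From mathcomp Require Import zify ring lra.
Set Implicit Arguments. Unset Strict Implicit. Unset Printing Implicit Defensive.
Import Order.TTheory GRing.Theory Num.Theory.
Import numFieldNormedType.Exports.
Local Open Scope classical_set_scope.
Local Open Scope ring_scope.


(** * Gaussian-dominated integrals on the line *)

(** The energy carries the factor [h N], so a Poincare constant of order [h N] for each tilt gives a
    gap of order 1. The tilt is sized for this: at the origin the double wells contribute -1/2 to
    the quadratic form, the interaction compensates this off the constant vectors as soon as mu > 1,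
    and only the direction of the mean is left to repair, at the price c = 1 + s > 1. With s <= mu -
    1 the convexity is at least s in all directions; s <= 1/4 serves the elementary estimates on
    psi.

    The grid step faces two demands. Masses must grow by a factor 4 per step towards the wells, so
    the step is A sqrt h with A large; neighbouring means must stay comparable, which costs B = exp
    (const A^2), still free of h and N. Expanding the exponent at a constant vector always produces
    the same Gaussian, whose mass cancels in ratios and never has to be computed.

    No chain of steps crosses the barrier at 0: the two half-lines are treated separately, each
    anchored at its own well. This is where the two constraints come from. *)

Section OneDim.
Variable R : realType.
Local Notation mu := (@lebesgue_measure R).
Implicit Types (g u v w : R -> R) (C a : R).

Lemma integrable_gauss C a : 0 < a ->
  mu.-integrable [set: R] (EFin \o (fun x => C * expR (- (a * x ^+ 2)))).
Proof.
(* The Gaussian is a multiple of the normal density of variance [1 / (2 a)]. *)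
move=> a0; pose s := Num.sqrt (2 * a)^-1.
have s2 : s ^+ 2 = (2 * a)^-1 by rewrite sqr_sqrtr // invr_ge0; nra.
have s0 : s != 0.
  by apply/eqP => s0; move: s2; rewrite s0 expr0n /= => /esym/eqP; rewrite invr_eq0 => /eqP; nra.
have := @integrableZl _ _ R mu _ measurableT (C * (normal_peak s)^-1) _
  (integrable_normal_pdf 0 s).
apply: eq_integrable => //= x _; rewrite /= -EFinM; congr EFin.
rewrite normal_pdfE // mulrA -(mulrA C) mulVf ?mulr1; last first.
  by rewrite gt_eqF // normal_peak_gt0.
rewrite /normal_fun subr0 s2; congr (_ * expR _); field; lra.
Qed.

Lemma integrable_gauss_dom C a g : 0 < a -> continuous g ->
  (forall x, `|g x| <= C * expR (- (a * x ^+ 2))) ->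
  mu.-integrable [set: R] (EFin \o g).
Proof.
move=> a0 cg gb.
apply: (@le_integrable _ _ R mu _ measurableT _ _ _ _ (integrable_gauss C a0)).
- by apply/measurable_EFinP; apply: continuous_measurable_fun.
- by move=> x _; rewrite /= lee_fin (le_trans (gb x)) // ler_norm.
Qed.

Lemma Rintegral_gauss_cvg C a (g_ : nat -> R -> R) g : 0 < a ->
  (forall k, continuous (g_ k)) -> continuous g ->
  (forall k x, `|g_ k x| <= C * expR (- (a * x ^+ 2))) ->
  (forall x, g_ k x @[k --> \oo] --> g x) ->
  \int[mu]_x g_ k x @[k --> \oo] --> \int[mu]_x g x.
Proof.
move=> a0 cg_ cg gb gc.
have [] := @dominated_convergence _ _ R mu setT measurableT
  (fun k => EFin \o g_ k) (EFin \o g) _ _ _ _ (integrable_gauss C a0) _.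
- by move=> k; apply/measurable_EFinP; apply: continuous_measurable_fun.
- by apply/measurable_EFinP; apply: continuous_measurable_fun.
- apply: aeW => x _ /=; apply/cvg_EFin; last exact: gc.
  by apply: nearW.
- by apply: aeW => x n _ /=; rewrite lee_fin.
move=> i1 _ H.
rewrite /Rintegral; apply: fine_cvg.
by rewrite fineK //; apply: integrable_fin_num.
Qed.

(** Continuity makes the fundamental theorem of calculus available at every point; the Gaussian
    bound makes [g] integrable on every measurable set. *)
Definition gdom1 g := continuous g /\
  exists C a, 0 < a /\ forall x, `|g x| <= C * expR (- (a * x ^+ 2)).

Lemma gdom1_integrable g : gdom1 g -> mu.-integrable [set: R] (EFin \o g).
Proof. by move=> [cg [C [a [a0 gb]]]]; exact: integrable_gauss_dom gb. Qed.

Lemma gdom1_integrableS g (A : set (measurableTypeR R)) : measurable A -> gdom1 g ->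
  mu.-integrable A (EFin \o g).
Proof.
by move=> mA /gdom1_integrable; apply: integrableS.
Qed.

Lemma Rintegral_exhaust g (A : nat -> set (measurableTypeR R)) (B : set (measurableTypeR R)) : gdom1 g ->
  (forall n, measurable (A n)) -> measurable B ->
  (forall x, \forall n \near \oo, A n x <-> B x) ->
  \int[mu]_(x in A n) g x @[n --> \oo] --> \int[mu]_(x in B) g x.
Proof.
move=> dg mA mB AB; have ig := gdom1_integrable dg.
have mP (D : set (measurableTypeR R)) : measurable D ->
    measurable_fun [set: measurableTypeR R] (EFin \o (g \_ D)).
  move=> mD; rewrite -restrict_EFin; apply: (measurable_int mu).
  have := integrableS measurableT mD (@subsetT _ _) ig.
  by move/(@integrable_mkcond _ (measurableTypeR R) R mu _ (EFin \o g) mD).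
have [] := @dominated_convergence _ _ R mu setT measurableT
  (fun k => EFin \o (g \_ (A k))) (EFin \o (g \_ B)) (EFin \o (fun x => `|g x|)).
- by move=> k; exact: mP.
- exact: mP.
- apply: aeW => x _ /=; apply: cvg_near_cst.
  near=> n; rewrite !patchE.
  have H : A n x <-> B x by near: n; exact: AB.
  by rewrite (_ : (x \in A n) = (x \in B)) //; apply/idP/idP => /set_mem/H/mem_set.
- exact: integrable_norm.
- apply: aeW => x n _ /=; rewrite lee_fin patchE; case: ifP => // _.
  by rewrite normr0.
move=> i1 _ H.
rewrite Rintegral_mkcond; under eq_cvg do rewrite Rintegral_mkcond.
rewrite /Rintegral; apply: fine_cvg.
by rewrite fineK //; apply: integrable_fin_num.
Unshelve. all: by end_near. Qed.

Definition cdf g x := \int[mu]_(t in `]-oo, x]) g t.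

Lemma is_derive_cdf g (x : R) : gdom1 g -> is_derive x (1 : R) (cdf g) (g x).
Proof.
move=> dg; have cg : continuous g by case: dg.
have [||||dF F'] := @continuous_FTC1 R g -oo%O x (x + 1).
- by rewrite ltrDl.
- exact: gdom1_integrableS.
- by rewrite ltNyr.
- exact: cg.
by apply: DeriveDef; [exact: dF | rewrite -derive1E].
Qed.

Lemma continuous_cdf g : gdom1 g -> continuous (cdf g).
Proof.
move=> dg x; apply: differentiable_continuous; apply/derivable1_diffP.
by have [] := is_derive_cdf x dg.
Qed.

Lemma cdf_lt g : gdom1 g -> (forall x, 0 < g x) -> {homo cdf g : x y / x < y}.
Proof.
move=> dg g0 x y xy.
apply: (@gtr0_derive1_lt_cc R (cdf g) x y) => //.
- by move=> z _; have [] := is_derive_cdf z dg.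
- by move=> z _; have [_] := is_derive_cdf z dg; rewrite derive1E => ->.
- by apply: continuous_subspaceT; exact: continuous_cdf.
- by rewrite in_itv /= lexx ltW.
- by rewrite in_itv /= lexx ltW.
Qed.

Lemma cvg_cdfy g : gdom1 g -> cdf g n%:R @[n --> \oo] --> \int[mu]_x g x.
Proof.
move=> dg; apply: (Rintegral_exhaust dg) => // x.
near=> n; split => // _; rewrite /= in_itv /=.
by near: n; exact: nbhs_infty_ger.
Unshelve. all: by end_near. Qed.

Lemma cvg_cdfNy g : gdom1 g -> cdf g (- n%:R) @[n --> \oo] --> (0 : R).
Proof.
move=> dg; rewrite -(Rintegral_set0 mu g); apply: (Rintegral_exhaust dg) => // x.
near=> n; split => //; rewrite /= in_itv /=.
rewrite leNgt => /negP; apply; rewrite ltrNl.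
by near: n; exact: nbhs_infty_gtr.
Unshelve. all: by end_near. Qed.

Lemma cdf_gt0 g x : gdom1 g -> (forall x, 0 < g x) -> 0 < cdf g x.
Proof.
move=> dg g0; apply: (@le_lt_trans _ _ (cdf g (x - 1))).
  by apply: Rintegral_ge0 => t _; exact: ltW.
by apply: cdf_lt => //; rewrite ltrBlDr ltrDl.
Qed.

Lemma cdf_ltT g x : gdom1 g -> (forall x, 0 < g x) -> cdf g x < \int[mu]_x g x.
Proof.
move=> dg g0; apply: (@lt_le_trans _ _ (cdf g (x + 1))).
  by apply: cdf_lt => //; rewrite ltrDl.
apply: (cvgr_to_ge (cvg_cdfy dg)).
near=> n; apply: ltW; apply: cdf_lt => //.
by near: n; exact: nbhs_infty_gtr.
Unshelve. all: by end_near. Qed.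

End OneDim.

(** * The one-dimensional Prekopa-Leindler inequality *)

Section PL1.
Variable R : realType.
Local Notation mu := (@lebesgue_measure R).
Implicit Types (g u v w : R -> R) (C a : R).

Lemma cdf_surj g r : gdom1 g -> (forall x, 0 < g x) ->
  0 < r < \int[mu]_x g x -> exists x, cdf g x = r.
Proof.
move=> dg g0 /andP[r0 rT].
have [n1 _ /(_ n1 (leqnn _)) /= H1] : \forall n \near \oo, r < cdf g n%:R.
  exact: (cvgr_gt _ (cvg_cdfy dg)).
have [n2 _ /(_ n2 (leqnn _)) /= H2] : \forall n \near \oo, cdf g (- n%:R) < r.
  exact: (cvgr_lt _ (cvg_cdfNy dg)).
have n21 : - n2%:R <= n1%:R :> R by rewrite (@le_trans _ _ 0) // oppr_le0.
have [||c _ <-] := @IVT R (cdf g) (- n2%:R) n1%:R r n21; last by exists c.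
  by apply: continuous_subspaceT; exact: continuous_cdf.
by rewrite ge_min le_max !(ltW H1, ltW H2) orbT.
Qed.

(* [T] is the monotone map with [cdf v (T x)] proportional to [cdf u x]. *)
Lemma transport_map u v : gdom1 u -> gdom1 v ->
  (forall x, 0 < u x) -> (forall x, 0 < v x) ->
  exists T T' : R -> R,
    [/\ forall x : R, is_derive x (1 : R) T (T' x), continuous T',
        forall x, 0 < T' x &
        forall x, T' x * v (T x) * \int[mu]_t u t = \int[mu]_t v t * u x].
Proof.
move=> du dv u0 v0; set U := \int[mu]_t u t; set V := \int[mu]_t v t.
have U0 : 0 < U by apply: lt_trans (cdf_ltT 0 du u0); exact: cdf_gt0.
have V0 : 0 < V by apply: lt_trans (cdf_ltT 0 dv v0); exact: cdf_gt0.
pose k := V / U.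
have k0 : 0 < k by rewrite divr_gt0.
have ex x : exists y, cdf v y = k * cdf u x.
  apply: cdf_surj => //; rewrite mulr_gt0 ?cdf_gt0 //=.
  by rewrite /k mulrAC ltr_pdivrMr // ltr_pM2l // cdf_ltT.
(* [get] returns a default value off the range of [cdf v]; by [ex], [T] evaluates [gv] only on that
   range. *)
pose gv r := get [set y | cdf v y = r].
have inj : injective (cdf v).
  move=> x y exy; case: (ltgtP x y) => // xy; have := cdf_lt dv v0 xy;
  by rewrite exy ltxx.
have gK : cancel (cdf v) gv.
  by move=> y; apply: inj; rewrite /gv; case: xgetP => [? _ //|/(_ y)]; case.
pose T x := gv (k * cdf u x).
have TE x : cdf v (T x) = k * cdf u x.
  by rewrite /T; have [y <-] := ex x; rewrite gK.
pose T' x := (v (T x))^-1 * (k * u x).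
have dT (x : R) : is_derive x (1 : R) T (T' x).
  have -> : T = gv \o (fun x => k * cdf u x) by [].
  rewrite /T'; apply: is_derive1_comp; last first.
    exact: (@is_deriveZ _ _ _ (cdf u) k x 1 (u x) (is_derive_cdf x du)).
  rewrite -TE; apply: is_derive_inverse.
  - by near=> y; exact: gK.
  - by near=> y; exact: continuous_cdf.
  - exact: is_derive_cdf.
  - by rewrite gt_eqF.
have cT : continuous T.
  by move=> x; apply: differentiable_continuous; apply/derivable1_diffP; have [] := dT x.
exists T, T'; split => //.
- move=> x; apply: cvgM.
    apply: cvgV; first by rewrite gt_eqF.
    by apply: (@continuous_comp _ _ _ T v); [exact: cT | exact: dv.1].
  by apply: cvgM; [exact: cvg_cst | exact: du.1].
- by move=> x; rewrite /T' mulr_gt0 ?invr_gt0 // mulr_gt0.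
- move=> x; rewrite /T' /k; field.
  by rewrite !gt_eqF.
Unshelve. all: by end_near. Qed.

Lemma Rintegral_substitution (G S S' : R -> R) (a b : R) : a <= b ->
  (forall x : R, is_derive x (1 : R) S (S' x)) -> continuous S' ->
  (forall x, 0 < S' x) -> continuous G ->
  \int[mu]_(x in `[S a, S b]) G x = \int[mu]_(x in `[a, b]) (G (S x) * S' x).
Proof.
move=> ab dS cS' S'0 cG.
have SE : derive1 S = S' by apply/funext => x; rewrite derive1E; have [_] := dS x.
have cS : continuous S.
  by move=> x; apply: differentiable_continuous; apply/derivable1_diffP; have [] := dS x.
rewrite /Rintegral; congr fine.
rewrite integration_by_substitution_increasing //; rewrite ?SE //.
- move=> x y _ _ xy.
  apply: (@gtr0_derive1_lt_cc R S x y) => //.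
  + by move=> z _; rewrite SE.
  + exact: continuous_subspaceT.
  + by rewrite in_itv /= lexx ltW.
  + by rewrite in_itv /= lexx ltW.
- by apply/cvg_ex; exists (S' a); apply: cvg_at_right_filter; exact: cS'.
- by apply/cvg_ex; exists (S' b); apply: cvg_at_left_filter; exact: cS'.
- split.
  + by move=> z _; have [] := dS z.
  + by apply: cvg_at_right_filter; exact: cS.
  + by apply: cvg_at_left_filter; exact: cS.
- exact: continuous_subspaceT.
Qed.

(* Integrate [w] along [S = (id + T) / 2]; AM-GM gives [S' >= sqrt T']. *)
Lemma prekopa_leindler1 u v w : gdom1 u -> gdom1 v -> gdom1 w ->
  (forall x, 0 < u x) -> (forall x, 0 < v x) -> (forall x, 0 <= w x) ->
  (forall x y, u x * v y <= w ((x + y) / 2) ^+ 2) ->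
  (\int[mu]_x u x) * (\int[mu]_x v x) <= (\int[mu]_x w x) ^+ 2.
Proof.
move=> du dv dw u0 v0 w0 uvw.
set U := \int[mu]_t u t; set V := \int[mu]_t v t; set W := \int[mu]_t w t.
have U0 : 0 < U by apply: lt_trans (cdf_ltT 0 du u0); exact: cdf_gt0.
have V0 : 0 < V by apply: lt_trans (cdf_ltT 0 dv v0); exact: cdf_gt0.
have W0 : 0 <= W by apply: Rintegral_ge0.
have [T [T' [dT cT' T'0 TE]]] := transport_map du dv u0 v0.
pose S x := (x + T x) / 2; pose S' x := (1 + T' x) / 2.
have dS (x : R) : is_derive x (1 : R) S (S' x).
  have := @is_deriveZ _ _ _ (fun x => x + T x) 2^-1 x 1 _ (is_deriveD (is_derive_id x 1) (dT x)).
  by rewrite /S /S' mulrC; congr is_derive; apply/funext => y; rewrite mulrC.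
have cS : continuous S.
  by move=> x; apply: differentiable_continuous; apply/derivable1_diffP; have [] := dS x.
have cS' : continuous S'.
  by move=> x; apply: cvgM; [apply: cvgD; [exact: cvg_cst|exact: cT']|exact: cvg_cst].
have S'0 x : 0 < S' x by rewrite divr_gt0 // addr_gt0.
pose k := Num.sqrt (V / U).
have k2 : k ^+ 2 = V / U by rewrite sqr_sqrtr // divr_ge0 // ltW.
have pt x : k * u x <= w (S x) * S' x.
  have ku0 : 0 <= k * u x by rewrite mulr_ge0 ?sqrtr_ge0 // ltW.
  have wS0 : 0 <= w (S x) * S' x by rewrite mulr_ge0 // ltW.
  rewrite -ler_sqr //.
  rewrite !exprMn k2.
  have h : V / U * u x ^+ 2 = T' x * (u x * v (T x)).
    apply: (@mulIf _ U); first by rewrite gt_eqF.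
    transitivity (V * u x * u x); first by field; rewrite gt_eqF.
    by rewrite -(TE x : _ = V * _) -/U; ring.
  rewrite h mulrC; apply: ler_pM.
  - by rewrite mulr_ge0 // ltW.
  - exact: ltW.
  - exact: uvw.
  - have : 0 <= (1 - T' x) ^+ 2 by exact: sqr_ge0.
    rewrite /S'.
    nra.
(* The substitution is made on compact intervals, so the behaviour of [S] at infinity does not
   enter; the intervals then exhaust the line. *)
have key n : k * \int[mu]_(x in `[- n%:R, n%:R]) u x <= W.
  have n0 : - n%:R <= n%:R :> R by rewrite (@le_trans _ _ 0) // oppr_le0.
  rewrite -RintegralZl //; last exact: gdom1_integrableS.
  apply: (@le_trans _ _ (\int[mu]_(x in `[- n%:R, n%:R]) (w (S x) * S' x))).
    apply: le_Rintegral => //.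
    - have := @integrableZl _ _ R mu _ (measurable_itv `[- n%:R, n%:R]) k _ (gdom1_integrableS (measurable_itv _) du).
      exact.
    - apply: continuous_compact_integrable; first exact: segment_compact.
      apply: continuous_subspaceT => z; apply: cvgM; last exact: cS'.
      by apply: (@continuous_comp _ _ _ S w); [exact: cS | exact: dw.1].
  rewrite -(@Rintegral_substitution w S S' _ _ n0 dS cS' S'0 dw.1).
  rewrite /W /Rintegral; apply: fine_le.
  - exact: integrable_fin_num (gdom1_integrableS (measurable_itv _) dw).
  - exact: integrable_fin_num (gdom1_integrable dw).
  - apply: ge0_subset_integral => //.
    + by have /measurable_int := gdom1_integrable dw.
    + by move=> x _; rewrite lee_fin.
have kU : k * U <= W.
  have : k * \int[mu]_(x in `[- n%:R, n%:R]) u x @[n --> \oo] --> k * U.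
    apply: cvgM; first exact: cvg_cst.
    apply: (Rintegral_exhaust du) => // x.
    near=> n; split => // _; rewrite /= in_itv /=.
    rewrite -ler_norml.
    by near: n; exact: nbhs_infty_ger.
  by move=> /cvgr_to_le; apply; apply: nearW.
have : (k * U) ^+ 2 <= W ^+ 2.
  by rewrite ler_sqr ?nnegrE // mulr_ge0 ?sqrtr_ge0 // ltW.
rewrite exprMn k2; congr (_ <= _); field; by rewrite gt_eqF.
Unshelve. all: by end_near. Qed.

End PL1.

(** * Iterated integrals *)

Section Iterated.
Variable R : realType.
Local Notation mu := (@lebesgue_measure R).
Implicit Types (G H : seq R -> R) (C a : R) (n : nat) (s : seq R).

Fixpoint iterR n G : R := if n is n'.+1 then
  \int[mu]_x iterR n' (fun s => G (x :: s)) else G [::].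

Definition gaussn n C a G := forall s, size s = n ->
  `|G s| <= C * expR (- (a * \sum_(x <- s) x ^+ 2)).

(* Sequential continuity on lists of length [n]: it passes to slices and is what
   dominated convergence consumes. *)
Definition scont n G := forall (S : nat -> seq R) s,
  (forall k, size (S k) = n) -> size s = n ->
  (forall i, nth 0 (S k) i @[k --> \oo] --> nth 0 s i) ->
  G (S k) @[k --> \oo] --> G s.

Lemma gaussn_ge0 n C a G : gaussn n C a G -> 0 <= C.
Proof.
move=> /(_ (nseq n 0)); rewrite size_nseq => /(_ erefl) /(le_trans (normr_ge0 _)).
by rewrite pmulr_lge0 // expR_gt0.
Qed.

Lemma gaussn_cons n C a G x : gaussn n.+1 C a G ->
  gaussn n (C * expR (- (a * x ^+ 2))) a (fun s => G (x :: s)).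
Proof.
move=> GC s sn; have := GC (x :: s); rewrite /= sn => /(_ erefl).
by rewrite big_cons mulrDr opprD expRD mulrA.
Qed.

Lemma gaussnW n C C' a G : gaussn n C a G -> C <= C' -> gaussn n C' a G.
Proof.
move=> GC CC' s sn; apply: le_trans (GC s sn) _.
by rewrite ler_pM2r // expR_gt0.
Qed.

Lemma scont_cons n G x : scont n.+1 G -> scont n (fun s => G (x :: s)).
Proof.
move=> Gc S s Sn sn Ss; apply: (Gc (fun k => x :: S k)) => /= [k||i].
- by rewrite Sn.
- by rewrite sn.
- by case: i => [|i] /=; [exact: cvg_cst | exact: Ss].
Qed.

Let K a := \int[mu]_x expR (- (a * x ^+ 2)).

(** The two claims need a common induction: convergence in [n] variables makes the integrals over
    slices continuous in the first variable, the bound makes them Gaussian-dominated, and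
    one-dimensional dominated convergence needs both. *)
Let main n :
  (forall G C a, 0 < a -> scont n G -> gaussn n C a G -> `|iterR n G| <= C * K a ^+ n) /\
  (forall (G_ : nat -> seq R -> R) G C a, 0 < a ->
    (forall k, scont n (G_ k)) -> scont n G ->
    (forall k, gaussn n C a (G_ k)) -> gaussn n C a G ->
    (forall s, size s = n -> G_ k s @[k --> \oo] --> G s) ->
    iterR n (G_ k) @[k --> \oo] --> iterR n G).
Proof.
elim: n => [|n [IHA IHB]].
  split => [G C a a0 _ /(_ [::] erefl)|G_ G C a _ _ _ _ _ /(_ [::] erefl) //].
  by rewrite big_nil mulr0 oppr0 expR0 expr0.
have cont G C a : 0 < a -> scont n.+1 G -> gaussn n.+1 C a G ->
    continuous (fun x => iterR n (fun s => G (x :: s))).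
  move=> a0 Gc GC x; apply/(@cvg_nbhsP _ R^o) => u ux.
  (* Dropping the factor [exp (- a y^2)] gives one dominating constant for all slices. *)
  have C1 y : C * expR (- (a * y ^+ 2)) <= C.
    rewrite ler_piMr ?(gaussn_ge0 GC) // -expR0 ler_expR oppr_le0.
    by rewrite mulr_ge0 ?sqr_ge0 // ltW.
  apply: (IHB (fun k s => G (u k :: s)) (fun s => G (x :: s)) C a a0).
  - by move=> k; exact: scont_cons.
  - exact: scont_cons.
  - by move=> k; apply: gaussnW (gaussn_cons _ GC) _; exact: C1.
  - by apply: gaussnW (gaussn_cons _ GC) _; exact: C1.
  - move=> s sn; apply: Gc => /= [k||[|i] /=].
    + by rewrite sn.
    + by rewrite sn.
    + exact: ux.
    + exact: cvg_cst.
have bnd G C a : 0 < a -> scont n.+1 G -> gaussn n.+1 C a G ->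
    forall x, `|iterR n (fun s => G (x :: s))| <= C * K a ^+ n * expR (- (a * x ^+ 2)).
  move=> a0 Gc GC x.
  have := IHA _ _ _ a0 (@scont_cons _ _ x Gc) (@gaussn_cons _ _ _ _ x GC).
  by rewrite mulrAC.
split=> [G C a a0 Gc GC|G_ G C a a0 Gc_ Gc GC_ GC cvgG] /=.
  have cg := cont _ _ _ a0 Gc GC; have bg := bnd _ _ _ a0 Gc GC.
  have ig := integrable_gauss_dom a0 cg bg.
  apply: (le_trans (le_normr_Rintegral measurableT ig)).
  rewrite exprSr mulrA -RintegralZl //; last first.
    by have := @integrable_gauss R 1 a a0; apply: eq_integrable => //= x _; rewrite mul1r.
  apply: le_Rintegral => //.
  - exact: integrable_norm.
  - exact: integrable_gauss.
apply: (@Rintegral_gauss_cvg _ (C * K a ^+ n) a) => //.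
- by move=> k; exact: cont a0 (Gc_ k) (GC_ k).
- exact: cont a0 Gc GC.
- by move=> k; exact: bnd a0 (Gc_ k) (GC_ k).
- move=> x; apply: (IHB (fun k s => G_ k (x :: s)) _ (C * expR (- (a * x ^+ 2))) a a0).
  + by move=> k; exact: scont_cons.
  + exact: scont_cons.
  + by move=> k; exact: gaussn_cons.
  + exact: gaussn_cons.
  + by move=> s sn; apply: cvgG; rewrite /= sn.
Qed.

Definition gdom n G := scont n G /\ exists C a, 0 < a /\ gaussn n C a G.

Lemma gdom_cons n G x : gdom n.+1 G -> gdom n (fun s => G (x :: s)).
Proof.
move=> [Gc [C [a [a0 GC]]]]; split; first exact: scont_cons.
by exists (C * expR (- (a * x ^+ 2))), a; split => //; exact: gaussn_cons.
Qed.

Lemma gdom_slice n G : gdom n.+1 G -> gdom1 (fun x => iterR n (fun s => G (x :: s))).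
Proof.
move=> [Gc [C [a [a0 GC]]]]; split; last first.
  exists (C * K a ^+ n), a; split => // x.
  have [A _] := main n.
  have := A _ _ _ a0 (@scont_cons _ _ x Gc) (@gaussn_cons _ _ _ _ x GC).
  by rewrite mulrAC.
move=> x; apply/(@cvg_nbhsP _ R^o) => u ux.
have C1 y : C * expR (- (a * y ^+ 2)) <= C.
  rewrite ler_piMr ?(gaussn_ge0 GC) // -expR0 ler_expR oppr_le0.
  by rewrite mulr_ge0 ?sqr_ge0 // ltW.
have [_ B] := main n.
apply: (B (fun k s => G (u k :: s)) (fun s => G (x :: s)) C a a0).
- by move=> k; exact: scont_cons.
- exact: scont_cons.
- by move=> k; apply: gaussnW (gaussn_cons _ GC) _; exact: C1.
- by apply: gaussnW (gaussn_cons _ GC) _; exact: C1.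
- move=> s sn; apply: Gc => /= [k||[|i] /=].
  + by rewrite sn.
  + by rewrite sn.
  + exact: ux.
  + exact: cvg_cst.
Qed.

End Iterated.

(** * Linearity, positivity, symmetries and Prekopa-Leindler for iterated integrals *)

Section IteratedProps.
Variable R : realType.
Local Notation mu := (@lebesgue_measure R).
Implicit Types (G H : seq R -> R) (C a : R) (n : nat) (s : seq R).

Lemma eq_iterR n G H : (forall s, size s = n -> G s = H s) -> iterR n G = iterR n H.
Proof.
elim: n G H => [|n IH] G H GH; first exact: GH.
by apply: eq_Rintegral => x _; apply: IH => s sn; apply: GH; rewrite /= sn.
Qed.

Lemma iterR_lin n b c G H : gdom n G -> gdom n H ->
  iterR n (fun s => b * G s + c * H s) = b * iterR n G + c * iterR n H.
Proof.
elim: n G H => [//|n IH] G H dG dH /=.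
transitivity (\int[mu]_x (b * iterR n (fun s => G (x :: s)) + c * iterR n (fun s => H (x :: s)))).
  by apply: eq_Rintegral => x _; rewrite IH //; exact: gdom_cons.
have iG := gdom1_integrable (gdom_slice dG).
have iH := gdom1_integrable (gdom_slice dH).
by rewrite RintegralD ?RintegralZl //;
  (by apply: (@integrableZl _ _ R mu _ measurableT _ _ iG)) ||
  (by apply: (@integrableZl _ _ R mu _ measurableT _ _ iH)).
Qed.

Lemma le_iterR n G H : gdom n G -> gdom n H ->
  (forall s, size s = n -> G s <= H s) -> iterR n G <= iterR n H.
Proof.
elim: n G H => [|n IH] G H dG dH GH /=; first exact: GH.
apply: le_Rintegral => //; first exact: gdom1_integrable (gdom_slice dG).
  exact: gdom1_integrable (gdom_slice dH).
move=> x _; apply: IH; [exact: gdom_cons|exact: gdom_cons|].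
by move=> s sn; apply: GH; rewrite /= sn.
Qed.

Lemma iterR_ge0 n G : (forall s, size s = n -> 0 <= G s) -> 0 <= iterR n G.
Proof.
elim: n G => [|n IH] G G0 /=; first exact: G0.
by apply: Rintegral_ge0 => x _; apply: IH => s sn; apply: G0; rewrite /= sn.
Qed.

(** Were the integral zero, [cdf g] would vanish identically, and so would its derivative [g]. *)
Lemma Rintegral_gt0 (g : R -> R) x0 : gdom1 g -> (forall x, 0 <= g x) ->
  0 < g x0 -> 0 < \int[mu]_x g x.
Proof.
move=> dg g0 gx0; rewrite lt_neqAle Rintegral_ge0 // andbT.
apply/eqP => I0.
have c0 : cdf g = cst 0.
  apply/funext => x; apply/eqP; rewrite eq_le /=; apply/andP; split; last first.
    by apply: Rintegral_ge0.
  rewrite I0 /cdf /Rintegral; apply: fine_le.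
  - exact: integrable_fin_num (gdom1_integrableS (measurable_itv _) dg).
  - exact: integrable_fin_num (gdom1_integrable dg).
  - apply: ge0_subset_integral => //.
    + by have /measurable_int := gdom1_integrable dg.
    + by move=> y _; rewrite lee_fin.
have [_] := is_derive_cdf x0 dg.
by rewrite c0 derive_cst => gx; move: gx0; rewrite -gx ltxx.
Qed.

Lemma iterR_gt0 n G s : gdom n G -> (forall s, size s = n -> 0 <= G s) ->
  size s = n -> 0 < G s -> 0 < iterR n G.
Proof.
elim: n G s => [|n IH] G s dG G0 sn Gs /=.
  by move: sn Gs => /size0nil ->.
case: s sn Gs => // x s [sn] Gs.
apply: (@Rintegral_gt0 _ x); first exact: gdom_slice.
  by move=> y; apply: iterR_ge0 => t tn; apply: G0; rewrite /= tn.
apply: (IH _ s) => //; first exact: gdom_cons.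
by move=> t tn; apply: G0; rewrite /= tn.
Qed.

Definition midseq s t := [seq (p.1 + p.2) / 2 | p <- zip s t].

Lemma iterR_prekopa_leindler n (u v w : seq R -> R) : gdom n u -> gdom n v -> gdom n w ->
  (forall s, size s = n -> 0 < u s) -> (forall s, size s = n -> 0 < v s) ->
  (forall s, size s = n -> 0 <= w s) ->
  (forall s t, size s = n -> size t = n -> u s * v t <= w (midseq s t) ^+ 2) ->
  iterR n u * iterR n v <= iterR n w ^+ 2.
Proof.
elim: n u v w => [|n IH] u v w du dv dw u0 v0 w0 uvw.
  exact: (uvw [::] [::]).
apply: prekopa_leindler1; try exact: gdom_slice.
- move=> x; apply: (@iterR_gt0 _ _ (nseq n 0)); [exact: gdom_cons| |by rewrite size_nseq|].
    by move=> s sn; apply/ltW/u0; rewrite /= sn.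
  by apply: u0; rewrite /= size_nseq.
- move=> x; apply: (@iterR_gt0 _ _ (nseq n 0)); [exact: gdom_cons| |by rewrite size_nseq|].
    by move=> s sn; apply/ltW/v0; rewrite /= sn.
  by apply: v0; rewrite /= size_nseq.
- by move=> x; apply: iterR_ge0 => s sn; apply: w0; rewrite /= sn.
move=> x y; apply: IH; try exact: gdom_cons.
- by move=> s sn; apply: u0; rewrite /= sn.
- by move=> s sn; apply: v0; rewrite /= sn.
- by move=> s sn; apply: w0; rewrite /= sn.
- by move=> s t sn tn; apply: (uvw (x :: s) (y :: t)); rewrite /= ?sn ?tn.
Qed.

Lemma Rintegral_shift (g : R -> R) b : continuous g -> (forall x, 0 <= g x) ->
  \int[mu]_x g (x + b) = \int[mu]_x g x.
Proof.
move=> cg g0; rewrite /Rintegral; congr fine.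
pose S (x : R) := x + b.
have dS (x : R) : is_derive x (1 : R) S 1.
  by have := is_deriveD (is_derive_id x (1 : R)) (is_derive_cst b x (1:R)); rewrite addr0.
have SE : derive1 S = cst 1 by apply/funext => x; rewrite derive1E; have [_] := dS x.
rewrite [RHS](@increasing_ge0_integration_by_substitutionT R S g) //.
- by apply: eq_integral => x _; rewrite SE /= mulr1.
- by move=> x y; rewrite ltrD2r.
- by rewrite SE; move=> x; exact: cvg_cst.
- by rewrite SE; exact: is_cvg_cst.
- by rewrite SE; exact: is_cvg_cst.
- exact: cvg_addrr_Ny.
- exact: cvg_addrr.
Qed.

Lemma iterR_shift n b G : gdom n G -> (forall s, size s = n -> 0 <= G s) ->
  iterR n (fun s => G [seq x + b | x <- s]) = iterR n G.
Proof.
elim: n G => [//|n IH] G dG G0 /=.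
rewrite -[RHS](@Rintegral_shift _ b); first last.
- by move=> x; apply: iterR_ge0 => s sn; apply: G0; rewrite /= sn.
- by case: (gdom_slice dG).
apply: eq_Rintegral => x _; rewrite -(IH (fun s => G (x + b :: s))) //.
  exact: gdom_cons.
by move=> s sn; apply: G0; rewrite /= sn.
Qed.

Lemma Rintegral_opp (g : R -> R) : gdom1 g ->
  \int[mu]_x g (- x) = \int[mu]_x g x.
Proof.
move=> dg; have [cg [C [a [a0 gC]]]] := dg.
have dg' : gdom1 (fun x => g (- x)).
  split; last by exists C, a; split => // x; rewrite (le_trans (gC _)) // sqrrN.
  by move=> x; apply: (@continuous_comp _ _ _ -%R g); [exact: opp_continuous | exact: cg].
have A (h : R -> R) : gdom1 h ->
    \int[mu]_(x in `[- n%:R, n%:R]) h x @[n --> \oo] --> \int[mu]_x h x.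
  move=> dh; apply: (Rintegral_exhaust dh) => // x.
  near=> n; split => // _; rewrite /= in_itv /= -ler_norml.
  by near: n; exact: nbhs_infty_ger.
have := A _ dg; have := A _ dg'.
have -> : (fun n => \int[mu]_(x in `[- n%:R, n%:R]) g (- x)) =
    (fun n => \int[mu]_(x in `[- n%:R, n%:R]) g x).
  apply/funext => n; rewrite /Rintegral; congr fine.
  have n0 : - n%:R <= n%:R :> R by rewrite (@le_trans _ _ 0) // oppr_le0.
  have := @integration_by_substitution_oppr R g (- n%:R) n%:R n0 (continuous_subspaceT cg).
  by rewrite opprK => ->.
by move=> h1 h2; apply: (cvg_unique _ h1 h2).
Unshelve. all: by end_near. Qed.

Lemma iterR_opp n G : gdom n G ->
  iterR n (fun s => G [seq - x | x <- s]) = iterR n G.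
Proof.
elim: n G => [//|n IH] G dG /=.
rewrite -[RHS]Rintegral_opp; last exact: gdom_slice.
apply: eq_Rintegral => x _; rewrite -(IH (fun s => G (- x :: s))) //.
exact: gdom_cons.
Qed.

Lemma iter_int_iterR n G : gdom n G -> iter_int n (EFin \o G) = (iterR n G)%:E.
Proof.
elim: n G => [//|n IH] G dG /=.
rewrite /Rintegral fineK; last exact: integrable_fin_num (gdom1_integrable (gdom_slice dG)).
by apply: eq_integral => x _; rewrite -IH //; exact: gdom_cons.
Qed.

End IteratedProps.

(** * Gaussian-dominated functions of row vectors and their integrals *)

Section Vec.
Variable R : realType.
Implicit Types (b c : R).

Lemma continuous_add (T : topologicalType) (f g : T -> R) :
  continuous f -> continuous g -> continuous (fun x => f x + g x).
Proof. by move=> cf cg x; apply: (@cvgD _ _ _ (nbhs x) _ f g); [exact: (cf x)|exact: (cg x)]. Qed.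

Lemma continuous_mul (T : topologicalType) (f g : T -> R) :
  continuous f -> continuous g -> continuous (fun x => f x * g x).
Proof. by move=> cf cg x; apply: (@cvgM _ _ (nbhs x) _ f g); [exact: (cf x)|exact: (cg x)]. Qed.

Lemma continuous_const (T : topologicalType) (c : R) : continuous (fun _ : T => c).
Proof. by move=> x; exact: cvg_cst. Qed.

Lemma continuous_opp (T : topologicalType) (f : T -> R) :
  continuous f -> continuous (fun x => - f x).
Proof. by move=> cf x; apply: (@cvgN _ _ _ (nbhs x) _ f); exact: (cf x). Qed.

Lemma continuous_exp (T : topologicalType) (f : T -> R) :
  continuous f -> continuous (fun x => expR (f x)).
Proof. by move=> cf x; apply: (@continuous_comp _ _ _ f expR); [exact: (cf x)|exact: continuous_expR]. Qed.

Lemma continuous_sum (T : topologicalType) (K : Type) (r : seq K) (f : K -> T -> R) :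
  (forall i, continuous (f i)) -> continuous (fun x => \sum_(i <- r) f i x).
Proof.
move=> cf; elim: r => [|i r IH].
  by under eq_fun do rewrite big_nil; move=> x; exact: cvg_cst.
under eq_fun do rewrite big_cons.
exact: continuous_add.
Qed.

Variable N : nat.
Local Notation vec := 'rV[R]_N.
Implicit Types (F G u v w : vec -> R) (x y : vec).

Definition sqn x : R := \sum_(i < N) x 0 i ^+ 2.

Lemma sqn_ge0 x : 0 <= sqn x.
Proof. by apply: sumr_ge0 => i _; exact: sqr_ge0. Qed.

Definition gdomV F := continuous F /\
  exists C a, 0 < a /\ forall x, `|F x| <= C * expR (- (a * sqn x)).

Definition rowseq (s : seq R) : vec := \row_(i < N) nth 0 s i.

Lemma rowseq_surj x : exists2 s, size s = N & rowseq s = x.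
Proof.
exists [seq x 0 i | i <- enum 'I_N]; first by rewrite size_map size_enum_ord.
apply/rowP => i; rewrite mxE (nth_map i) ?size_enum_ord //.
by rewrite nth_ord_enum.
Qed.

Lemma sqn_rowseq s : size s = N -> sqn (rowseq s) = \sum_(x <- s) x ^+ 2.
Proof.
move=> sN; rewrite (big_nth 0) sN big_mkord.
by apply: eq_bigr => i _; rewrite mxE.
Qed.

Lemma cvg_rowseq (S : nat -> seq R) s :
  (forall i, nth 0 (S k) i @[k --> \oo] --> nth 0 s i) ->
  rowseq (S k) @[k --> \oo] --> rowseq s.
Proof.
move=> Ss; apply/cvg_ballP => e e0.
suff : \forall k \near \oo, forall i : 'I_N, ball (nth 0 s i) e (nth 0 (S k) i).
  by apply: filterS => k H; split => // i j; rewrite !mxE.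
apply: filter_forall => i; move/cvg_ballP : (Ss i); exact.
Qed.

Lemma gdomV_gdom F : gdomV F -> gdom N (F \o rowseq).
Proof.
move=> [cF [C [a [a0 FC]]]]; split.
  move=> S s Sn sn Ss.
  by apply: (cvg_comp _ _ (cvg_rowseq Ss)); exact: cF.
by exists C, a; split => // s sn /=; rewrite -sqn_rowseq.
Qed.

Definition intV F := iterR N (F \o rowseq).

Lemma intRN_intV F : gdomV F -> intRN (EFin \o F) = (intV F)%:E.
Proof. by move=> dF; rewrite -iter_int_iterR //; exact: gdomV_gdom. Qed.

Lemma eq_intV F G : (forall x, F x = G x) -> intV F = intV G.
Proof. by move=> FG; apply: eq_iterR => s _ /=. Qed.

Lemma gdomV_lin b c F G : gdomV F -> gdomV G -> gdomV (fun x => b * F x + c * G x).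
Proof.
move=> [Fc [C [a [a0 FC]]]] [Gc [C' [a' [a'0 GC]]]]; split.
  by apply: continuous_add; apply: continuous_mul => //; exact: continuous_const.
have ge0 H D d : (forall x, `|H x| <= D * expR (- (d * sqn x))) -> 0 <= D.
  by move=> /(_ 0) /(le_trans (normr_ge0 _)); rewrite pmulr_lge0 // expR_gt0.
exists (`|b| * C + `|c| * C'), (Num.min a a'); split; first by rewrite lt_min a0 a'0.
move=> x; apply: (le_trans (ler_normD _ _)); rewrite !normrM mulrDl -!mulrA.
apply: lerD; apply: ler_wpM2l => //.
- apply: (le_trans (FC x)); apply: ler_wpM2l; first exact: ge0 FC.
  by rewrite ler_expR lerN2 ler_wpM2r ?sqn_ge0 // ge_min lexx.
- apply: (le_trans (GC x)); apply: ler_wpM2l; first exact: ge0 GC.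
  by rewrite ler_expR lerN2 ler_wpM2r ?sqn_ge0 // ge_min lexx orbT.
Qed.

Lemma eq_gdomV F G : (forall x, F x = G x) -> gdomV F -> gdomV G.
Proof. by move=> /funext ->. Qed.

Lemma gdomVD F G : gdomV F -> gdomV G -> gdomV (fun x => F x + G x).
Proof.
move=> dF dG; apply: eq_gdomV (gdomV_lin 1 1 dF dG) => x.
by rewrite !mul1r.
Qed.

Lemma gdomVZ b F : gdomV F -> gdomV (fun x => b * F x).
Proof.
move=> dF; apply: eq_gdomV (gdomV_lin b 0 dF dF) => x.
by rewrite mul0r addr0.
Qed.

Lemma intV_lin b c F G : gdomV F -> gdomV G ->
  intV (fun x => b * F x + c * G x) = b * intV F + c * intV G.
Proof. by move=> dF dG; rewrite -iterR_lin //; exact: gdomV_gdom. Qed.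

Lemma intVD F G : gdomV F -> gdomV G -> intV (fun x => F x + G x) = intV F + intV G.
Proof.
move=> dF dG; rewrite -[intV F]mul1r -[intV G]mul1r -intV_lin //.
by apply: eq_intV => x; rewrite !mul1r.
Qed.

Lemma intVZ b F : gdomV F -> intV (fun x => b * F x) = b * intV F.
Proof.
move=> dF; rewrite -[RHS]addr0 -(mul0r (intV F)) -intV_lin //.
by apply: eq_intV => x; rewrite mul0r addr0.
Qed.

Lemma gdomV0 : gdomV (fun=> 0).
Proof.
split; first exact: continuous_const.
by exists 0, 1; split => // x; rewrite normr0 mul0r.
Qed.

Lemma gdomV_sum (T : Type) (r : seq T) (F : T -> vec -> R) :
  (forall k, gdomV (F k)) -> gdomV (fun x => \sum_(k <- r) F k x).
Proof.
move=> dF; elim: r => [|k r IH].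
  by apply: eq_gdomV gdomV0 => x; rewrite big_nil.
by apply: eq_gdomV (gdomVD (dF k) IH) => x; rewrite big_cons.
Qed.

Lemma intV_sum (T : Type) (r : seq T) (F : T -> vec -> R) :
  (forall k, gdomV (F k)) ->
  intV (fun x => \sum_(k <- r) F k x) = \sum_(k <- r) intV (F k).
Proof.
move=> dF; elim: r => [|k r IH].
  rewrite big_nil (@eq_intV _ (fun x => 0 * 0)).
    by rewrite (intVZ 0 gdomV0) mul0r.
  by move=> x; rewrite big_nil mul0r.
rewrite big_cons -IH -intVD //; last exact: gdomV_sum.
by apply: eq_intV => x; rewrite big_cons.
Qed.

Lemma le_intV F G : gdomV F -> gdomV G -> (forall x, F x <= G x) -> intV F <= intV G.
Proof. by move=> dF dG FG; exact: (le_iterR (gdomV_gdom dF) (gdomV_gdom dG) (fun s _ => FG (rowseq s))). Qed.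

Lemma intV_ge0 F : (forall x, 0 <= F x) -> 0 <= intV F.
Proof. by move=> F0; apply: iterR_ge0 => s _ /=. Qed.

Lemma intV_gt0 F x : gdomV F -> (forall x, 0 <= F x) -> 0 < F x -> 0 < intV F.
Proof.
move=> dF F0; have [s sN <-] := rowseq_surj x => Fs.
by apply: (iterR_gt0 (s := s) (gdomV_gdom dF)) => // t _; exact: F0.
Qed.

Lemma intV_prekopa_leindler u v w : gdomV u -> gdomV v -> gdomV w ->
  (forall x, 0 < u x) -> (forall x, 0 < v x) -> (forall x, 0 <= w x) ->
  (forall x y, u x * v y <= w (2^-1 *: (x + y)) ^+ 2) ->
  intV u * intV v <= intV w ^+ 2.
Proof.
move=> du dv dw u0 v0 w0 uvw; apply: (iterR_prekopa_leindler (gdomV_gdom du) (gdomV_gdom dv) (gdomV_gdom dw)).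
- by move=> s _; exact: u0.
- by move=> s _; exact: v0.
- by move=> s _; exact: w0.
move=> s t sN tN /=; apply: (le_trans (uvw _ _)).
rewrite (_ : _ *: _ = rowseq (midseq s t)) //.
apply/rowP => i; rewrite !mxE (nth_map (0, 0)) ?size_zip ?sN ?tN ?minnn //.
by rewrite nth_zip ?sN ?tN //= mulrC.
Qed.

Lemma intV_shift b F : gdomV F -> (forall x, 0 <= F x) ->
  intV (fun x => F (x + const_mx b)) = intV F.
Proof.
move=> dF F0; rewrite /intV -(iterR_shift b (gdomV_gdom dF)); last by move=> s _; exact: F0.
apply: eq_iterR => s sN /=; congr F; apply/rowP => i.
by rewrite !mxE (nth_map 0) ?sN.
Qed.

Lemma intV_opp F : gdomV F -> intV (fun x => F (- x)) = intV F.
Proof.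
move=> dF; rewrite /intV -(iterR_opp (gdomV_gdom dF)).
apply: eq_iterR => s sN /=; congr F; apply/rowP => i.
by rewrite !mxE (nth_map 0) ?sN.
Qed.

Lemma continuous_coord i : continuous (fun x : vec => x 0 i).
Proof. exact: coord_continuous. Qed.

(* Multipliers that preserve [gdomV]. *)
Definition subgauss (g : vec -> R) := continuous g /\
  forall e : R, 0 < e -> exists A, forall x, `|g x| <= A * expR (e * sqn x).

Lemma subgaussM g h : subgauss g -> subgauss h -> subgauss (fun x => g x * h x).
Proof.
move=> [cg gb] [ch hb]; split; first exact: continuous_mul.
move=> e e0; have e2 : 0 < e / 2 by rewrite divr_gt0.
have [A HA] := gb _ e2; have [B HB] := hb _ e2.
exists (A * B) => x; rewrite normrM (splitr e) mulrDl expRD mulrACA.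
by apply: ler_pM.
Qed.

Lemma subgaussD g h : subgauss g -> subgauss h -> subgauss (fun x => g x + h x).
Proof.
move=> [cg gb] [ch hb]; split; first exact: continuous_add.
move=> e e0; have [A HA] := gb _ e0; have [B HB] := hb _ e0.
exists (A + B) => x; rewrite mulrDl (le_trans (ler_normD _ _)) //.
exact: lerD.
Qed.

Lemma subgauss_bounded g M : continuous g -> (forall x, `|g x| <= M) -> subgauss g.
Proof.
move=> cg gM; split => // e e0; exists M => x; apply: (le_trans (gM x)).
rewrite ler_peMr //; first exact: le_trans (gM x).
by rewrite -expR0 ler_expR mulr_ge0 ?sqn_ge0 // ltW.
Qed.

Lemma subgauss_cst c : subgauss (fun=> c).
Proof. by apply: (@subgauss_bounded _ `|c|) => //; exact: continuous_const. Qed.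

Lemma coord_sqn x i : x 0 i ^+ 2 <= sqn x.
Proof.
rewrite /sqn (bigD1 i) //= lerDl; apply: sumr_ge0 => j _; exact: sqr_ge0.
Qed.

(** Complete the square in [c y <= e y^2 + c^2 / (4 e)]. *)
Lemma subgauss_expR c i : subgauss (fun x => expR (c * x 0 i)).
Proof.
split.
  apply: continuous_exp; apply: continuous_mul; first exact: continuous_const.
  exact: continuous_coord.
move=> e e0; exists (expR (c ^+ 2 / (4 * e))) => x.
rewrite ger0_norm ?expR_ge0 // -expRD ler_expR.
have h1 : 0 <= (c / (2 * e) - x 0 i) ^+ 2 by exact: sqr_ge0.
have h2 := coord_sqn x i.
have : c * x 0 i = c ^+ 2 / (4 * e) + e * x 0 i ^+ 2 - e * (c / (2 * e) - x 0 i) ^+ 2.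
  by field; lra.
nra.
Qed.

(** Reduces to exponentials by [|y| <= exp y + exp (- y)]. *)
Lemma subgauss_coord i : subgauss (fun x => x 0 i).
Proof.
have [_ h1] := subgauss_expR 1 i; have [_ h2] := subgauss_expR (-1) i.
split; first exact: continuous_coord.
move=> e e0; have [A HA] := h1 e e0; have [B HB] := h2 e e0.
exists (A + B) => x; rewrite mulrDl.
have {}HA := HA x; have {}HB := HB x.
have e1 := expR_ge1Dx (1 * x 0 i); have e2 := expR_ge1Dx (-1 * x 0 i).
rewrite !ger0_norm ?expR_ge0 // in HA HB.
have p1 := expR_ge0 (1 * x 0 i); have p2 := expR_ge0 (-1 * x 0 i).
by rewrite ler_norml; apply/andP; split; lra.
Qed.

Lemma subgauss_sum (T : Type) (r : seq T) (F : T -> vec -> R) :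
  (forall k, subgauss (F k)) -> subgauss (fun x => \sum_(k <- r) F k x).
Proof.
move=> dF; elim: r => [|k r IH].
  by have := subgauss_cst 0; congr subgauss; apply/funext => x; rewrite big_nil.
by have := subgaussD (dF k) IH; congr subgauss; apply/funext => x; rewrite big_cons.
Qed.

Lemma gdomV_mul g F : subgauss g -> gdomV F -> gdomV (fun x => g x * F x).
Proof.
move=> [cg gb] [cF [C [a [a0 FC]]]]; split.
  exact: continuous_mul.
(* Half of the Gaussian decay of [F] pays for the growth of [g]. *)
have a2 : 0 < a / 2 by rewrite divr_gt0.
have [A HA] := gb _ a2; exists (A * C), (a / 2); split => // x.
rewrite normrM; apply: le_trans (ler_pM _ _ (HA x) (FC x)) _ => //.
by rewrite mulrACA -expRD; apply: ler_wpM2l; [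
  rewrite -(pmulr_lge0 _ (expR_gt0 (a/2 * sqn 0 - a * sqn 0))) expRD mulrACA;
  apply: le_trans (ler_pM _ _ (HA 0) (FC 0)) | rewrite ler_expR; lra].
Qed.

Lemma gdomV_expR (P : vec -> R) a C : continuous P -> 0 < a ->
  (forall x, a * sqn x - C <= P x) -> gdomV (fun x => expR (- P x)).
Proof.
move=> cP a0 HP; split.
  by apply: continuous_exp; exact: continuous_opp.
exists (expR C), a; split => // x.
rewrite ger0_norm ?expR_ge0 // -expRD ler_expR; have := HP x; lra.
Qed.

End Vec.

(** * The sharp discrete Wirtinger inequality *)

Section Wirtinger.
Variable R : realType.

(** Each [2 sin (phi / 2) cos (j phi)] is the difference of [sin ((j + 1/2) phi)] and
    [sin ((j - 1/2) phi)]. *)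
Lemma sum_cos_telescope (phi : R) n :
  2 * sin (phi / 2) * (\sum_(j < n) cos (j%:R * phi)) =
  sin (n%:R * phi - phi / 2) + sin (phi / 2).
Proof.
elim: n => [|n IH].
  by rewrite big_ord0 mulr0 mul0r sub0r sinN addNr.
rewrite big_ord_recr /= mulrDr IH.
have -> : n.+1%:R * phi - phi / 2 = n%:R * phi + phi / 2.
  by rewrite -natr1; field.
by rewrite sinB sinD; ring.
Qed.

Variable n : nat.
Local Notation N := n.+1.
Let om : R := pi *+ 2 / N%:R.

(** [N phi] is a multiple of [2 pi], so the telescoped sum vanishes, while [phi / 2] lies strictly
    between 0 and [pi] and its sine can be cancelled. *)
Lemma cos_sum_roots (p : nat) : (0 < p < N)%N ->
  \sum_(j < N) cos (j%:R * (p%:R * om)) = 0.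
Proof.
move=> /andP[p0 pN]; set phi := p%:R * om.
have N0 : (N%:R : R) != 0 by rewrite pnatr_eq0.
have phiE : phi / 2 = pi * (p%:R / N%:R) by rewrite /phi /om; field.
have s0 : 0 < sin (phi / 2).
  apply: sin_gt0_pi; rewrite phiE mulr_gt0 ?divr_gt0 ?ltr0n ?pi_gt0 //=.
  by rewrite gtr_pMr ?pi_gt0 // ltr_pdivrMr ?ltr0n // mul1r ltr_nat.
have := sum_cos_telescope phi N.
have -> : N%:R * phi - phi / 2 = - (phi / 2) + (pi *+ 2) *+ p.
  by rewrite -[_ *+ p]mulr_natl /phi /om; field.
rewrite (periodicn (@sinD2pi R)) sinN addNr => /eqP; rewrite mulf_eq0.
by rewrite mulf_eq0 pnatr_eq0 /= gt_eqF //= => /eqP.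
Qed.

Lemma cos_sum_orth (k l : 'I_N) :
  \sum_(j < N) cos (j%:R * (k%:R * om) - j%:R * (l%:R * om)) = (N * (k == l))%:R.
Proof.
case: eqVneq => [->|kl].
  rewrite muln1 (eq_bigr (fun=> 1)); last by move=> j _; rewrite subrr cos0.
  by rewrite big_const_ord iter_addr_0.
rewrite muln0.
wlog lk : k l kl / (l < k)%N.
  move=> W; case: (ltngtP l k) => [|kl'|/val_inj lk]; first exact: W.
    rewrite -(W l k _ kl') 1?eq_sym //; apply: eq_bigr => j _.
    by rewrite -cosN opprB.
  by rewrite lk eqxx in kl.
rewrite -[RHS](@cos_sum_roots (k - l)%N); last first.
  by rewrite subn_gt0 lk /= (leq_ltn_trans (leq_subr _ _)).
apply: eq_bigr => j _; congr cos.
by rewrite natrB ?(ltnW lk) // mulrBl mulrBr.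
Qed.

Implicit Type x : 'I_N -> R.
(** [Cf + i Sf] is the discrete Fourier transform of [x]. *)
Let Cf x (j : nat) := \sum_(k < N) x k * cos (j%:R * (k%:R * om)).
Let Sf x (j : nat) := \sum_(k < N) x k * sin (j%:R * (k%:R * om)).

Lemma parseval x : \sum_(j < N) (Cf x j ^+ 2 + Sf x j ^+ 2) = N%:R * \sum_(k < N) x k ^+ 2.
Proof.
transitivity (\sum_(j < N) \sum_(k < N) \sum_(l < N)
    x k * x l * cos (j%:R * (k%:R * om) - j%:R * (l%:R * om))).
  apply: eq_bigr => j _; rewrite !expr2 /Cf /Sf !big_distrl /= -big_split /=.
  apply: eq_bigr => k _; rewrite !big_distrr /= -big_split /=.
  apply: eq_bigr => l _; rewrite cosB; ring.
rewrite exchange_big mulr_sumr /=; apply: eq_bigr => k _.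
rewrite exchange_big /= (bigD1 k) //= [X in _ + X]big1 ?addr0; last first.
  by move=> l lk; rewrite -mulr_sumr cos_sum_orth eq_sym (negbTE lk) muln0 mulr0.
rewrite -mulr_sumr cos_sum_orth eqxx muln1 expr2; ring.
Qed.

(** The wrap-around of [ordS] changes the angle by a multiple of [2 pi]. *)
Let cos_ordS (j : nat) (k : 'I_N) :
  cos (j%:R * ((ordS k)%:R * om)) = cos (j%:R * (k%:R * om) + j%:R * om) /\
  sin (j%:R * ((ordS k)%:R * om)) = sin (j%:R * (k%:R * om) + j%:R * om).
Proof.
have N0 : (N%:R : R) != 0 by rewrite pnatr_eq0.
have E : j%:R * (k%:R * om) + j%:R * om =
    j%:R * ((ordS k)%:R * om) + (pi *+ 2) *+ (j * (k.+1 %/ N)).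
  rewrite -[(_ *+ 2) *+ _]mulr_natl natrM /=.
  transitivity (j%:R * (k.+1%:R * om)); first by rewrite -natr1; ring.
  rewrite {1}(divn_eq k.+1 N) natrD natrM /om; field; by rewrite nat1r.
by rewrite E (periodicn (@cosD2pi R)) (periodicn (@sinD2pi R)).
Qed.

Let ordS_bij : bijective (@ordS N).
Proof. by exists (@ord_pred N); [exact: ordSK | exact: ord_predK]. Qed.

(** A cyclic shift multiplies the Fourier coefficient by a phase of angle [j om], and
    [|1 - exp (i th)|^2 = 2 - 2 cos th]. *)
Lemma fourier_diff x (j : nat) :
  Cf (fun k => x k - x (ordS k)) j ^+ 2 + Sf (fun k => x k - x (ordS k)) j ^+ 2 =
  (2 - 2 * cos (j%:R * om)) * (Cf x j ^+ 2 + Sf x j ^+ 2).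
Proof.
set a := Cf x j; set b := Sf x j; set th := j%:R * om.
pose a' := Cf (fun k => x (ordS k)) j; pose b' := Sf (fun k => x (ordS k)) j.
have aE : a = a' * cos th - b' * sin th.
  rewrite /a /Cf (reindex_inj (bij_inj ordS_bij)) /= /a' /b' /Cf /Sf !mulr_suml -sumrB.
  by apply: eq_bigr => k _; rewrite (cos_ordS j k).1 cosD; ring.
have bE : b = b' * cos th + a' * sin th.
  rewrite /b /Sf (reindex_inj (bij_inj ordS_bij)) /= /a' /b' /Cf /Sf !mulr_suml -big_split /=.
  by apply: eq_bigr => k _; rewrite (cos_ordS j k).2 sinD; ring.
have -> : Cf (fun k => x k - x (ordS k)) j = a - a'.
  by rewrite /a /a' /Cf -sumrB; apply: eq_bigr => k _; rewrite mulrBl.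
have -> : Sf (fun k => x k - x (ordS k)) j = b - b'.
  by rewrite /b /b' /Sf -sumrB; apply: eq_bigr => k _; rewrite mulrBl.
rewrite aE bE; have := cos2Dsin2 th; move: (cos th) (sin th) => c s cs.
have -> : (a' * c - b' * s - a') ^+ 2 + (b' * c + a' * s - b') ^+ 2 =
  (a' ^+ 2 + b' ^+ 2) * (1 - 2 * c + (c ^+ 2 + s ^+ 2)) by ring.
have -> : (a' * c - b' * s) ^+ 2 + (b' * c + a' * s) ^+ 2 =
  (a' ^+ 2 + b' ^+ 2) * (c ^+ 2 + s ^+ 2) by ring.
by rewrite cs; ring.
Qed.

(** The reflection of [j] to [N - j] brings the angle into [[0, pi]], where the cosine decreases. *)
Let cos_mode (j : nat) : (0 < j < N)%N -> cos (j%:R * om) <= cos om.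
Proof.
wlog j2 : j / (j.*2 <= N)%N.
  move=> W /andP[j0 jN]; have [|jN2] := leqP j.*2 N; first by move=> /W; apply; rewrite j0.
  have -> : cos (j%:R * om) = cos ((N - j)%:R * om).
    rewrite natrB 1?ltnW // mulrBl.
    have -> : N%:R * om = pi *+ 2 :> R by rewrite /om; field; rewrite ?nat1r pnatr_eq0.
    rewrite -[RHS]cosN opprB -[in RHS](cosD2pi (j%:R * om - pi *+ 2)).
    by congr cos; ring.
  apply: W; last by rewrite subn_gt0 jN /= ltn_subrL j0.
  by rewrite -addnn; lia.
move=> /andP[j0 jN].
have [->|j1] := eqVneq j 1%N; first by rewrite mul1r.
have om0 : 0 < om by rewrite divr_gt0 ?ltr0n // mulrn_wgt0 ?pi_gt0.
have jpi : j%:R * om <= pi.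
  rewrite /om mulrA ler_pdivrMr ?ltr0n //.
  have -> : j%:R * (pi *+ 2) = pi * (j.*2)%:R :> R by rewrite -muln2 natrM; ring.
  by rewrite ler_pM2l ?pi_gt0 // ler_nat.
have j1om : om <= j%:R * om by apply: ler_peMl; [exact: ltW | rewrite ler1n].
rewrite leNgt ltr_cos; first by rewrite -leNgt.
  by rewrite in_itv /= jpi andbT mulr_ge0 // ltW.
by rewrite in_itv /= (ltW om0) (le_trans j1om jpi).
Qed.

(* The sharp constant is what makes [qform] below positive definite for every
   [mu > 1]. *)
Lemma discrete_wirtinger x :
  4 * sin (pi / N%:R) ^+ 2 * (\sum_(k < N) x k ^+ 2 - (\sum_(k < N) x k) ^+ 2 / N%:R) <=
  \sum_(k < N) (x k - x (ordS k)) ^+ 2.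
Proof.
have N0 : (0 : R) < N%:R by rewrite ltr0n.
rewrite -(ler_pM2l N0) -[leRHS]parseval.
under [leRHS]eq_bigr do rewrite fourier_diff.
(* This is the multiplier of the lowest nonconstant mode [j = 1]. *)
have -> : 4 * sin (pi / N%:R) ^+ 2 = 2 - 2 * cos om.
  rewrite sin2cos2 (_ : om = (pi / N%:R) *+ 2); last first.
    by rewrite /om mulrnAl.
  by rewrite cos_mulr2n; ring.
rewrite mulrCA mulrBr -parseval [N%:R * (_ / _)]mulrCA divff ?gt_eqF // mulr1.
(* Mode 0 is split off: on the left it is the squared sum that gets subtracted, on the right its
   multiplier is zero. *)
rewrite big_ord_recl [leRHS]big_ord_recl /=.
have C0 : Cf x 0 = \sum_(k < N) x k.
  by apply: eq_bigr => k _; rewrite mul0r cos0 mulr1.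
have S0 : Sf x 0 = 0.
  by rewrite /Sf big1 // => k _; rewrite mul0r sin0 mulr0.
rewrite C0 S0 mul0r cos0 mulr1 subrr mul0r add0r [0 ^+ 2]expr0n /= addr0.
rewrite (addrC (_ ^+ 2)) addrK.
rewrite mulr_sumr; apply: ler_sum => j _; apply: ler_wpM2r.
  by rewrite addr_ge0 ?sqr_ge0.
by rewrite lerD2l lerN2 ler_pM2l // cos_mode //= /bump add1n ltnS ltn_ord.
Qed.

End Wirtinger.

(** * Convexity of the potential *)

Section Potential.
Variables (R : realType) (n : nat).
Local Notation N := n.+1.
Local Notation vec := 'rV[R]_N.
Implicit Types (x y z : vec).

Definition mean x : R := (\sum_(k < N) x 0 k) / N%:R.
Definition diff2 x : R := \sum_(k < N) (x 0 k - x 0 (ordS k)) ^+ 2.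

Let N0 : (0 : R) < N%:R. Proof. by rewrite ltr0n. Qed.

Lemma sum_const (b : R) : \sum_(k < N) b = N%:R * b.
Proof. by rewrite big_const_ord iter_addr_0 mulr_natl. Qed.

Lemma sum_mean x : \sum_(k < N) x 0 k = N%:R * mean x.
Proof. by rewrite /mean mulrC divfK // gt_eqF. Qed.

Lemma mean_lin (b c : R) x y : mean (b *: x + c *: y) = b * mean x + c * mean y.
Proof.
rewrite /mean !mulrA -mulrDl !mulr_sumr -big_split /=; congr (_ / _).
by apply: eq_bigr => k _; rewrite !mxE.
Qed.

Lemma mean_const (b : R) : mean (const_mx b) = b.
Proof.
rewrite /mean (eq_bigr (fun=> b)); last by move=> k _; rewrite mxE.
by rewrite sum_const mulrC mulKf // gt_eqF.
Qed.

Lemma sum_sqr_centered (a : 'I_N -> R) :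
  0 <= \sum_(k < N) a k ^+ 2 - (\sum_(k < N) a k) ^+ 2 / N%:R.
Proof.
set S := \sum_(k < N) a k; pose m := S / N%:R.
suff -> : \sum_(k < N) a k ^+ 2 - S ^+ 2 / N%:R = \sum_(k < N) (a k - m) ^+ 2.
  by apply: sumr_ge0 => k _; exact: sqr_ge0.
have -> : \sum_(k < N) (a k - m) ^+ 2 = \sum_(k < N) (a k ^+ 2 - 2 * m * a k + m ^+ 2).
  by apply: eq_bigr => k _; ring.
rewrite big_split /= sumrB -mulr_sumr -/S sum_const /m.
by field; rewrite nat1r gt_eqF.
Qed.

(** The squared distance from [x] to the constant vectors. *)
Definition osc2 x := sqn x - N%:R * mean x ^+ 2.

Lemma osc2_ge0 x : 0 <= osc2 x.
Proof.
have := sum_sqr_centered (fun k => x 0 k); rewrite sum_mean /osc2 /sqn.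
by congr (_ <= _ - _); field; rewrite nat1r gt_eqF.
Qed.

Lemma diff2_ge0 x : 0 <= diff2 x.
Proof. by apply: sumr_ge0 => k _; exact: sqr_ge0. Qed.

Lemma wirtinger x : 4 * sin (pi / N%:R) ^+ 2 * osc2 x <= diff2 x.
Proof.
have := discrete_wirtinger (fun k => x 0 k); rewrite sum_mean.
by congr (_ * (_ - _) <= _); field; rewrite nat1r gt_eqF.
Qed.

Lemma sub_coord_le x (k l : 'I_N) :
  `|x 0 k - x 0 l| <= \sum_(i < N) `|x 0 i - x 0 (ordS i)|.
Proof.
wlog kl : k l / (k <= l)%N.
  by move=> W; have [/W //|/ltnW/W] := leqP k l; rewrite distrC.
have step (j : nat) : (k <= j)%N -> (j < N)%N ->
    `|x 0 k - x 0 (inord j)| <= \sum_(k <= i < j) `|x 0 (inord i) - x 0 (ordS (inord i))|.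
  elim: j => [|j IH] kj jN.
    have -> : k = inord 0 by apply: val_inj; rewrite /= inordK //; move: kj; rewrite leqn0 => /eqP.
    by rewrite subrr normr0 big_geq // inordK.
  move: kj; rewrite leq_eqVlt => /orP[/eqP kj|kj].
    by rewrite -kj inord_val subrr normr0 big_geq.
  rewrite big_nat_recr //=.
  have -> : x 0 k - x 0 (inord j.+1) =
      (x 0 k - x 0 (inord j)) + (x 0 (inord j) - x 0 (inord j.+1)) by ring.
  apply: (le_trans (ler_normD _ _)); apply: lerD; first by apply: IH => //; exact: ltnW.
  rewrite (_ : inord j.+1 = ordS (inord j)) //.
  by apply: val_inj; rewrite /= !inordK // ?modn_small // ltnW.
have := step l kl (ltn_ord l); rewrite inord_val => /le_trans; apply.
rewrite [leRHS](_ : _ = \sum_(0 <= i < N) `|x 0 (inord i) - x 0 (ordS (inord i))|); last first.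
  by rewrite big_mkord; apply: eq_bigr => i _; rewrite inord_val.
rewrite (big_cat_nat (leq0n k) (ltnW (ltn_ord k))) /=.
rewrite (big_cat_nat kl (ltnW (ltn_ord l))) /= addrCA lerDl.
by rewrite addr_ge0 // sumr_ge0.
Qed.

(** Average [sub_coord_le] over [l], then apply Cauchy-Schwarz to the [N] increments. *)
Lemma sub_mean_sq_le x (k : 'I_N) : (x 0 k - mean x) ^+ 2 <= N%:R * diff2 x.
Proof.
set T := \sum_(i < N) `|x 0 i - x 0 (ordS i)|.
have T2 : T ^+ 2 <= N%:R * diff2 x.
  have := sum_sqr_centered (fun i => `|x 0 i - x 0 (ordS i)|).
  rewrite -/T subr_ge0 ler_pdivrMr // mulrC.
  by congr (_ <= _ * _); apply: eq_bigr => i _; rewrite real_normK // num_real.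
apply: le_trans T2.
rewrite -[leLHS]real_normK ?num_real // ler_sqr ?nnegrE ?sumr_ge0 //.
have -> : x 0 k - mean x = (\sum_(l < N) (x 0 k - x 0 l)) / N%:R.
  rewrite sumrB sum_const sum_mean.
  by field; rewrite nat1r gt_eqF.
rewrite normrM normfV (ger0_norm (ltW N0)) ler_pdivrMr //.
apply: (le_trans (ler_norm_sum _ _ _)).
apply: (@le_trans _ _ (\sum_(l < N) T)).
  by apply: ler_sum => l _; exact: sub_coord_le.
by rewrite sum_const mulrC.
Qed.

Variables (mu s : R).
Hypothesis hmu : 1 < mu.
Hypothesis s0 : 0 < s.
Hypothesis smu : s <= mu - 1.

Definition stiffness : R := mu / (8 * sin (pi / N%:R) ^+ 2).
(** The quadratic part of the tilted potential: the wells give [- sqn / 2], and the tilt turns the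
    coefficient of [N mean^2] from [- 1 / 2] into [s / 2]. *)
Definition qform x := stiffness * diff2 x - 2^-1 * osc2 x + s * N%:R / 2 * mean x ^+ 2.

Let sin_pos : (0 < n)%N -> 0 < sin (pi / N%:R : R).
Proof.
move=> n0; apply: sin_gt0_pi; rewrite divr_gt0 ?pi_gt0 //=.
by rewrite ltr_pdivrMr // ltr_pMr ?pi_gt0 // ltr1n ltnS.
Qed.

Lemma osc2_N1 x : n = 0%N -> osc2 x = 0.
Proof.
move=> n0; apply/eqP; rewrite eq_le osc2_ge0 andbT /osc2 /sqn.
have e k : x 0 k = mean x.
  rewrite /mean (eq_bigr (fun=> x 0 k)).
    by rewrite sum_const mulrC mulKf // gt_eqF.
  move=> l _; congr (x 0 _); apply: val_inj => /=.
  by have := ltn_ord l; have := ltn_ord k; lia.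
rewrite (eq_bigr (fun=> mean x ^+ 2)); last by move=> k _; rewrite e.
by rewrite sum_const subrr.
Qed.

Lemma stiffness_ge0 : 0 <= stiffness.
Proof.
rewrite /stiffness divr_ge0 //; first by move: hmu; lra.
by rewrite mulr_ge0 // sqr_ge0.
Qed.

Lemma stiffness_osc2 x : mu / 2 * osc2 x <= stiffness * diff2 x.
Proof.
have M1 := hmu; have S1 := s0; have S2 := smu.
(* For [N = 1] the sine vanishes and [stiffness] is a division by zero, hence 0; the bound survives
   because [osc2] is 0 as well. *)
have [n0|n0] := posnP n.
  by rewrite osc2_N1 // mulr0 mulr_ge0 ?stiffness_ge0 ?diff2_ge0.
have sp := sin_pos n0; have W := wirtinger x.
rewrite /stiffness [leRHS]mulrAC ler_pdivlMr; last by rewrite mulr_gt0 // exprn_gt0.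
have -> : mu / 2 * osc2 x * (8 * sin (pi / N%:R) ^+ 2) =
  mu * (4 * sin (pi / N%:R) ^+ 2 * osc2 x) by field.
by rewrite ler_pM2l //; lra.
Qed.

(** Wirtinger spends the fraction [1 / mu] of the interaction on the concave term; the rest is kept
    for [sobolev]. *)
Lemma qform_ge x : (1 - mu^-1) * (stiffness * diff2 x) + s * N%:R / 2 * mean x ^+ 2 <= qform x.
Proof.
have M1 := hmu; have S1 := s0; have S2 := smu.
rewrite /qform lerD2r mulrBl mul1r lerD2l lerN2.
have mu0 : 0 < mu by lra.
rewrite -(ler_pM2l mu0) mulrA mulrA divff ?gt_eqF // mul1r.
exact: stiffness_osc2.
Qed.

Lemma qform_sqn x : s / 2 * sqn x <= qform x.
Proof.
have M1 := hmu; have S1 := s0; have S2 := smu.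
have A := stiffness_osc2 x; have B := osc2_ge0 x.
have -> : sqn x = osc2 x + N%:R * mean x ^+ 2 by rewrite /osc2 subrK.
rewrite /qform.
have : s * osc2 x <= (mu - 1) * osc2 x by rewrite ler_wpM2r.
lra.
Qed.

Lemma qform_ge0 x : 0 <= qform x.
Proof. by apply: le_trans (qform_sqn x); rewrite mulr_ge0 ?sqn_ge0 // divr_ge0 // ltW. Qed.

(** Twice the constants of [Bm] (mean) and [By] (oscillation) in [sobolev]. *)
Definition C_sob : R := 4 / s + 16 * pi ^+ 2 / (mu - 1).

Lemma C_sob_gt0 : 0 < C_sob.
Proof.
have M1 := hmu; have S1 := s0; have S2 := smu.
rewrite /C_sob; have p0 := pi_gt0 R.
by rewrite addr_gt0 ?divr_gt0 ?mulr_gt0 ?exprn_gt0 //; lra.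
Qed.

Lemma sin_le (t : R) : 0 <= t -> sin t <= t.
Proof.
rewrite le_eqVlt => /predU1P[<-|t0]; first by rewrite sin0.
have [|c _] := @MVT_segment R (@sin R) (@cos R) 0 t (ltW t0).
  by apply: continuous_subspaceT; exact: continuous_sin.
rewrite sin0 !subr0 => ->.
by rewrite -[leRHS]mul1r ler_pM2r // cos_le1.
Qed.

(** Uniform in [N] because [sin (pi / N) <= pi / N] makes [stiffness] of order at least [N^2], just
    what [sub_mean_sq_le], multiplied by [N], requires. *)
Lemma sobolev x (k : 'I_N) : N%:R * x 0 k ^+ 2 <= C_sob * qform x.
Proof.
have M1 := hmu; have S1 := s0; have S2 := smu.
have Q := qform_ge x; have D0 := diff2_ge0 x; have Q0 := qform_ge0 x.
have mu1 : 0 < mu - 1 by lra.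
have p0 := pi_gt0 R.
have Bm : N%:R * mean x ^+ 2 <= 2 / s * qform x.
  have : 0 <= (1 - mu^-1) * (stiffness * diff2 x).
    apply: mulr_ge0; first by rewrite subr_ge0 invf_le1; lra.
    by rewrite mulr_ge0 ?stiffness_ge0.
  move=> H; rewrite [leRHS]mulrAC ler_pdivlMr //; lra.
have By : N%:R * (N%:R * diff2 x) <= 8 * pi ^+ 2 / (mu - 1) * qform x.
  have [n0|n0] := posnP n.
    have -> : diff2 x = 0.
      rewrite /diff2 big1 // => k' _; rewrite (_ : ordS k' = k') ?subrr ?expr0n //.
      apply: ord_inj; have := ltn_ord k'; have := ltn_ord (ordS k'); lia.
    by rewrite !mulr0 mulr_ge0 // divr_ge0 ?mulr_ge0 ?sqr_ge0 // ltW.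
  have sp := sin_pos n0.
  have s2 : sin (pi / N%:R) ^+ 2 <= pi ^+ 2 / N%:R ^+ 2 :> R.
    have pN : 0 <= pi / N%:R :> R by rewrite divr_ge0 // ltW.
    by rewrite -expr_div_n; apply: lerXn2r; rewrite ?nnegrE ?(ltW sp) //; exact: sin_le.
  have H : (mu - 1) * (N%:R * (N%:R * diff2 x)) <= 8 * pi ^+ 2 * ((1 - mu^-1) * (stiffness * diff2 x)).
    have -> : 8 * pi ^+ 2 * ((1 - mu^-1) * (stiffness * diff2 x)) =
      (mu - 1) * diff2 x * (pi ^+ 2 / sin (pi / N%:R) ^+ 2).
      rewrite /stiffness; field; rewrite !gt_eqF //; lra.
    have -> : (mu - 1) * (N%:R * (N%:R * diff2 x)) = (mu - 1) * diff2 x * N%:R ^+ 2 by ring.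
    apply: ler_wpM2l; first by rewrite mulr_ge0 // ltW.
    rewrite ler_pdivlMr ?exprn_gt0 // mulrC -ler_pdivlMr ?exprn_gt0 //.
  rewrite [leRHS]mulrAC ler_pdivlMr // mulrC; apply: (le_trans H).
  rewrite ler_pM2l; last by rewrite mulr_gt0 // exprn_gt0.
  apply: le_trans Q; rewrite lerDl mulr_ge0 ?sqr_ge0 //.
  by rewrite divr_ge0 // mulr_ge0 // ltW.
have C := sub_mean_sq_le x k.
have C' : N%:R * (x 0 k - mean x) ^+ 2 <= N%:R * (N%:R * diff2 x) by rewrite ler_pM2l.
have : N%:R * x 0 k ^+ 2 <= 2 * (N%:R * mean x ^+ 2) + 2 * (N%:R * (x 0 k - mean x) ^+ 2).
  have : 0 <= N%:R * (x 0 k - 2 * mean x) ^+ 2 by rewrite mulr_ge0 ?sqr_ge0 // ltW.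
  lra.
rewrite /C_sob; lra.
Qed.

End Potential.

(** * The tilted potential: joint convexity, expansion at constant vectors, growth *)

Section Tilted.
Variables (R : realType) (n : nat).
Local Notation N := n.+1.
Local Notation vec := 'rV[R]_N.
Implicit Types (x y z : vec) (mu s t m : R).

Let N0 : (0 : R) < N%:R. Proof. by rewrite ltr0n. Qed.

Definition tilted_V mu s t x := V_N mu x + N%:R * (1 + s) / 2 * (mean x - t) ^+ 2.

Lemma V_NE mu x : V_N mu x =
  \sum_(k < N) (x 0 k ^+ 4 / 4) - 2^-1 * sqn x + N%:R / 4 + stiffness n mu * diff2 x.
Proof.
rewrite /V_N -/(stiffness n mu) -/(diff2 x); congr (_ + _).
have -> : N%:R / 4 = \sum_(k < N) 4^-1 :> R by rewrite sum_const.
rewrite /sqn mulr_sumr -sumrB -big_split /=; apply: eq_bigr => k _; by field.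
Qed.

Lemma tilted_VE mu s t x : tilted_V mu s t x =
  \sum_(k < N) (x 0 k ^+ 4 / 4) + qform mu s x
  - N%:R * (1 + s) * t * mean x + N%:R * (1 + s) / 2 * t ^+ 2 + N%:R / 4.
Proof. by rewrite /tilted_V V_NE /qform /osc2; field. Qed.

Lemma mean_mid x y : mean (2^-1 *: (x + y)) = (mean x + mean y) / 2.
Proof. by rewrite scalerDr mean_lin -mulrDr mulrC. Qed.

Lemma mean_sub x y : mean (x - y) = mean x - mean y.
Proof. by have := mean_lin 1 (-1) x y; rewrite scale1r scaleN1r => ->; ring. Qed.

Lemma qform_parallelogram mu s x y :
  qform mu s x + qform mu s y - 2 * qform mu s (2^-1 *: (x + y)) = 2^-1 * qform mu s (x - y).
Proof.
have dP : diff2 x + diff2 y - 2 * diff2 (2^-1 *: (x + y)) = 2^-1 * diff2 (x - y).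
  rewrite /diff2 !mulr_sumr -big_split -sumrB /=.
  by apply: eq_bigr => k _; rewrite !mxE; field.
have sP : sqn x + sqn y - 2 * sqn (2^-1 *: (x + y)) = 2^-1 * sqn (x - y).
  rewrite /sqn !mulr_sumr -big_split -sumrB /=.
  by apply: eq_bigr => k _; rewrite !mxE; field.
rewrite /qform /osc2 mean_mid mean_sub.
apply: (@mulIf _ 2) => //.
transitivity (stiffness n mu * (2 * (diff2 x + diff2 y - 2 * diff2 (2^-1 *: (x + y))))
  - (sqn x + sqn y - 2 * sqn (2^-1 *: (x + y)))
  + (1 + s) * N%:R / 2 * (mean x - mean y) ^+ 2); first by field.
by rewrite dP sP; field.
Qed.

(** The quadratic part, jointly in [x] and the tilt, is computed by the parallelogram identity; the
    quartic part is midpoint convex and is dropped. *)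
Lemma tilted_V_convex mu s t t' x y :
  2^-1 * qform mu s (x - y) - N%:R * (1 + s) / 2 * (t - t') * mean (x - y)
    + N%:R * (1 + s) / 4 * (t - t') ^+ 2 <=
  tilted_V mu s t x + tilted_V mu s t' y - 2 * tilted_V mu s ((t + t') / 2) (2^-1 *: (x + y)).
Proof.
have Q4 : 0 <= \sum_(k < N) (x 0 k ^+ 4 / 4) + \sum_(k < N) (y 0 k ^+ 4 / 4)
    - 2 * \sum_(k < N) ((2^-1 *: (x + y)) 0 k ^+ 4 / 4).
  rewrite mulr_sumr -big_split -sumrB /=; apply: sumr_ge0 => k _; rewrite !mxE.
  move: (x 0 k) (y 0 k) => a b.
  have -> : a ^+ 4 / 4 + b ^+ 4 / 4 - 2 * ((2^-1 * (a + b)) ^+ 4 / 4) =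
    (a - b) ^+ 2 * (6 * (a + b) ^+ 2 + (a - b) ^+ 2) / 32 by field.
  by apply: divr_ge0 => //; apply: mulr_ge0; rewrite ?sqr_ge0 //; apply: addr_ge0; rewrite ?sqr_ge0 //; apply: mulr_ge0; rewrite ?sqr_ge0.
rewrite -qform_parallelogram !tilted_VE mean_mid mean_sub -subr_ge0.
apply: le_trans Q4 _; rewrite le_eqVlt; apply/orP; left; apply/eqP; by field.
Qed.

(* Expansion of [tilted_V mu s t] around the constant vector [m], the minimizer of
   [psi0 s t] when [m ^+ 3 + s * m = (1 + s) * t]. *)
Definition psi0 s t m := 4^-1 * (m ^+ 2 - 1) ^+ 2 + (1 + s) / 2 * (m - t) ^+ 2.
Definition rem m z := \sum_(k < N) (3 / 2 * m ^+ 2 * z 0 k ^+ 2 + m * z 0 k ^+ 3 + z 0 k ^+ 4 / 4).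

Lemma tilted_V_shift mu s t m z : m ^+ 3 + s * m = (1 + s) * t ->
  tilted_V mu s t (z + const_mx m) = N%:R * psi0 s t m + qform mu s z + rem m z.
Proof.
move=> mt.
have mE : mean (z + const_mx m) = mean z + m.
  by have := mean_lin 1 1 z (const_mx m); rewrite !scale1r mean_const !mul1r.
have dE : diff2 (z + const_mx m) = diff2 z.
  by apply: eq_bigr => k _; rewrite !mxE; congr (_ ^+ 2); ring.
have sE : \sum_(k < N) (4^-1 * ((z + const_mx m) 0 k ^+ 2 - 1) ^+ 2) =
    rem m z - 2^-1 * sqn z + (m ^+ 3 - m) * (N%:R * mean z) + N%:R * (4^-1 * (m ^+ 2 - 1) ^+ 2).
  rewrite -sum_mean -sum_const /rem /sqn !mulr_sumr -sumrB -!big_split /=.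
  by apply: eq_bigr => k _; rewrite !mxE; field.
rewrite /tilted_V /V_N -/(stiffness n mu) -/(diff2 _) dE mE sE /qform /osc2 /psi0.
have -> : m ^+ 3 = (1 + s) * t - s * m by rewrite -mt; ring.
by field.
Qed.

Lemma rem_ge0 m z : 0 <= rem m z.
Proof.
apply: sumr_ge0 => k _; move: (z 0 k) => a.
have -> : 3 / 2 * m ^+ 2 * a ^+ 2 + m * a ^+ 3 + a ^+ 4 / 4 =
  (a ^+ 2 / 2 + m * a) ^+ 2 + (m * a) ^+ 2 / 2 by field.
by rewrite addr_ge0 ?divr_ge0 ?sqr_ge0.
Qed.

(** The cubic term is absorbed by [m a^3 <= m^2 a^2 + a^4 / 4], so that only second and fourth
    moments are needed later. *)
Lemma rem_le m z : rem m z <=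
  \sum_(k < N) (5 / 2 * m ^+ 2 * z 0 k ^+ 2 + 2^-1 * z 0 k ^+ 4).
Proof.
apply: ler_sum => k _; move: (z 0 k) => a.
have : 0 <= (m * a - a ^+ 2 / 2) ^+ 2 by exact: sqr_ge0.
have -> : (m * a - a ^+ 2 / 2) ^+ 2 = m ^+ 2 * a ^+ 2 - m * a ^+ 3 + a ^+ 4 / 4 by field.
lra.
Qed.

Lemma Nmean2_le x : N%:R * mean x ^+ 2 <= sqn x.
Proof. by rewrite -subr_ge0; exact: osc2_ge0. Qed.

(** A crude growth bound, meant for integrability: its loss of order [N t^2] never enters the
    estimates. *)
Lemma tilted_V_ge mu s t x : 1 < mu -> 0 < s -> s <= mu - 1 ->
  s / 4 * sqn x - N%:R * (1 + s) ^+ 2 * t ^+ 2 / s <= tilted_V mu s t x.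
Proof.
move=> mu1 s0 smu; rewrite tilted_VE.
have Q := qform_sqn mu1 s0 smu x; have M := Nmean2_le x.
have P4 : 0 <= \sum_(k < N) (x 0 k ^+ 4 / 4).
  apply: sumr_ge0 => k _; rewrite divr_ge0 // (_ : x 0 k ^+ 4 = (x 0 k ^+ 2) ^+ 2) ?sqr_ge0 //.
  by rewrite -exprM.
have T : 0 <= N%:R * (1 + s) / 2 * t ^+ 2.
  by rewrite mulr_ge0 ?sqr_ge0 // divr_ge0 // mulr_ge0 ?(ltW N0) //; lra.
have Y : N%:R * (1 + s) * t * mean x <= s / 4 * (N%:R * mean x ^+ 2) + N%:R * (1 + s) ^+ 2 * t ^+ 2 / s.
  have : 0 <= N%:R * s / 4 * (mean x - 2 * (1 + s) * t / s) ^+ 2.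
    by rewrite mulr_ge0 ?sqr_ge0 // divr_ge0 // mulr_ge0 ?ltW.
  have -> : N%:R * s / 4 * (mean x - 2 * (1 + s) * t / s) ^+ 2 =
    s / 4 * (N%:R * mean x ^+ 2) + N%:R * (1 + s) ^+ 2 * t ^+ 2 / s - N%:R * (1 + s) * t * mean x.
    by field; lra.
  lra.
have : s / 4 * (N%:R * mean x ^+ 2) <= s / 4 * sqn x by rewrite ler_wpM2l //; lra.
have := ltW N0; lra.
Qed.

Lemma V_N_ge mu x : 0 <= stiffness n mu -> sqn x - 2 * N%:R <= V_N mu x.
Proof.
move=> st; rewrite /V_N -/(stiffness n mu) -/(diff2 x).
apply: (@le_trans _ _ (\sum_(k < N) (4^-1 * (x 0 k ^+ 2 - 1) ^+ 2))); last first.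
  by rewrite lerDl mulr_ge0 ?diff2_ge0.
have -> : 2 * N%:R = \sum_(k < N) 2 :> R by rewrite sum_const mulrC.
rewrite /sqn -sumrB; apply: ler_sum => k _; move: (x 0 k) => a.
have : 0 <= (a ^+ 2 - 3) ^+ 2 by exact: sqr_ge0.
have -> : (a ^+ 2 - 3) ^+ 2 = 4 * (4^-1 * (a ^+ 2 - 1) ^+ 2) - 4 * a ^+ 2 + 8 by field.
lra.
Qed.

Lemma continuous_pow (T : topologicalType) (f : T -> R) k :
  continuous f -> continuous (fun u => f u ^+ k).
Proof.
move=> cf; elim: k => [|k IH]; first by under eq_fun do rewrite expr0; exact: continuous_const.
by under eq_fun do rewrite exprS; exact: continuous_mul.
Qed.

Lemma continuous_sqn : continuous (@sqn R N).
Proof. by apply: continuous_sum => k; apply: continuous_pow; exact: continuous_coord. Qed.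

Lemma continuous_mean : continuous (@mean R n).
Proof.
apply: continuous_mul; last exact: continuous_const.
by apply: continuous_sum => k; exact: continuous_coord.
Qed.

Lemma continuous_diff2 : continuous (@diff2 R n).
Proof.
apply: continuous_sum => k; apply: continuous_pow; apply: continuous_add.
  exact: continuous_coord.
by apply: continuous_opp; exact: continuous_coord.
Qed.

Lemma continuous_V_N mu : continuous (@V_N R mu N).
Proof.
apply: continuous_add; last by apply: continuous_mul; [exact: continuous_const | exact: continuous_diff2].
apply: continuous_sum => k; apply: continuous_mul; first exact: continuous_const.
apply: continuous_pow; apply: continuous_add; last exact: continuous_const.
by apply: continuous_pow; exact: continuous_coord.
Qed.

Lemma continuous_tilted_V mu s t : continuous (tilted_V mu s t).
Proof.
apply: continuous_add; first exact: continuous_V_N.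
apply: continuous_mul; first exact: continuous_const.
apply: continuous_pow; apply: continuous_add; first exact: continuous_mean.
exact: continuous_const.
Qed.

Lemma continuous_qform mu s : continuous (@qform R n mu s).
Proof.
apply: continuous_add; last first.
  apply: continuous_mul; first exact: continuous_const.
  by apply: continuous_pow; exact: continuous_mean.
apply: continuous_add.
  by apply: continuous_mul; [exact: continuous_const | exact: continuous_diff2].
apply: continuous_opp; apply: continuous_mul; first exact: continuous_const.
apply: continuous_add; first exact: continuous_sqn.
apply: continuous_opp; apply: continuous_mul; first exact: continuous_const.
by apply: continuous_pow; exact: continuous_mean.
Qed.

Lemma continuous_rem m : continuous (rem m).
Proof.
apply: continuous_sum => k; apply: continuous_add; last first.
  apply: continuous_mul; last exact: continuous_const.
  by apply: continuous_pow; exact: continuous_coord.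
apply: continuous_add; apply: continuous_mul; try exact: continuous_const;
  by apply: continuous_pow; exact: continuous_coord.
Qed.

End Tilted.

(** * Poincare inequality for log-concave weights *)

Section Poincare.
Variable R : realType.

(** The square of [1 + X / 2 <= exp (X / 2)]. The coefficient 1/4 in place of 1/2 only costs a
    constant factor in the Poincare inequality. *)
Lemma expR_ge_quadratic (X : R) : -2 <= X -> 1 + X + X ^+ 2 / 4 <= expR X.
Proof.
move=> X2; have -> : 1 + X + X ^+ 2 / 4 = (1 + X / 2) ^+ 2 by field.
have -> : expR X = expR (X / 2) ^+ 2 by rewrite expr2 -expRD; congr expR; field.
apply: lerXn2r; rewrite ?nnegrE ?expR_ge0 //; last exact: expR_ge1Dx.
lra.
Qed.

Lemma le0_of_small_multiples (Y Z t0 : R) : 0 < t0 ->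
  (forall t, 0 < t -> t <= t0 -> Y <= t * Z) -> Y <= 0.
Proof.
move=> t00 H; rewrite leNgt; apply/negP => Y0.
pose t := Num.min t0 (Y / (2 * (`|Z| + 1))).
have Z1 : 0 < 2 * (`|Z| + 1) by rewrite mulr_gt0 // ltr_wpDl.
have tp : 0 < t by rewrite lt_min t00 divr_gt0.
have := H t tp; rewrite ge_min lexx => /(_ isT).
have tY : t <= Y / (2 * (`|Z| + 1)) by rewrite ge_min lexx orbT.
have : t * (2 * (`|Z| + 1)) <= Y by rewrite -ler_pdivlMr.
have : t * Z <= t * `|Z| by rewrite ler_wpM2l ?ler_norm // ltW.
nra.
Qed.

Variable N : nat.
Local Notation vec := 'rV[R]_N.
Implicit Types (x y : vec).

(* Prekopa-Leindler for [exp (t f - t^2 b) G], [exp (- t f) G] and [G], where [b] is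
   a multiple of [|grad f|^2], expanded to second order as [t] tends to 0. *)
Lemma poincare (G f : vec -> R) (g : 'I_N -> vec -> R) (kappa M0 M1 M F : R) :
  gdomV G -> (forall x, 0 < G x) -> 0 < kappa ->
  (forall x y, G x * G y <= G (2^-1 *: (x + y)) ^+ 2 * expR (- (kappa / 4 * sqn (x - y)))) ->
  continuous f -> (forall x, `|f x| <= M0) ->
  (forall i, continuous (g i)) -> (forall i x, `|g i x| <= M1) ->
  0 <= M -> (forall x y, f x - f y <=
    \sum_(i < N) g i x * (x - y) 0 i + M / 2 * sqn (x - y)) ->
  intV (fun x => f x * G x) = F * intV G ->
  intV (fun x => (f x - F) ^+ 2 * G x) <=
  4 / kappa * intV (fun x => (\sum_(i < N) g i x ^+ 2) * G x).
Proof.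
move=> dG G0 k0 GG cf fM cg gM M0' fT FE.
set W := fun x => \sum_(i < N) g i x ^+ 2.
set a2 := intV _; set B := intV _; set p := intV G.
have p0 : 0 < p by apply: (intV_gt0 (x := 0)) => // x; exact: ltW.
have cW : continuous W by apply: continuous_sum => i; apply: continuous_mul.
pose f0 x := f x - F.
have cf0 : continuous f0 by apply: continuous_add => //; exact: continuous_const.
pose K0 := M0 + `|F|.
have f0K x : `|f0 x| <= K0 by apply: (le_trans (ler_normB _ _)); rewrite lerD2r.
have K00 : 0 <= K0 by exact: le_trans (f0K 0).
pose W0 := N%:R * M1 ^+ 2.
have Wge0 x : 0 <= W x by apply: sumr_ge0 => i _; exact: sqr_ge0.
have WW0 x : W x <= W0.
  rewrite /W0 -[N in N%:R]card_ord -sumr_const mulr_suml; apply: ler_sum => i _.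
  rewrite mul1r -real_normK ?num_real //; apply: lerXn2r; rewrite ?nnegrE //.
  exact: le_trans (gM i x).
have W00 : 0 <= W0 by exact: le_trans (WW0 0).
have sgf : subgauss f0 by exact: subgauss_bounded f0K.
have sgW : subgauss W.
  by apply: (@subgauss_bounded _ _ W W0) => // x; rewrite ger0_norm.
have d1 : gdomV (fun x => f0 x * G x) by exact: gdomV_mul.
have d2 : gdomV (fun x => f0 x ^+ 2 * G x) by apply: gdomV_mul => //; exact: subgaussM.
have dW : gdomV (fun x => W x * G x) by exact: gdomV_mul.
have a1 : intV (fun x => f0 x * G x) = 0.
  have df : gdomV (fun x => f x * G x) by apply: gdomV_mul => //; exact: subgauss_bounded fM.
  rewrite (@eq_intV _ _ _ (fun x => 1 * (f x * G x) + (- F) * G x)); last first.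
    by move=> x; rewrite /f0; ring.
  by rewrite intV_lin // mul1r FE mulNr subrr.
have a20 : 0 <= a2 by apply: intV_ge0 => x; rewrite mulr_ge0 ?sqr_ge0 // ltW.
have B0 : 0 <= B by apply: intV_ge0 => x; apply: mulr_ge0; [exact: Wge0 | exact: ltW].
(* [K] bounds the cross term of [X ^+ 2 / 4], which is of order [t^3]. *)
pose K := K0 * W0 / kappa.
have Kge0 : 0 <= K by apply: divr_ge0; [exact: mulr_ge0 | exact: ltW].
pose A0 := 2 / kappa * B + K * p.
have k20 : 0 <= 2 / kappa by apply: divr_ge0 => //; exact: ltW.
have A00 : 0 <= A0 by apply: addr_ge0; apply: mulr_ge0 => //; exact: ltW.
pose K1 := K0 + 2 * W0 / kappa.
have KW0 : 0 <= 2 * W0 / kappa by apply: divr_ge0; [exact: mulr_ge0 | exact: ltW].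
have K10 : 0 <= K1 by apply: addr_ge0.
(* The bounds on [t] give, in turn, [t^2 <= t], control of the Taylor remainder, [X >= - 2] for
   [expR_ge_quadratic], and nonnegativity of the lower bound of [intV u]. *)
pose t0 := Num.min (Num.min 1 (kappa / (4 * (M + 1)))) (Num.min (2 / (K1 + 1)) (p / (A0 + 1))).
have t00 : 0 < t0.
  by rewrite !lt_min ltr01 !divr_gt0 ?mulr_gt0 //; lra.
suff : p * (a2 / 2 - 2 / kappa * B) <= 0.
  rewrite pmulr_rle0 // => H.
  have -> : 4 / kappa = 2 * (2 / kappa) by field; lra.
  lra.
apply: (le0_of_small_multiples (Z := K * p ^+ 2 + A0 * a2 / 4) t00) => t tp.
rewrite !le_min => /andP[/andP[t1 tM] /andP[tK tA]].
have {}tM : t * M <= kappa / 4.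
  have : t * (4 * (M + 1)) <= kappa by rewrite -ler_pdivlMr //; lra.
  lra.
have {}tK : t * K1 <= 2.
  have : t * (K1 + 1) <= 2 by rewrite -ler_pdivlMr //; lra.
  lra.
have {}tA : t * A0 <= p.
  have : t * (A0 + 1) <= p by rewrite -ler_pdivlMr //; lra.
  lra.
have t2 : t ^+ 2 <= t by rewrite expr2 ler_piMr // ltW.
(* [2 / kappa] is the coefficient that completes the square of [t g d] against [kappa / 8 * d^2]. *)
pose X x := t * f0 x - t ^+ 2 * (2 / kappa) * W x.
pose u x := expR (X x) * G x; pose v x := expR (- (t * f0 x)) * G x.
have XK x : `|X x| <= t * K1.
  have tW : 0 <= t ^+ 2 * (2 / kappa) * W x.
    by apply: mulr_ge0 => //; apply: mulr_ge0 => //; exact: sqr_ge0.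
  apply: (le_trans (ler_normB _ _)); rewrite (ger0_norm tW) normrM (gtr0_norm tp).
  rewrite /K1 mulrDr; apply: lerD.
    by apply: ler_wpM2l => //; exact: ltW.
  rewrite -(mulrA (t ^+ 2)); apply: ler_pM => //.
  - exact: sqr_ge0.
  - exact: mulr_ge0.
  - by rewrite [leRHS]mulrAC; apply: ler_wpM2l.
have cX : continuous X.
  apply: continuous_add; first by apply: continuous_mul => //; exact: continuous_const.
  by apply: continuous_opp; apply: continuous_mul => //; exact: continuous_const.
have du : gdomV u.
  apply: gdomV_mul => //; apply: (@subgauss_bounded _ _ _ (expR (t * K1))).
    exact: continuous_exp.
  move=> x; rewrite ger0_norm ?expR_ge0 // ler_expR.
  exact: le_trans (ler_norm _) (XK x).
have dv : gdomV v.
  apply: gdomV_mul => //; apply: (@subgauss_bounded _ _ _ (expR (t * K0))).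
    apply: continuous_exp; apply: continuous_opp; apply: continuous_mul => //.
    exact: continuous_const.
  move=> x; rewrite ger0_norm ?expR_ge0 // ler_expR -mulrN.
  apply: ler_wpM2l; first exact: ltW.
  by rewrite (le_trans (ler_norm _)) // normrN.
have PL : intV u * intV v <= p ^+ 2.
  apply: intV_prekopa_leindler => //.
  - by move=> x; rewrite mulr_gt0 // expR_gt0.
  - by move=> x; rewrite mulr_gt0 // expR_gt0.
  - by move=> x; exact: ltW.
  move=> x y; rewrite /u /v mulrACA -expRD.
  apply: (@le_trans _ _ (expR (kappa / 4 * sqn (x - y)) * (G x * G y))).
    apply: ler_wpM2r; first by rewrite mulr_ge0 // ltW.
    rewrite ler_expR /X.
    have -> : t * f0 x - t ^+ 2 * (2 / kappa) * W x + - (t * f0 y) =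
      t * (f x - f y) - t ^+ 2 * (2 / kappa) * W x by rewrite /f0; ring.
    have := fT x y; rewrite -(ler_pM2l tp) => h1.
    (* The convexity gain [kappa / 4] is split evenly: one half absorbs the gradient term, the
       other, through [t M <= kappa / 4], the Taylor remainder. *)
    have h2 : t * (\sum_(i < N) g i x * (x - y) 0 i) <=
        kappa / 8 * sqn (x - y) + t ^+ 2 * (2 / kappa) * W x.
      rewrite /W /sqn !mulr_sumr -big_split /=; apply: ler_sum => i _.
      move: ((x - y) 0 i) (g i x) => d gi.
      have : 0 <= kappa / 8 * (d - 4 * t * gi / kappa) ^+ 2.
        by rewrite mulr_ge0 ?sqr_ge0 // divr_ge0 // ltW.
      have -> : kappa / 8 * (d - 4 * t * gi / kappa) ^+ 2 =
        kappa / 8 * d ^+ 2 - t * (gi * d) + t ^+ 2 * (2 / kappa) * gi ^+ 2 by field; lra.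
      lra.
    have h3 : t * M * sqn (x - y) <= kappa / 4 * sqn (x - y).
      by apply: ler_wpM2r => //; exact: sqn_ge0.
    lra.
  rewrite mulrC -ler_pdivlMr ?expR_gt0 // -expRN; exact: GG.
have Lu : p - t ^+ 2 * (2 / kappa) * B + t ^+ 2 * a2 / 4 - t ^+ 3 * K * p <= intV u.
  have -> : p - t ^+ 2 * (2 / kappa) * B + t ^+ 2 * a2 / 4 - t ^+ 3 * K * p =
      intV (fun x => 1 * ((1 - t ^+ 3 * K) * G x + t * (f0 x * G x)) +
        1 * ((- (t ^+ 2 * (2 / kappa))) * (W x * G x) + t ^+ 2 / 4 * (f0 x ^+ 2 * G x))).
    rewrite intV_lin; [|exact: gdomV_lin|exact: gdomV_lin].
    rewrite !intV_lin // a1 -/a2 -/B -/p; ring.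
  apply: le_intV => //; first by apply: gdomV_lin; exact: gdomV_lin.
  move=> x; rewrite /u.
  have -> : 1 * ((1 - t ^+ 3 * K) * G x + t * (f0 x * G x)) +
        1 * ((- (t ^+ 2 * (2 / kappa))) * (W x * G x) + t ^+ 2 / 4 * (f0 x ^+ 2 * G x)) =
    (1 + X x + t ^+ 2 * f0 x ^+ 2 / 4 - t ^+ 3 * K) * G x by rewrite /X; ring.
  apply: ler_wpM2r; first exact: ltW.
  apply: le_trans (expR_ge_quadratic (X := X x) _); last first.
    by have := XK x; rewrite ler_norml => /andP[+ _]; lra.
  rewrite -addrA lerD2l.
  have : t * f0 x * W x <= t * K0 * W0.
    rewrite -!mulrA; apply: ler_wpM2l; first exact: ltW.
    apply: (@le_trans _ _ (K0 * W x)); last exact: ler_wpM2l.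
    by apply: ler_wpM2r => //; exact: le_trans (ler_norm _) (f0K x).
  have q0 : 0 <= t ^+ 2 * kappa^-1 by rewrite mulr_ge0 ?sqr_ge0 // invr_ge0 ltW.
  move=> /(ler_wpM2l q0).
  have : 0 <= (t ^+ 2 * (2 / kappa) * W x) ^+ 2 by exact: sqr_ge0.
  have -> : X x ^+ 2 = t ^+ 2 * f0 x ^+ 2 - 4 * (t ^+ 2 / kappa * (t * f0 x * W x)) +
    (t ^+ 2 * (2 / kappa) * W x) ^+ 2 by rewrite /X; field; lra.
  have -> : t ^+ 3 * K = t ^+ 2 / kappa * (t * K0 * W0) by rewrite /K; field; lra.
  lra.
have Lv : p + t ^+ 2 * a2 / 4 <= intV v.
  have -> : p + t ^+ 2 * a2 / 4 =
      intV (fun x => 1 * (1 * G x + (- t) * (f0 x * G x)) + t ^+ 2 / 4 * (f0 x ^+ 2 * G x)).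
    rewrite intV_lin //; last exact: gdomV_lin.
    rewrite !intV_lin // a1 -/a2 -/p; ring.
  apply: le_intV => //; first by apply: gdomV_lin => //; exact: gdomV_lin.
  move=> x; rewrite /v.
  have -> : 1 * (1 * G x + (- t) * (f0 x * G x)) + t ^+ 2 / 4 * (f0 x ^+ 2 * G x) =
    (1 + (- (t * f0 x)) + (- (t * f0 x)) ^+ 2 / 4) * G x by ring.
  apply: ler_wpM2r; first exact: ltW.
  apply: expR_ge_quadratic.
  have : t * f0 x <= t * K1.
    apply: ler_wpM2l; first exact: ltW.
    apply: (le_trans (ler_norm _)); apply: (le_trans (f0K x)).
    by rewrite /K1 lerDl.
  lra.
set A := a2 / 4 - 2 / kappa * B - t * K * p.
have AA0 : - A0 <= A.
  have : t * (K * p) <= 1 * (K * p) by apply: ler_wpM2r => //; rewrite mulr_ge0 // ltW.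
  rewrite /A /A0; lra.
have LuE : p + t ^+ 2 * A <= intV u by apply: le_trans Lu; rewrite /A le_eqVlt; apply/orP; left; apply/eqP; ring.
(* The lower bounds of the two integrals can be multiplied only if they are nonnegative. *)
have LuP : 0 <= p + t ^+ 2 * A.
  have : t ^+ 2 * (- A0) <= t ^+ 2 * A by apply: ler_wpM2l => //; exact: sqr_ge0.
  have : t ^+ 2 * A0 <= t * A0 by apply: ler_wpM2r.
  lra.
have P2 : (p + t ^+ 2 * A) * (p + t ^+ 2 * a2 / 4) <= p ^+ 2.
  apply: le_trans PL; apply: ler_pM => //.
  by rewrite addr_ge0 ?(ltW p0) // divr_ge0 // mulr_ge0 // sqr_ge0.
have t2p : 0 < t ^+ 2 by rewrite exprn_gt0.
(* Divided by [t^2], this is the Poincare inequality up to terms that vanish with [t]. *)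
have P3 : p * (A + a2 / 4) + t ^+ 2 * (A * (a2 / 4)) <= 0.
  rewrite -(pmulr_rle0 _ t2p); have -> : t ^+ 2 * (p * (A + a2 / 4) + t ^+ 2 * (A * (a2 / 4))) =
    (p + t ^+ 2 * A) * (p + t ^+ 2 * a2 / 4) - p ^+ 2 by ring.
  by rewrite subr_le0.
have P4 : - (t * (A0 * a2 / 4)) <= t ^+ 2 * (A * (a2 / 4)).
  have e1 : - (A0 * (a2 / 4)) <= A * (a2 / 4).
    by rewrite -mulNr; apply: ler_wpM2r => //; rewrite divr_ge0.
  have e2 : t ^+ 2 * (A0 * (a2 / 4)) <= t * (A0 * (a2 / 4)).
    by apply: ler_wpM2r => //; rewrite mulr_ge0 // divr_ge0.
  have := ler_wpM2l (sqr_ge0 t) e1; lra.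
have P5 : p * (A + a2 / 4) = p * (a2 / 2 - 2 / kappa * B) - t * (K * p ^+ 2).
  by rewrite /A; field; lra.
lra.
Qed.

End Poincare.

(** * Masses of the tilted measures *)

Section Partition.
Variables (R : realType) (n : nat) (mu s h : R).
Local Notation N := n.+1.
Local Notation vec := 'rV[R]_N.
Implicit Types (x y z : vec) (t m : R).
Hypothesis mu1 : 1 < mu.
Hypothesis s0 : 0 < s.
Hypothesis smu : s <= mu - 1.
Hypothesis h0 : 0 < h.

Let N0 : (0 : R) < N%:R. Proof. by rewrite ltr0n. Qed.
Let hN : 0 < h * N%:R. Proof. by rewrite mulr_gt0. Qed.

Definition tilt t x := expR (- (tilted_V mu s t x / (h * N%:R))).
Definition tilt_mass t := intV (tilt t).
Definition gaussw x := expR (- (qform mu s x / (h * N%:R))).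
Definition gauss_mass := intV gaussw.

Lemma tilt_gt0 t x : 0 < tilt t x. Proof. exact: expR_gt0. Qed.

Lemma gdomV_tilt t : gdomV (tilt t).
Proof.
apply: (@gdomV_expR _ _ _ (s / 4 / (h * N%:R)) (N%:R * (1 + s) ^+ 2 * t ^+ 2 / s / (h * N%:R))).
- by apply: continuous_mul; [exact: continuous_tilted_V | exact: continuous_const].
- by rewrite !divr_gt0.
- move=> x; rewrite mulrAC -mulrBl ler_pM2r ?invr_gt0 //.
  exact: tilted_V_ge.
Qed.

Lemma gdomV_gaussw : gdomV gaussw.
Proof.
apply: (@gdomV_expR _ _ _ (s / 2 / (h * N%:R)) 0).
- by apply: continuous_mul; [exact: continuous_qform | exact: continuous_const].
- by rewrite !divr_gt0.
- move=> x; rewrite subr0 mulrAC ler_pM2r ?invr_gt0 //.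
  exact: qform_sqn.
Qed.

Lemma tilt_mass_gt0 t : 0 < tilt_mass t.
Proof.
by apply: (intV_gt0 (x := 0) (gdomV_tilt t)) => [x|]; [exact/ltW/tilt_gt0 | exact: tilt_gt0].
Qed.

Lemma gauss_mass_gt0 : 0 < gauss_mass.
Proof. by apply: (intV_gt0 (x := 0) gdomV_gaussw) => [x|]; [exact: expR_ge0 | exact: expR_gt0]. Qed.

Lemma tilt_mid t t' x y : tilt t x * tilt t' y <= tilt ((t + t') / 2) (2^-1 *: (x + y)) ^+ 2 *
  expR (- ((2^-1 * qform mu s (x - y) - N%:R * (1 + s) / 2 * (t - t') * mean (x - y)
    + N%:R * (1 + s) / 4 * (t - t') ^+ 2) / (h * N%:R))).
Proof.
rewrite /tilt expr2 -!expRD ler_expR -!opprD lerN2 -!mulrDl ler_pM2r ?invr_gt0 //.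
have := tilted_V_convex mu s t t' x y; lra.
Qed.

Lemma tilt_strongly_log_concave t x y : tilt t x * tilt t y <=
  tilt t (2^-1 *: (x + y)) ^+ 2 * expR (- (s / (h * N%:R) / 4 * sqn (x - y))).
Proof.
have tt : (t + t) / 2 = t by field.
have := tilt_mid t t x y; rewrite tt => /le_trans; apply.
apply: ler_wpM2l; first exact: sqr_ge0.
rewrite ler_expR lerN2 subrr expr0n /= !mulr0 mul0r addr0 subr0.
have -> : s / (h * N%:R) / 4 * sqn (x - y) = s / 4 * sqn (x - y) / (h * N%:R).
  by field; rewrite nat1r !gt_eqF.
rewrite ler_pM2r ?invr_gt0 //; have := qform_sqn mu1 s0 smu (x - y); lra.
Qed.

(** Prekopa-Leindler with two different tilts. The exponential factor is the price of the mismatch: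
    the cross term, linear in [mean (x - y)], maximized against the convexity of [qform]. *)
Lemma tilt_mass_mid t t' : tilt_mass t * tilt_mass t' <=
  expR ((1 + s) ^+ 2 * (t - t') ^+ 2 / (4 * s * h)) * tilt_mass ((t + t') / 2) ^+ 2.
Proof.
set E := (1 + s) ^+ 2 * (t - t') ^+ 2 / (4 * s * h).
pose w x := expR (E / 2) * tilt ((t + t') / 2) x.
have eE : expR (E / 2) ^+ 2 = expR E by rewrite expr2 -expRD; congr expR; field.
have -> : expR E * tilt_mass ((t + t') / 2) ^+ 2 = intV w ^+ 2.
  rewrite /w intVZ; last exact: gdomV_tilt.
  by rewrite exprMn eE.
apply: intV_prekopa_leindler; try exact: gdomV_tilt.
- by apply: gdomVZ; exact: gdomV_tilt.
- exact: tilt_gt0.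
- exact: tilt_gt0.
- by move=> x; rewrite mulr_ge0 ?expR_ge0 // ltW ?tilt_gt0.
move=> x y; apply: le_trans (tilt_mid _ _ _ _) _.
rewrite /w exprMn mulrC; apply: ler_wpM2r; first exact: sqr_ge0.
rewrite eE ler_expR.
have -> : E = N%:R * ((1 + s) ^+ 2 * (t - t') ^+ 2 / (4 * s)) / (h * N%:R).
  by rewrite /E; field; rewrite nat1r !gt_eqF.
rewrite -mulNr ler_pM2r ?invr_gt0 //.
have Q := qform_sqn mu1 s0 smu (x - y); have M := Nmean2_le (x - y).
set d := mean (x - y) in M *; set T := t - t'.
have : 0 <= N%:R * s / 4 * (d - (1 + s) * T / s) ^+ 2.
  by rewrite mulr_ge0 ?sqr_ge0 // divr_ge0 // mulr_ge0 ?ltW.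
have -> : N%:R * s / 4 * (d - (1 + s) * T / s) ^+ 2 =
  s / 4 * (N%:R * d ^+ 2) - N%:R * (1 + s) / 2 * T * d + N%:R * ((1 + s) ^+ 2 * T ^+ 2 / (4 * s)).
  by field; rewrite gt_eqF.
have : s / 4 * (N%:R * d ^+ 2) <= s / 4 * sqn (x - y) by rewrite ler_wpM2l // divr_ge0 // ltW.
have : 0 <= N%:R * (1 + s) / 4 * T ^+ 2.
  rewrite mulr_ge0 ?sqr_ge0 // divr_ge0 // mulr_ge0 ?(ltW N0) //.
  by rewrite addr_ge0 // ltW.
lra.
Qed.

Lemma tilted_V_opp t x : tilted_V mu s (- t) (- x) = tilted_V mu s t x.
Proof.
have mo : mean (- x) = - mean x.
  by have := mean_lin (-1) 0 x x; rewrite scale0r addr0 scaleN1r mul0r addr0 mulN1r.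
rewrite /tilted_V mo; congr (_ + _); last by ring.
rewrite /V_N; congr (_ + _ * _); apply: eq_bigr => k _; rewrite !mxE; ring.
Qed.

Lemma qform_opp x : qform mu s (- x) = qform mu s x.
Proof.
have mo : mean (- x) = - mean x.
  by have := mean_lin (-1) 0 x x; rewrite scale0r addr0 scaleN1r mul0r addr0 mulN1r.
rewrite /qform /osc2 mo !sqrrN; congr (_ * _ - _ * (_ - _) + _);
  by apply: eq_bigr => k _; rewrite !mxE; ring.
Qed.

Lemma tilt_mass_opp t : tilt_mass (- t) = tilt_mass t.
Proof.
rewrite /tilt_mass -(intV_opp (gdomV_tilt (- t))); apply: eq_intV => x.
by rewrite /tilt tilted_V_opp.
Qed.

(** Below, [tau (a - b)] against the Sobolev form of the convexity has maximum [C_sob / 2]; taking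
    the square root of the inequality halves it. *)
Let E0 : R := expR (C_sob mu s / 4).

(* By reflection both factors of Prekopa-Leindler are equal. *)
Lemma gauss_exp_moment tau (k : 'I_N) : tau ^+ 2 * h = 1 ->
  intV (fun x => expR (tau * x 0 k) * gaussw x) <= E0 * gauss_mass.
Proof.
move=> tauh.
pose u x := expR (tau * x 0 k) * gaussw x.
pose v x := expR (- tau * x 0 k) * gaussw x.
have du : gdomV u by apply: gdomV_mul; [exact: subgauss_expR | exact: gdomV_gaussw].
have dv : gdomV v by apply: gdomV_mul; [exact: subgauss_expR | exact: gdomV_gaussw].
have uv : intV u = intV v.
  rewrite -(intV_opp du); apply: eq_intV => x.
  by rewrite /u /v /gaussw qform_opp mxE mulrN mulNr.
have PL : intV u * intV v <= (E0 * gauss_mass) ^+ 2.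
  rewrite -(intVZ _ gdomV_gaussw).
  apply: (intV_prekopa_leindler du dv (gdomVZ E0 gdomV_gaussw)).
  - by move=> x; rewrite mulr_gt0 ?expR_gt0.
  - by move=> x; rewrite mulr_gt0 ?expR_gt0.
  - by move=> x; rewrite mulr_ge0 ?expR_ge0.
  move=> x y; rewrite /u /v /gaussw /E0 !exprMn !expr2 -!expRD ler_expR.
  have P := qform_parallelogram mu s x y.
  have S := sobolev mu1 s0 smu (x - y) k.
  rewrite !mxE in S; move: (x 0 k) (y 0 k) S => a b S.
  have C0 := C_sob_gt0 mu1 s0 smu.
  have : (a - b) ^+ 2 / (2 * h * C_sob mu s) <= 2^-1 * qform mu s (x - y) / (h * N%:R).
    rewrite ler_pdivrMr ?mulr_gt0 //.
    have -> : 2^-1 * qform mu s (x - y) / (h * N%:R) * (2 * h * C_sob mu s) =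
      C_sob mu s * qform mu s (x - y) / N%:R by field; rewrite nat1r !gt_eqF.
    by rewrite ler_pdivlMr // mulrC.
  rewrite -P.
  have : 0 <= (2 * h * C_sob mu s)^-1 * ((a - b) - tau * h * C_sob mu s) ^+ 2.
    apply: mulr_ge0; last exact: sqr_ge0.
    by rewrite invr_ge0 ltW //; apply: mulr_gt0 C0; apply: mulr_gt0.
  have -> : (2 * h * C_sob mu s)^-1 * ((a - b) - tau * h * C_sob mu s) ^+ 2 =
    (a - b) ^+ 2 / (2 * h * C_sob mu s) - tau * (a - b) + tau ^+ 2 * h * C_sob mu s / 2.
    by field; rewrite !gt_eqF.
  rewrite tauh; move: ((a - b) ^+ 2 / _) ((h * N%:R)^-1) => A iv; nra.
have u0 : 0 <= intV u by apply: intV_ge0 => x; rewrite mulr_ge0 ?expR_ge0.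
move: PL; rewrite -uv -expr2 ler_sqr ?nnegrE //.
by rewrite mulr_ge0 ?expR_ge0 // ltW ?gauss_mass_gt0.
Qed.

Lemma sqr_le_cosh (X : R) : X ^+ 2 <= 4 * (expR X + expR (- X)).
Proof.
wlog X0 : X / 0 <= X.
  move=> W; have [/W//|/ltW X0] := leP 0 X.
  by have := W (- X); rewrite oppr_ge0 => /(_ X0); rewrite sqrrN opprK addrC.
have := @expR_ge_quadratic R X; have := expR_ge0 (- X); lra.
Qed.

(** Square the quadratic bound at [X / 2]. *)
Lemma pow4_le_cosh (X : R) : X ^+ 4 <= 256 * (expR X + expR (- X)).
Proof.
wlog X0 : X / 0 <= X.
  move=> W; have [/W//|/ltW X0] := leP 0 X.
  have := W (- X); rewrite oppr_ge0 => /(_ X0).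
  by rewrite opprK addrC (_ : (- X) ^+ 4 = X ^+ 4) //; ring.
have h1 := @expR_ge_quadratic R (X / 2).
have h2 : X ^+ 2 / 16 <= expR (X / 2) by lra.
have h3 : (X ^+ 2 / 16) ^+ 2 <= expR (X / 2) ^+ 2.
  by apply: lerXn2r; rewrite ?nnegrE ?expR_ge0 // divr_ge0 // sqr_ge0.
have h4 : expR (X / 2) ^+ 2 = expR X by rewrite expr2 -expRD; congr expR; field.
have h5 : (X ^+ 2 / 16) ^+ 2 = X ^+ 4 / 256 by field.
have := expR_ge0 (- X); lra.
Qed.

(** At the rate [1 / sqrt h] the bound is free of [h] and [N]: under [gaussw] a single coordinate
    has size [sqrt h], although the exponent has the large denominator [h N]. *)
Let cosh_moment (k : 'I_N) :
  intV (fun x => (expR ((Num.sqrt h)^-1 * x 0 k) + expR (- ((Num.sqrt h)^-1 * x 0 k))) * gaussw x)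
  <= 2 * E0 * gauss_mass.
Proof.
set tau := (Num.sqrt h)^-1.
have sh : Num.sqrt h != 0 by rewrite gt_eqF // sqrtr_gt0.
have tauh : tau ^+ 2 * h = 1.
  by rewrite /tau exprVn sqr_sqrtr ?ltW // mulVf // gt_eqF.
have tauh' : (- tau) ^+ 2 * h = 1 by rewrite sqrrN.
have d t : gdomV (fun x => expR (t * x 0 k) * gaussw x).
  by apply: gdomV_mul; [exact: subgauss_expR | exact: gdomV_gaussw].
rewrite (@eq_intV _ _ _ (fun x => expR (tau * x 0 k) * gaussw x + expR (- tau * x 0 k) * gaussw x)); last first.
  by move=> x; rewrite mulrDl mulNr.
rewrite intVD //; have := gauss_exp_moment k tauh; have := gauss_exp_moment k tauh'; lra.
Qed.

Let subgauss_coord2 (k : 'I_N) : subgauss (fun x => x 0 k ^+ 2).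
Proof. by apply: subgaussM; exact: subgauss_coord. Qed.

Let subgauss_coord4 (k : 'I_N) : subgauss (fun x => x 0 k ^+ 4).
Proof.
have := subgaussM (subgauss_coord2 k) (subgauss_coord2 k).
by congr subgauss; apply/funext => x; rewrite -exprD.
Qed.

Let dcosh (k : 'I_N) : gdomV (fun x => (expR ((Num.sqrt h)^-1 * x 0 k) + expR (- ((Num.sqrt h)^-1 * x 0 k))) * gaussw x).
Proof.
apply: gdomV_mul; last exact: gdomV_gaussw.
apply: subgaussD; first exact: subgauss_expR.
have := subgauss_expR (- (Num.sqrt h)^-1) k.
by congr subgauss; apply/funext => x; rewrite mulNr.
Qed.

Lemma moment2 (k : 'I_N) : intV (fun x => x 0 k ^+ 2 * gaussw x) <= 8 * E0 * h * gauss_mass.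
Proof.
have sh : Num.sqrt h != 0 by rewrite gt_eqF // sqrtr_gt0.
have sh2 : Num.sqrt h ^+ 2 = h by rewrite sqr_sqrtr // ltW.
apply: (@le_trans _ _ (intV (fun x => 4 * h * ((expR ((Num.sqrt h)^-1 * x 0 k) + expR (- ((Num.sqrt h)^-1 * x 0 k))) * gaussw x)))).
  apply: le_intV.
  - by apply: gdomV_mul => //; exact: gdomV_gaussw.
  - by apply: gdomVZ; exact: dcosh.
  move=> x; rewrite mulrA; apply: ler_wpM2r; first exact: expR_ge0.
  have := sqr_le_cosh ((Num.sqrt h)^-1 * x 0 k).
  rewrite exprMn exprVn sh2 mulrC ler_pdivrMr //; lra.
rewrite intVZ; last exact: dcosh.
have := cosh_moment k; rewrite -(ler_pM2l h0); lra.
Qed.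

Lemma moment4 (k : 'I_N) : intV (fun x => x 0 k ^+ 4 * gaussw x) <= 512 * E0 * h ^+ 2 * gauss_mass.
Proof.
have sh : Num.sqrt h != 0 by rewrite gt_eqF // sqrtr_gt0.
have h20 : 0 < h ^+ 2 by rewrite exprn_gt0.
have sh4 : Num.sqrt h ^+ 4 = h ^+ 2 by rewrite (exprM _ 2 2) sqr_sqrtr // ltW.
apply: (@le_trans _ _ (intV (fun x => 256 * h ^+ 2 * ((expR ((Num.sqrt h)^-1 * x 0 k) + expR (- ((Num.sqrt h)^-1 * x 0 k))) * gaussw x)))).
  apply: le_intV.
  - by apply: gdomV_mul => //; exact: gdomV_gaussw.
  - by apply: gdomVZ; exact: dcosh.
  move=> x; rewrite mulrA; apply: ler_wpM2r; first exact: expR_ge0.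
  have := pow4_le_cosh ((Num.sqrt h)^-1 * x 0 k).
  rewrite exprMn exprVn sh4 mulrC ler_pdivrMr //; lra.
rewrite intVZ; last exact: dcosh.
have := cosh_moment k; rewrite -(ler_pM2l h20); lra.
Qed.

(** Half the constant 512 of [moment4]; it also exceeds [5 / 2 * 8], the share of [moment2]. *)
Definition C_mass : R := 256 * E0.

Let drem m : gdomV (fun x => expR (- (rem m x / (h * N%:R))) * gaussw x).
Proof.
apply: gdomV_mul; last exact: gdomV_gaussw.
apply: (@subgauss_bounded _ _ _ 1).
  apply: continuous_exp; apply: continuous_opp; apply: continuous_mul.
    exact: continuous_rem.
  exact: continuous_const.
move=> x; rewrite ger0_norm ?expR_ge0 // -[leRHS]expR0 ler_expR oppr_le0.
by apply: divr_ge0; [exact: rem_ge0 | exact: (ltW hN)].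
Qed.

(** After the shift by [m] the Gaussian factor no longer depends on [t] or [m], so [gauss_mass] is
    common to all tilts. *)
Lemma tilt_mass_shift t m : m ^+ 3 + s * m = (1 + s) * t ->
  tilt_mass t = expR (- (psi0 s t m / h)) * intV (fun x => expR (- (rem m x / (h * N%:R))) * gaussw x).
Proof.
move=> mt; rewrite /tilt_mass -(intV_shift m (gdomV_tilt t)); last by move=> x; exact/ltW/tilt_gt0.
rewrite -intVZ.
  apply: eq_intV => x; rewrite /tilt /gaussw (tilted_V_shift _ _ mt) -!expRD; congr expR.
  by field; rewrite nat1r !gt_eqF.
exact: drem.
Qed.

Lemma tilt_mass_le t m : m ^+ 3 + s * m = (1 + s) * t -> tilt_mass t <= expR (- (psi0 s t m / h)) * gauss_mass.
Proof.
move=> mt; rewrite (tilt_mass_shift mt) ler_pM2l ?expR_gt0 //.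
apply: le_intV => //; first exact: gdomV_gaussw.
move=> x; rewrite ler_piMl ?expR_ge0 // -[leRHS]expR0 ler_expR oppr_le0.
by apply: divr_ge0; [exact: rem_ge0 | exact: (ltW hN)].
Qed.

(* Jensen, through the tangent [exp (A - X) >= 1 + A - X]. *)
Lemma tilt_mass_ge t m : h <= 1 -> m ^+ 3 + s * m = (1 + s) * t ->
  expR (- (psi0 s t m / h)) * (expR (- (C_mass * (1 + m ^+ 2))) * gauss_mass) <= tilt_mass t.
Proof.
move=> h1 mt; rewrite (tilt_mass_shift mt) ler_pM2l ?expR_gt0 //.
set A := C_mass * (1 + m ^+ 2).
pose r x := \sum_(k < N) (5 / 2 * m ^+ 2 * x 0 k ^+ 2 + 2^-1 * x 0 k ^+ 4).
have dk (k : 'I_N) : gdomV (fun x => 5 / 2 * m ^+ 2 * (x 0 k ^+ 2 * gaussw x) + 2^-1 * (x 0 k ^+ 4 * gaussw x)).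
  by apply: gdomV_lin; apply: gdomV_mul => //; exact: gdomV_gaussw.
have rE x : r x * gaussw x =
    \sum_(k < N) (5 / 2 * m ^+ 2 * (x 0 k ^+ 2 * gaussw x) + 2^-1 * (x 0 k ^+ 4 * gaussw x)).
  by rewrite /r mulr_suml; apply: eq_bigr => k _; ring.
have dr : gdomV (fun x => r x * gaussw x).
  by apply: eq_gdomV (gdomV_sum (index_enum 'I_N) dk) => x; rewrite rE.
(* [N] coordinates with moments of order [h] make up the factor [h N] by which the exponent divides
   [rem]; [h <= 1] brings the fourth moment from [h^2] to [h]. *)
have Ir : intV (fun x => r x * gaussw x) <= h * N%:R * (A * gauss_mass).
  rewrite (eq_intV rE) intV_sum //.
  apply: (@le_trans _ _ (\sum_(k < N) (h * (A * gauss_mass)))); last first.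
    by rewrite sum_const mulrA (mulrC N%:R).
  apply: ler_sum => k _; rewrite intV_lin; try by apply: gdomV_mul => //; exact: gdomV_gaussw.
  have M2 := moment2 k; have M4 := moment4 k.
  have z0 := gauss_mass_gt0; have e0 : 0 < E0 by exact: expR_gt0.
  have m20 : 0 <= m ^+ 2 by exact: sqr_ge0.
  have q1 : 5 / 2 * m ^+ 2 * intV (fun x => x 0 k ^+ 2 * gaussw x) <= 5 / 2 * m ^+ 2 * (8 * E0 * h * gauss_mass).
    by apply: ler_wpM2l => //; rewrite mulr_ge0 // divr_ge0.
  have q2 : 2^-1 * intV (fun x => x 0 k ^+ 4 * gaussw x) <= 256 * E0 * h * gauss_mass.
    have : h ^+ 2 * (E0 * gauss_mass) <= h * (E0 * gauss_mass).
      by rewrite ler_pM2r ?mulr_gt0 // expr2 ler_piMr // ltW.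
    lra.
  have q3 : 0 <= m ^+ 2 * (E0 * h * gauss_mass) by rewrite mulr_ge0 // ltW // !mulr_gt0.
  rewrite /A /C_mass; lra.
have -> : expR (- A) * gauss_mass = expR (- A) * ((1 + A) * gauss_mass - A * gauss_mass) by ring.
apply: (@le_trans _ _ (expR (- A) * intV (fun x => (1 + A) * gaussw x + (- (h * N%:R)^-1) * (r x * gaussw x)))).
  apply: ler_wpM2l; first exact: expR_ge0.
  rewrite intV_lin //; last exact: gdomV_gaussw.
  rewrite lerD2l mulNr lerN2 mulrC ler_pdivrMr //.
  by rewrite mulrC.
rewrite -intVZ; last by apply: gdomV_lin => //; exact: gdomV_gaussw.
apply: le_intV => //; first by apply: gdomVZ; apply: gdomV_lin => //; exact: gdomV_gaussw.
move=> x.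
have -> : expR (- A) * ((1 + A) * gaussw x + - (h * N%:R)^-1 * (r x * gaussw x)) =
  expR (- A) * (1 + (A - r x / (h * N%:R))) * gaussw x by ring.
apply: ler_wpM2r; first exact: expR_ge0.
apply: (@le_trans _ _ (expR (- A) * expR (A - r x / (h * N%:R)))).
  by apply: ler_wpM2l; [exact: expR_ge0 | exact: expR_ge1Dx].
rewrite -expRD ler_expR addKr lerN2 ler_pM2r ?invr_gt0 //.
exact: rem_le.
Qed.

End Partition.

(** * Discrete Hardy inequality along the tilts *)

Section Hardy.
Variable R : realType.

(* No growth of [p] is needed next to [J0], because [F J0 = 0]. *)
Lemma discrete_hardy (J0 : nat) (p F V : nat -> R) (B : R) :
  (forall j, 0 < p j) -> (forall j, 0 <= V j) -> 0 <= B -> F J0 = 0 ->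
  (forall j, p j * (F j.+1 - F j) ^+ 2 <= B * V j) ->
  (forall j, p j.+1 * (F j.+1 - F j) ^+ 2 <= B * V j.+1) ->
  (forall j, (j.+1 < J0)%N -> 4 * p j <= p j.+1) ->
  (forall j, (J0 < j)%N -> 4 * p j.+1 <= p j) ->
  forall n, (J0 < n)%N ->
  \sum_(j < n) p j * F j ^+ 2 <= 4 * B * \sum_(j < n) V j.
Proof.
move=> p0 V0 B0 FJ D D' inn out.
pose x j := p j * F j ^+ 2.
have x0 j : 0 <= x j by rewrite mulr_ge0 ?sqr_ge0 // ltW.
have xJ : x J0 = 0 by rewrite /x FJ expr0n mulr0.
(* The ratio 4 beats the factor 2 in [F_j^2 <= 2 F_(j+1)^2 + 2 (F_(j+1) - F_j)^2], which leaves a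
   contraction by 1/2 in the direction away from [J0]. *)
have inn' j : (j < J0)%N -> 2 * x j <= x j.+1 + 4 * (B * V j).
  move=> jJ; have := D j; have := mulr_ge0 B0 (V0 j).
  have [jJ'|] := ltnP j.+1 J0.
    have := inn j jJ' => h1 h2 h3.
    have h4 : 4 * p j * F j.+1 ^+ 2 <= p j.+1 * F j.+1 ^+ 2.
      by apply: ler_wpM2r => //; exact: sqr_ge0.
    have h5 : 0 <= p j * (F j - 2 * F j.+1) ^+ 2.
      by rewrite mulr_ge0 ?sqr_ge0 // ltW.
    have h6 : p j * F j ^+ 2 <= 2 * (p j * F j.+1 ^+ 2) + 2 * (p j * (F j.+1 - F j) ^+ 2) by lra.
    rewrite /x; lra.
  move=> Jj; have E : j.+1 = J0 by apply/eqP; rewrite eqn_leq Jj jJ.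
  rewrite /x E FJ sub0r sqrrN expr0n mulr0 /=; lra.
have out' j : (J0 <= j)%N -> 2 * x j.+1 <= x j + 4 * (B * V j.+1).
  rewrite leq_eqVlt => /orP[/eqP <-|Jj]; have := D' j; have := mulr_ge0 B0 (V0 j.+1).
    have := D' J0; rewrite /x FJ subr0 expr0n mulr0 /=.
    have := mulr_ge0 B0 (V0 J0.+1); lra.
  have := out j Jj => h1 h2 h3.
  have h4 : 4 * p j.+1 * F j ^+ 2 <= p j * F j ^+ 2.
    by apply: ler_wpM2r => //; exact: sqr_ge0.
  have h5 : 0 <= p j.+1 * (F j.+1 - 2 * F j) ^+ 2.
    by rewrite mulr_ge0 ?sqr_ge0 // ltW.
  rewrite /x; lra.
(* Keeping the boundary term [x k] in the bound turns the geometric summation into a one-step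
   induction; in [outer] it sits on the other side. *)
have inner k : (k <= J0)%N -> \sum_(j < k) x j <= x k + 4 * B * \sum_(j < k) V j.
  elim: k => [|k IH] kJ; first by rewrite !big_ord0 mulr0 addr0.
  rewrite !big_ord_recr /=; have := IH (ltnW kJ); have := inn' k kJ; lra.
have outer i : \sum_(j < J0 + i.+1) x j + x (J0 + i)%N <= 4 * B * \sum_(j < J0 + i.+1) V j.
  elim: i => [|i IH].
    rewrite addn0 addn1 !big_ord_recr /=; have := inner J0 (leqnn _).
    have := mulr_ge0 B0 (V0 J0); rewrite xJ; lra.
  rewrite addnS !big_ord_recr /=; have := out' (J0 + i)%N (leq_addr _ _).
  rewrite -addnS; lra.
move=> n Jn; have -> : n = (J0 + (n - J0.+1).+1)%N by lia.
by apply: le_trans (outer _); rewrite lerDl.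
Qed.

Lemma sum_gauss_le (v : R) n : \sum_(j < n) expR (- (v - j%:R) ^+ 2) <= 4 * expR 1.
Proof.
(* By [- y^2 <= 1 - 2 |y|] the Gaussian sum is dominated by a two-sided geometric one, of ratio
   [exp (- 2) <= 1 / 4]. *)
pose g (j : nat) := expR (- (2 * `|v - j%:R|)).
have g1 j : g j <= 1 by rewrite /g -[leRHS]expR0 ler_expR oppr_le0 mulr_ge0.
have g0 j : 0 <= g j by exact: expR_ge0.
have e2 : 4 * expR (- 2) <= 1 :> R.
  have e : 2 <= expR 1 :> R by have := expR_ge1Dx (1 : R); lra.
  have : expR 2 = expR 1 * expR 1 :> R by rewrite -expRD; congr expR; ring.
  move=> e2; have e4 : 4 <= expR 2 :> R by rewrite e2; nra.
  have e5 := expRxMexpNx_1 (2 : R); have := ler_wpM2r (expR_ge0 (- 2)) e4; lra.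
have lo j : j.+1%:R <= v -> 4 * g j <= g j.+1.
  move=> jv; rewrite /g !ger0_norm; [|move: jv; rewrite -?natr1; lra..].
  have -> : - (2 * (v - j%:R)) = - (2 * (v - j.+1%:R)) + - 2 by rewrite -natr1; ring.
  rewrite expRD mulrCA ler_piMr ?expR_ge0 //.
have hi j : v <= j%:R -> 4 * g j.+1 <= g j.
  move=> jv; rewrite /g !ler0_norm; [|move: jv; rewrite -?natr1; lra..].
  have -> : - (2 * - (v - j.+1%:R)) = - (2 * - (v - j%:R)) + - 2 by rewrite -natr1; ring.
  rewrite expRD mulrCA ler_piMr ?expR_ge0 //.
apply: (@le_trans _ _ (\sum_(j < n) expR 1 * g j)).
  apply: ler_sum => j _; rewrite /g -expRD ler_expR.
  have : 0 <= (`|v - j%:R| - 1) ^+ 2 by exact: sqr_ge0.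
  rewrite -[(v - j%:R) ^+ 2]real_normK ?num_real //; lra.
rewrite -mulr_sumr mulrC ler_wpM2r ?expR_ge0 //.
(* While the terms grow, the last one controls the sum; once they decrease, it is the reserve for
   those to come. *)
have main k : (k%:R <= v -> \sum_(j < k.+1) g j <= 2 * g k) /\
              (v < k%:R -> \sum_(j < k.+1) g j + g k <= 4).
  elim: k => [|k [IH1 IH2]]; rewrite big_ord_recr /=.
    by rewrite big_ord0; have := g1 0%N; have := g0 0%N; split; lra.
  split => [k1v|vk1].
    have kv : k%:R <= v by apply: le_trans k1v; rewrite ler_nat.
    have := IH1 kv; have := lo k k1v; have := g0 k; lra.
  have [kv|vk] := leP k%:R v.
    have := IH1 kv; have := g1 k.+1; have := g1 k; lra.
  have := IH2 vk; have := hi k (ltW vk); have := g0 k; lra.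
case: n => [|k]; first by rewrite big_ord0.
have [m1 m2] := main k; have [kv|vk] := leP k%:R v.
  have := m1 kv; have := g1 k; lra.
have := m2 vk; have := g0 k; lra.
Qed.

End Hardy.

(** * The double well in the tilt parameter *)

Section EffectivePotential.
Variables (R : realType) (s : R).
Hypothesis s0 : 0 < s.
Hypothesis s4 : s <= 4^-1.
Implicit Types (t m d : R).

Lemma minimizer t : 0 <= t -> exists2 m, 0 <= m & m ^+ 3 + s * m = (1 + s) * t.
Proof.
have S0 := s0; have S4 := s4; move=> t0.
pose f m := m ^+ 3 + s * m.
pose b := (1 + s) * t / s.
have b0 : 0 <= b by rewrite divr_ge0 ?mulr_ge0 //; lra.
have cf : continuous f.
  apply: continuous_add; last by apply: continuous_mul; [exact: continuous_const | move=> x; exact: cvg_id].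
  by move=> x; exact: exprn_continuous.
have [|c cab fc] := @IVT R f 0 b ((1 + s) * t) b0 (continuous_subspaceT cf).
  have f0 : f 0 = 0 by rewrite /f expr0n mulr0 addr0.
  have fb : (1 + s) * t <= f b.
    rewrite /f (_ : s * b = (1 + s) * t); last by rewrite /b; field; lra.
    by rewrite lerDr exprn_ge0.
  have tt : 0 <= (1 + s) * t by rewrite mulr_ge0 //; lra.
  by rewrite f0 ge_min le_max tt fb orbT.
by exists c => //; move: cab; rewrite in_itv /= => /andP[].
Qed.

Lemma psi0_min t m m' : m ^+ 3 + s * m = (1 + s) * t -> psi0 s t m <= psi0 s t m'.
Proof.
have S0 := s0 => mt; rewrite -subr_ge0.
have -> : psi0 s t m' - psi0 s t m =
  (m' - m) ^+ 2 * ((m' + m) ^+ 2 + 2 * m ^+ 2 + 2 * s) / 4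
  + (m ^+ 3 + s * m - (1 + s) * t) * (m' - m) by rewrite /psi0; field.
rewrite mt subrr mul0r addr0 divr_ge0 // mulr_ge0 ?sqr_ge0 //.
have := sqr_ge0 (m' + m); have := sqr_ge0 m; lra.
Qed.

Lemma minimizer_le1 t m : t <= 1 -> 0 <= m -> m ^+ 3 + s * m = (1 + s) * t -> m <= 1.
Proof.
have S0 := s0 => t1 m0 mt; rewrite leNgt; apply/negP => m1.
have : 1 < m ^+ 3 by rewrite exprn_egt1.
nra.
Qed.

Lemma minimizer_ge1 t m : 1 <= t -> 0 <= m -> m ^+ 3 + s * m = (1 + s) * t -> 1 <= m.
Proof.
have S0 := s0 => t1 m0 mt; rewrite leNgt; apply/negP => m1.
have : m ^+ 3 <= 1 by rewrite exprn_ile1 // ltW.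
nra.
Qed.

(** Testing the minimum at tilt [t + d] with the old minimizer [m] changes only the tilt term, so
    the gain is governed by [m - t]. Since [(1 + s) (m - t) = m (1 - m^2)] vanishes at both ends,
    margins from 0 and 1 are imposed on [t]. *)
Lemma psi0_inner t d m m' : 0 < d -> d / 2 <= t -> t + 2 * d <= 1 ->
  0 <= m -> m ^+ 3 + s * m = (1 + s) * t ->
  0 <= m' -> m' ^+ 3 + s * m' = (1 + s) * (t + d) ->
  d ^+ 2 / 4 <= psi0 s t m - psi0 s (t + d) m'.
Proof.
have S0 := s0; have S4 := s4 => d0 dt t1 m0 mt m'0 m't.
have m1 : m <= 1 by apply: (minimizer_le1 _ m0 mt); lra.
have key : 3 / 4 * d <= m - t.
  have c0 : 0 < 1 + s by lra.
  have E1 : (1 + s) * (m - t) = m * ((1 - m) * (1 + m)).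
    by rewrite mulrBr -mt; ring.
  have E2 : (1 + s) * (1 - t) = (1 - m) * (1 + m + m ^+ 2 + s).
    by rewrite mulrBr -mt; ring.
  rewrite -(ler_pM2l c0) E1.
  (* For small [m], [m - t] is compared with [t]; for [m > 1/2], with [1 - t]. *)
  have [mh|mh] := leP m (2^-1).
    have : (1 + s) * t <= m * 2^-1 by rewrite -mt; nra.
    nra.
  have h1 : 3 / 8 * (1 + m + m ^+ 2 + s) <= m * (1 + m) by nra.
  have h2 : 3 / 8 * (1 + m + m ^+ 2 + s) * (1 - m) <= m * (1 + m) * (1 - m).
    by apply: ler_wpM2r => //; lra.
  have h3 : (1 + s) * (2 * d) <= (1 + s) * (1 - t) by rewrite ler_pM2l //; lra.
  nra.
have A := psi0_min m m't.
have : psi0 s t m - psi0 s (t + d) m = (1 + s) / 2 * d * (2 * (m - t) - d).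
  by rewrite /psi0; field.
have : 2^-1 * d * (d / 2) <= (1 + s) / 2 * d * (2 * (m - t) - d).
  by apply: ler_pM; rewrite ?mulr_ge0 ?divr_ge0 ?ler_pM2r //; lra.
nra.
Qed.

(** As in [psi0_inner], now testing with [m'] at tilt [t]. The gain must grow with [t], because the
    lower bound on the mass loses a factor exponential in [m^2]; hence also the bound on [m^2]. *)
Lemma psi0_outer t d m m' : 0 < d -> 1 + d <= t ->
  0 <= m -> m ^+ 3 + s * m = (1 + s) * t ->
  0 <= m' -> m' ^+ 3 + s * m' = (1 + s) * (t + d) ->
  7 / 20 * d * (t + d - 1) <= psi0 s (t + d) m' - psi0 s t m /\ m ^+ 2 <= 5 / 4 * (t + d).
Proof.
have S0 := s0; have S4 := s4 => d0 dt m0 mt m'0 m't.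
have m1 : 1 <= m by apply: (minimizer_ge1 _ m0 mt); lra.
have m'1 : 1 <= m' by apply: (minimizer_ge1 _ m'0 m't); lra.
split; last first.
  have : m ^+ 2 <= m ^+ 3 by rewrite exprS ler_peMl // sqr_ge0.
  nra.
have c0 : 0 < 1 + s by lra.
have key : 3 / 5 * (t + d - 1) <= t + d - m'.
  have E1 : (1 + s) * (t + d - m') = m' * ((m' - 1) * (1 + m')).
    by rewrite mulrBr -m't; ring.
  have E2 : (1 + s) * (t + d - 1) = (m' - 1) * (1 + m' + m' ^+ 2 + s).
    by rewrite mulrBr -m't; ring.
  rewrite -(ler_pM2l c0) E1 mulrCA E2.
  have h1 : 3 / 5 * (1 + m' + m' ^+ 2 + s) <= m' * (1 + m') by nra.
  have h2 : 3 / 5 * (1 + m' + m' ^+ 2 + s) * (m' - 1) <= m' * (1 + m') * (m' - 1).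
    by apply: ler_wpM2r => //; lra.
  lra.
have A := psi0_min m' mt.
have : psi0 s (t + d) m' - psi0 s t m' = (1 + s) / 2 * d * (2 * (t + d - m') - d).
  by rewrite /psi0; field.
have : 2^-1 * d * (7 / 10 * (t + d - 1)) <= (1 + s) / 2 * d * (2 * (t + d - m') - d).
  by apply: ler_pM; rewrite ?mulr_ge0 ?divr_ge0 ?ler_pM2r //; lra.
lra.
Qed.

End EffectivePotential.

(** * Geometric growth of the masses towards the wells *)

Section Ratio.
Variables (R : realType) (n : nat) (mu s h : R).
Local Notation N := n.+1.
Hypothesis mu1 : 1 < mu.
Hypothesis s0 : 0 < s.
Hypothesis s4 : s <= 4^-1.
Hypothesis smu : s <= mu - 1.
Hypothesis h0 : 0 < h.
Hypothesis h1 : h <= 1.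

(** The least grid step in units of [sqrt h]. A step gains a multiple of [d^2 / h >= Agrid^2] in the
    exponent, which has to beat the loss [C_mass (1 + m^2)] of [tilt_mass_ge]. *)
Definition Agrid : R := 8 * (C_mass mu s + 1).

Lemma C_mass_gt0 : 0 < C_mass mu s.
Proof. by apply: mulr_gt0; [rewrite ltr0n | exact: expR_gt0]. Qed.

Lemma expR_2_ge4 : 4 <= expR 2 :> R.
Proof.
have e : 2 <= expR 1 :> R by have := expR_ge1Dx (1 : R); lra.
have e2 : expR 2 = expR 1 * expR 1 :> R by rewrite -expRD; congr expR; ring.
by rewrite e2; nra.
Qed.

(** The upper bound at [t] meets the lower bound at [t']: [gauss_mass] cancels, and the surplus 2 in
    the exponent yields [exp 2 >= 4]. *)
Lemma ratio_step t t' m m' (a : R) :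
  m ^+ 3 + s * m = (1 + s) * t -> m' ^+ 3 + s * m' = (1 + s) * t' ->
  C_mass mu s * (1 + m' ^+ 2) + 2 <= (psi0 s t m - psi0 s t' m') / h ->
  4 * tilt_mass n mu s h t <= tilt_mass n mu s h t'.
Proof.
move=> mt mt' H.
have U := tilt_mass_le n mu1 s0 smu h0 mt.
have L := tilt_mass_ge n mu1 s0 smu h0 h1 mt'.
apply: le_trans L; apply: (@le_trans _ _ (expR 2 * (expR (- (psi0 s t m / h)) * gauss_mass n mu s h))).
  apply: ler_pM => //; first exact/ltW/tilt_mass_gt0.
  exact: expR_2_ge4.
rewrite !mulrA ler_pM2r; last exact: gauss_mass_gt0.
rewrite -!expRD ler_expR; move: H; rewrite mulrBl; lra.
Qed.

Variable d : R.
Hypothesis dh : Agrid * Num.sqrt h <= d.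

Let d0 : 0 < d.
Proof.
apply: lt_le_trans dh; rewrite mulr_gt0 ?sqrtr_gt0 //.
by rewrite mulr_gt0 // addr_gt0 // C_mass_gt0.
Qed.

Let d2h : Agrid ^+ 2 <= d ^+ 2 / h.
Proof.
rewrite ler_pdivlMr // -[h in X in X <= _]sqr_sqrtr ?(ltW h0) // -exprMn.
have A0 : 0 < Agrid by rewrite mulr_gt0 // addr_gt0 // C_mass_gt0.
by apply: lerXn2r; rewrite ?nnegrE ?(ltW d0) // mulr_ge0 ?(ltW A0) // sqrtr_ge0.
Qed.

Lemma ratio_inner t : d / 2 <= t -> t + 2 * d <= 1 ->
  4 * tilt_mass n mu s h t <= tilt_mass n mu s h (t + d).
Proof.
have D0 := d0; have D2 := d2h; have H0 := h0 => dt t1.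
have t0 : 0 <= t by lra.
have td0 : 0 <= t + d by lra.
have [m m0 mt] := minimizer s0 s4 t0; have [m' m'0 mt'] := minimizer s0 s4 td0.
apply: (ratio_step 0 mt mt').
have P := psi0_inner s0 s4 d0 dt t1 m0 mt m'0 mt'.
have m'1 : m' <= 1 by apply: (minimizer_le1 s0 _ m'0 mt'); lra.
have C0 := C_mass_gt0.
apply: (@le_trans _ _ (d ^+ 2 / 4 / h)); last by rewrite ler_pM2r ?invr_gt0.
have -> : d ^+ 2 / 4 / h = d ^+ 2 / h / 4 by field; rewrite gt_eqF.
apply: (@le_trans _ _ (Agrid ^+ 2 / 4)); last by rewrite ler_pM2r ?invr_gt0.
have : C_mass mu s * (1 + m' ^+ 2) <= C_mass mu s * 2 by rewrite ler_pM2l //; nra.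
rewrite /Agrid; nra.
Qed.

Lemma ratio_outer t : 1 + d <= t -> 4 * tilt_mass n mu s h (t + d) <= tilt_mass n mu s h t.
Proof.
have D0 := d0; have D2 := d2h; have H0 := h0; have H1 := h1; have DH := dh => dt.
have t0 : 0 <= t by lra.
have td0 : 0 <= t + d by lra.
have [m m0 mt] := minimizer s0 s4 t0; have [m' m'0 mt'] := minimizer s0 s4 td0.
apply: (ratio_step 0 mt' mt).
have [P M] := psi0_outer s0 s4 d0 dt m0 mt m'0 mt'.
have C0 := C_mass_gt0.
apply: (@le_trans _ _ (7 / 20 * d * (t + d - 1) / h)); last by rewrite ler_pM2r ?invr_gt0.
set u := t + d - 1.
have u0 : 2 * d <= u by rewrite /u; lra.
have A0 : 0 < Agrid by rewrite mulr_gt0 // addr_gt0 // C_mass_gt0.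
(* [d u / h] exceeds both a large constant and a large multiple of [u]: half of it pays for the
   constant loss, half for the one that grows with [m^2]. *)
have e1 : 2 * (d ^+ 2 / h) <= d * u / h.
  rewrite mulrA ler_pM2r ?invr_gt0 // expr2; nra.
have e2 : Agrid * u <= d * u / h.
  rewrite [leRHS]mulrAC; apply: ler_wpM2r; first by lra.
  rewrite ler_pdivlMr //; apply: le_trans DH.
  rewrite ler_pM2l // -[leLHS]sqr_sqrtr ?(ltW h0) // expr2 ler_piMl ?sqrtr_ge0 //.
  by rewrite -sqrtr1 ler_sqrt.
have -> : 7 / 20 * d * u / h = 7 / 40 * (d * u / h) + 7 / 40 * (d * u / h) by field; rewrite gt_eqF.
have : C_mass mu s * (1 + m ^+ 2) <= C_mass mu s * (9 / 4 + 5 / 4 * u).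
  by rewrite ler_pM2l // /u; lra.
have : 5 / 4 * (C_mass mu s * u) <= 7 / 40 * (Agrid * u).
  have u00 : 0 <= u by lra.
  have : 0 <= C_mass mu s * u by rewrite mulr_ge0 // ltW.
  rewrite /Agrid; lra.
have : C_mass mu s * (9 / 4) + 2 <= 7 / 40 * (2 * Agrid ^+ 2).
  rewrite /Agrid; nra.
lra.
Qed.

End Ratio.

(** * Poincare inequality under two constraints *)

Section Mixture.
Variables (R : realType) (n : nat) (mu s h : R).
Local Notation N := n.+1.
Local Notation vec := 'rV[R]_N.
Hypothesis mu1 : 1 < mu.
Hypothesis s0 : 0 < s.
Hypothesis s4 : s <= 4^-1.
Hypothesis smu : s <= mu - 1.
Hypothesis h0 : 0 < h.
Local Notation tilt := (@tilt R n mu s h).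
Local Notation tilt_mass := (tilt_mass n mu s h).
Local Notation w := (@weight R mu h N).

Let N0 : (0 : R) < N%:R. Proof. by rewrite ltr0n. Qed.
Let hN : 0 < h * N%:R. Proof. by rewrite mulr_gt0. Qed.

Variables (f : vec -> R) (g : 'I_N -> vec -> R) (M0 M1 M : R).
Hypothesis cf : continuous f.
Hypothesis fM : forall x, `|f x| <= M0.
Hypothesis cg : forall i, continuous (g i).
Hypothesis gM : forall i x, `|g i x| <= M1.
Hypothesis Mge0 : 0 <= M.
Hypothesis fT : forall x y, f x - f y <=
    \sum_(i < N) g i x * (x - y) 0 i + M / 2 * sqn (x - y).

Definition tilt_mean t := intV (fun x => f x * tilt t x) / tilt_mass t.
Definition tilt_var t := intV (fun x => (f x - tilt_mean t) ^+ 2 * tilt t x).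
Definition gsq x := \sum_(i < N) g i x ^+ 2.

Let sgf : subgauss f. Proof. exact: subgauss_bounded fM. Qed.
Let sgfc c : subgauss (fun x => f x - c).
Proof. by apply: subgaussD => //; exact: subgauss_cst. Qed.
Let sgg : subgauss gsq.
Proof.
apply: subgauss_sum => i.
have sg := subgauss_bounded (@cg i) (@gM i); exact: (subgaussM sg sg).
Qed.

Lemma tilt_meanE t : intV (fun x => f x * tilt t x) = tilt_mean t * tilt_mass t.
Proof. by rewrite /tilt_mean divfK // gt_eqF // tilt_mass_gt0. Qed.

Lemma tilt_var_ge0 t : 0 <= tilt_var t.
Proof. by apply: intV_ge0 => x; rewrite mulr_ge0 ?sqr_ge0 ?expR_ge0. Qed.

Lemma tilt_var_le t : tilt_var t <= 4 * h * N%:R / s * intV (fun x => gsq x * tilt t x).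
Proof.
have k0 : 0 < s / (h * N%:R) by rewrite divr_gt0.
have := @poincare R N (tilt t) f g (s / (h * N%:R)) M0 M1 M (tilt_mean t) (gdomV_tilt n mu1 s0 smu h0 t)
  (tilt_gt0 mu s h t) k0 (tilt_strongly_log_concave mu1 s0 smu h0 t) (@cf) (@fM) (@cg) (@gM) Mge0 (@fT) (tilt_meanE t).
suff -> : 4 / (s / (h * N%:R)) = 4 * h * N%:R / s by [].
by field; rewrite nat1r !gt_eqF.
Qed.

Lemma second_moment t : intV (fun x => f x ^+ 2 * tilt t x) = tilt_var t + tilt_mass t * tilt_mean t ^+ 2.
Proof.
have dG := gdomV_tilt n mu1 s0 smu h0 t.
have d1 : gdomV (fun x => f x * tilt t x) by exact: gdomV_mul.
have d2 : gdomV (fun x => f x ^+ 2 * tilt t x) by apply: gdomV_mul => //; exact: subgaussM.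
have -> : tilt_var t = intV (fun x => 1 * (1 * (f x ^+ 2 * tilt t x) + (- 2 * tilt_mean t) * (f x * tilt t x)) + tilt_mean t ^+ 2 * tilt t x).
  by apply: eq_intV => x; ring.
rewrite intV_lin //; last exact: gdomV_lin.
rewrite intV_lin // tilt_meanE -/(tilt_mass t); ring.
Qed.

(** The exponent is quadratic in the tilt, so the quotient of [tilt t' ^+ 2] by [tilt t] is again a
    tilt, at the reflected point [2 t' - t], up to a factor free of [x]. *)
Lemma tilt_sqr t t' x : tilt t' x ^+ 2 =
  expR ((1 + s) * (t' - t) ^+ 2 / h) * tilt (2 * t' - t) x * tilt t x.
Proof.
rewrite /tilt expr2 -!expRD; congr expR; rewrite /tilted_V.
by field; rewrite nat1r !gt_eqF.
Qed.

(* Cauchy-Schwarz against [tilt t' ^+ 2 / tilt t], whose mass is controlled by [tilt_mass_mid]. *)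
Lemma tilt_mean_diff t t' : tilt_mass t * (tilt_mean t' - tilt_mean t) ^+ 2 <=
  expR (((1 + s) + (1 + s) ^+ 2 / s) * (t' - t) ^+ 2 / h) * tilt_var t.
Proof.
have dG u := gdomV_tilt n mu1 s0 smu h0 u.
set e := expR ((1 + s) * (t' - t) ^+ 2 / h).
set P := e * tilt_mass (2 * t' - t); set X := (tilt_mean t' - tilt_mean t) * tilt_mass t'.
have p0 := tilt_mass_gt0 n mu1 s0 smu h0.
have P0 : 0 < P by rewrite mulr_gt0 ?expR_gt0 ?p0.
have XE : X = intV (fun x => (f x - tilt_mean t) * tilt t' x).
  rewrite (@eq_intV _ _ _ (fun x => 1 * (f x * tilt t' x) + (- tilt_mean t) * tilt t' x)); last by move=> x; ring.
  by rewrite intV_lin //; [rewrite tilt_meanE /X -/(tilt_mass t'); ring | exact: gdomV_mul].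
(* Cauchy-Schwarz in discriminant form; [l = X / P] is the optimal choice. *)
have disc l : 2 * l * X <= tilt_var t + l ^+ 2 * P.
  have -> : tilt_var t + l ^+ 2 * P = intV (fun x => 1 * ((f x - tilt_mean t) ^+ 2 * tilt t x) + (l ^+ 2 * e) * tilt (2 * t' - t) x).
    rewrite intV_lin //; last by apply: gdomV_mul => //; exact: subgaussM.
    by rewrite /P -/(tilt_mass _) -/(tilt_var t); ring.
  rewrite XE -intVZ; last exact: gdomV_mul.
  apply: le_intV.
  - by apply: gdomVZ; exact: gdomV_mul.
  - by apply: gdomV_lin => //; apply: gdomV_mul => //; exact: subgaussM.
  move=> x; have G0 := tilt_gt0 mu s h t x.
  rewrite -(ler_pM2r G0).
  have -> : (1 * ((f x - tilt_mean t) ^+ 2 * tilt t x) + l ^+ 2 * e * tilt (2 * t' - t) x) * tilt t x =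
    ((f x - tilt_mean t) * tilt t x) ^+ 2 + l ^+ 2 * (e * tilt (2 * t' - t) x * tilt t x) by ring.
  rewrite -tilt_sqr.
  have : 0 <= ((f x - tilt_mean t) * tilt t x - l * tilt t' x) ^+ 2 by exact: sqr_ge0.
  lra.
have X2 : X ^+ 2 <= tilt_var t * P.
  have := disc (X / P).
  have -> : 2 * (X / P) * X = 2 * (X ^+ 2 / P) by ring.
  have -> : (X / P) ^+ 2 * P = X ^+ 2 / P by field; rewrite gt_eqF.
  by move=> H; rewrite -ler_pdivrMr //; lra.
have PM := tilt_mass_mid n mu1 s0 smu h0 t (2 * t' - t).
have E1 : (t + (2 * t' - t)) / 2 = t' by field.
have E2 : (1 + s) ^+ 2 * (t - (2 * t' - t)) ^+ 2 / (4 * s * h) = (1 + s) ^+ 2 / s * (t' - t) ^+ 2 / h.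
  by field; rewrite !gt_eqF.
rewrite E1 E2 in PM.
set e' := expR _ in PM.
have -> : expR (((1 + s) + (1 + s) ^+ 2 / s) * (t' - t) ^+ 2 / h) = e * e'.
  by rewrite -expRD; congr expR; ring.
have pt'2 : 0 < tilt_mass t' ^+ 2 by rewrite exprn_gt0.
rewrite -(ler_pM2r pt'2).
have -> : tilt_mass t * (tilt_mean t' - tilt_mean t) ^+ 2 * tilt_mass t' ^+ 2 = tilt_mass t * X ^+ 2 by rewrite /X; ring.
apply: (@le_trans _ _ (tilt_mass t * (tilt_var t * P))); first by rewrite ler_pM2l.
have -> : tilt_mass t * (tilt_var t * P) = e * tilt_var t * (tilt_mass t * tilt_mass (2 * t' - t)) by rewrite /P; ring.
have -> : e * e' * tilt_var t * tilt_mass t' ^+ 2 = e * tilt_var t * (e' * tilt_mass t' ^+ 2) by ring.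
by apply: ler_wpM2l => //; rewrite mulr_ge0 ?expR_ge0 ?tilt_var_ge0.
Qed.

Lemma tiltE t x : tilt t x = expR (- ((1 + s) / (2 * h) * (mean x - t) ^+ 2)) * w x.
Proof.
rewrite /tilt /weight -expRD; congr expR; rewrite /tilted_V.
by field; rewrite nat1r !gt_eqF.
Qed.

Lemma gdomV_weight : gdomV w.
Proof.
apply: (@gdomV_expR _ _ _ (h * N%:R)^-1 (2 * N%:R / (h * N%:R))).
- by apply: continuous_mul; [exact: continuous_V_N | exact: continuous_const].
- by rewrite invr_gt0.
- move=> x; rewrite mulrC -mulrBl ler_pM2r ?invr_gt0 //.
  by apply: V_N_ge; exact: stiffness_ge0.
Qed.

Hypothesis h1 : h <= 1.
Variables (J0 : nat) (d : R).
Hypothesis dE : d * (J0%:R + 2^-1) = 1.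
Hypothesis dlo : Agrid mu s * Num.sqrt h <= d.
Hypothesis dhi : d <= 2 * (Agrid mu s * Num.sqrt h).

Let A := Agrid mu s.
Let A0 : 0 < A. Proof. by rewrite mulr_gt0 // addr_gt0 // C_mass_gt0. Qed.
Let d0 : 0 < d.
Proof. by apply: lt_le_trans dlo; rewrite mulr_gt0 ?sqrtr_gt0. Qed.
Let sqh : Num.sqrt h ^+ 2 = h. Proof. by rewrite sqr_sqrtr // ltW. Qed.
Let d2lo : A ^+ 2 * h <= d ^+ 2.
Proof.
rewrite -sqh -exprMn; apply: lerXn2r; rewrite ?nnegrE //; last exact: ltW.
by rewrite mulr_ge0 ?sqrtr_ge0 // ltW.
Qed.
Let d2hi : d ^+ 2 <= 4 * A ^+ 2 * h.
Proof.
have -> : 4 * A ^+ 2 * h = (2 * (A * Num.sqrt h)) ^+ 2 by rewrite -[in LHS]sqh; ring.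
apply: lerXn2r; rewrite ?nnegrE ?(ltW d0) //.
by apply: mulr_ge0 => //; apply: mulr_ge0; [exact: (ltW A0) | exact: sqrtr_ge0].
Qed.

(** Half-integer points: with its mirror image the grid is symmetric and equally spaced across 0,
    each point is the midpoint of a cell of width [d], and [dE] puts point [J0] at the well 1. *)
Definition grid (j : nat) : R := (j%:R + 2^-1) * d.

Definition B_diff : R := expR (((1 + s) + (1 + s) ^+ 2 / s) * (4 * Agrid mu s ^+ 2)).

Let grid_step j : grid j.+1 = grid j + d.
Proof. by rewrite /grid -natr1; ring. Qed.

Lemma B_diff_ge t t' : `|t' - t| = d ->
  expR (((1 + s) + (1 + s) ^+ 2 / s) * (t' - t) ^+ 2 / h) <= B_diff.
Proof.
have S0 := s0; move=> td; rewrite ler_expR -mulrA; apply: ler_wpM2l.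
  by rewrite addr_ge0 ?divr_ge0 ?sqr_ge0 //; lra.
by rewrite -real_normK ?num_real // td ler_pdivrMr.
Qed.

(** The sign [sg] selects the half-line; masses agree on both sides by symmetry, means and variances
    do not. *)
Lemma half_hardy (sg : R) : `|sg| = 1 -> tilt_mean sg = 0 -> forall k, (J0 < k)%N ->
  \sum_(j < k) tilt_mass (sg * grid j) * tilt_mean (sg * grid j) ^+ 2 <=
  4 * B_diff * \sum_(j < k) tilt_var (sg * grid j).
Proof.
move=> sg1 F0.
have ps t : tilt_mass (sg * t) = tilt_mass t.
  have [sg0|sg0] := leP 0 sg.
    by move: sg1; rewrite ger0_norm // => ->; rewrite mul1r.
  have -> : sg = -1 by move: sg1; rewrite ltr0_norm // => /eqP; rewrite eqr_oppLR => /eqP.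
  by rewrite mulN1r tilt_mass_opp.
have nd t : `|sg * (t + d) - sg * t| = d /\ `|sg * t - sg * (t + d)| = d.
  by rewrite -!mulrBr !normrM sg1 !mul1r addrC addKr opprD addNKr normrN gtr0_norm.
apply: (@discrete_hardy _ J0 (fun j => tilt_mass (sg * grid j)) (fun j => tilt_mean (sg * grid j))
  (fun j => tilt_var (sg * grid j)) B_diff).
- by move=> j; exact: tilt_mass_gt0.
- by move=> j; exact: tilt_var_ge0.
- exact: expR_ge0.
- by rewrite /grid [_ * d]mulrC dE mulr1.
- move=> j; apply: (le_trans (tilt_mean_diff _ _)); apply: ler_wpM2r; first exact: tilt_var_ge0.
  by apply: B_diff_ge; rewrite grid_step; case: (nd (grid j)).
- move=> j; rewrite -sqrrN opprB; apply: (le_trans (tilt_mean_diff _ _)).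
  apply: ler_wpM2r; first exact: tilt_var_ge0.
  by apply: B_diff_ge; rewrite grid_step; case: (nd (grid j)).
(* [j + 2 <= J0] gives [grid j + 2 d <= grid J0 = 1], the margin from the well that [ratio_inner]
   requires. *)
- move=> j jJ; rewrite !ps grid_step; apply: ratio_inner => //.
    have : 0 <= j%:R * d by apply: mulr_ge0 => //; exact: (ltW d0).
    by rewrite /grid; lra.
  have jJ' : 0 <= J0%:R - (j%:R + 1 + 1) :> R by rewrite subr_ge0 !natr1 ler_nat.
  have := mulr_ge0 (ltW d0) jJ'; have := dE; rewrite /grid; lra.
- move=> j Jj; rewrite !ps grid_step; apply: ratio_outer => //.
  have jJ' : 0 <= j%:R - (J0%:R + 1) :> R by rewrite subr_ge0 !natr1 ler_nat.
  have := mulr_ge0 (ltW d0) jJ'; have := dE; rewrite /grid; lra.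
Qed.

(** The value of the tilt factor at distance [d / 2] from its centre, bounded below through
    [d^2 <= 4 Agrid^2 h]. *)
Definition c_mix : R := expR (- ((1 + s) * Agrid mu s ^+ 2 / 2)).

Let norm_sg (sg t m : R) : `|sg| = 1 -> (m - sg * t) ^+ 2 = (sg * m - t) ^+ 2.
Proof.
move=> sg1; have sg2 : sg ^+ 2 = 1 by rewrite -real_normK ?num_real // sg1 expr1n.
have -> : (m - sg * t) ^+ 2 = m ^+ 2 - 2 * sg * m * t + sg ^+ 2 * t ^+ 2 by ring.
have -> : (sg * m - t) ^+ 2 = sg ^+ 2 * m ^+ 2 - 2 * sg * m * t + t ^+ 2 by ring.
by rewrite sg2 !mul1r.
Qed.

Lemma mixture_upper (sg : R) k x : `|sg| = 1 ->
  \sum_(j < k) tilt (sg * grid j) x <= 4 * expR 1 * w x.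
Proof.
move=> sg1; set v := sg * mean x / d - 2^-1.
apply: (@le_trans _ _ (\sum_(j < k) expR (- (v - j%:R) ^+ 2) * w x)); last first.
  by rewrite -mulr_suml ler_wpM2r ?expR_ge0 // sum_gauss_le.
apply: ler_sum => j _; rewrite tiltE; apply: ler_wpM2r; first exact: expR_ge0.
rewrite ler_expR lerN2 norm_sg //.
have -> : sg * mean x - grid j = d * (v - j%:R).
  by rewrite /v /grid; field; rewrite gt_eqF.
rewrite exprMn mulrA ler_peMl ?sqr_ge0 //.
have -> : (1 + s) / (2 * h) * d ^+ 2 = (1 + s) / 2 * (d ^+ 2 / h) by field; rewrite gt_eqF.
(* [Agrid >= 8] makes the coefficient of [(v - j)^2] at least 1, so [sum_gauss_le] applies. *)
have a : A ^+ 2 <= d ^+ 2 / h by rewrite ler_pdivlMr.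
have c0 := C_mass_gt0 mu s; have S0 := s0.
have a8 : 8 <= A by rewrite /A /Agrid; lra.
have : 64 <= d ^+ 2 / h by apply: le_trans a; nra.
nra.
Qed.

Lemma mixture_lower k x : `|mean x| < k%:R * d ->
  c_mix * w x <= \sum_(j < k) (tilt (1 * grid j) x + tilt (- 1 * grid j) x).
Proof.
(* The cell [[j d, (j + 1) d)] contains [|mean x|], and the tilt at its midpoint, with the sign of
   the mean, already suffices. *)
move=> mk; set j := Num.truncn (`|mean x| / d).
have md0 : 0 <= `|mean x| / d by rewrite divr_ge0 // ltW.
have /andP[jl ju] := truncn_itv md0; rewrite -/j in jl ju.
have jk : (j < k)%N.
  by rewrite -(ltr_nat R) (le_lt_trans jl) // ltr_pdivrMr.
rewrite (bigD1 (Ordinal jk)) //= -[leLHS]addr0; apply: lerD; last first.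
  by apply: sumr_ge0 => i _; rewrite addr_ge0 // expR_ge0.
rewrite ler_pdivlMr // in jl; rewrite ltr_pdivrMr // -natr1 in ju.
have dist : (`|mean x| - grid j) ^+ 2 <= d ^+ 2 / 4.
  have e1 : - (d / 2) <= `|mean x| - grid j by rewrite /grid; lra.
  have e2 : `|mean x| - grid j <= d / 2 by rewrite /grid; lra.
  nra.
have S0 := s0.
have E : c_mix <= expR (- ((1 + s) / (2 * h) * (`|mean x| - grid j) ^+ 2)).
  rewrite ler_expR lerN2.
  apply: (@le_trans _ _ ((1 + s) / (2 * h) * (A ^+ 2 * h))); last first.
    by rewrite le_eqVlt; apply/orP; left; apply/eqP; rewrite -/A; field; rewrite gt_eqF.
  apply: ler_wpM2l; first by rewrite divr_ge0 ?mulr_ge0 ?(ltW h0) //; lra.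
  have := d2hi; rewrite -/A => D2; apply: (le_trans dist); lra.
have [m0|m0] := leP 0 (mean x).
  apply: (@le_trans _ _ (tilt (1 * grid j) x)); last by rewrite lerDl expR_ge0.
  rewrite tiltE mul1r; apply: ler_wpM2r; first exact: expR_ge0.
  by move: E; rewrite ger0_norm.
apply: (@le_trans _ _ (tilt (- 1 * grid j) x)); last by rewrite lerDr expR_ge0.
rewrite tiltE; apply: ler_wpM2r; first exact: expR_ge0.
move: E; rewrite ltr0_norm // -[(- _ - _) ^+ 2]sqrrN.
by congr (_ <= expR (- (_ * _ ^+ 2))); ring.
Qed.

Lemma le0_of_nat_multiples (Y Z : R) (k0 : nat) :
  (forall k, (k0 < k)%N -> Y * k%:R <= Z) -> Y <= 0.
Proof.
move=> H; rewrite leNgt; apply/negP => Y0.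
pose k := maxn k0 (Num.truncn (`|Z| / Y)).
have : `|Z| / Y < k.+1%:R.
  apply: lt_le_trans (truncnS_gt _) _.
  by rewrite ler_nat ltnS leq_max leqnn orbT.
rewrite ltr_pdivrMr // => kZ.
have := H k.+1; rewrite ltnS leq_max leqnn => /(_ isT).
have := ler_norm Z; move: kZ; lra.
Qed.

(** Each second moment is variance plus squared mean; Hardy turns the means into variances, the
    Poincare inequality of each tilt turns these into gradients, and [mixture_upper] reassembles the
    weight. *)
Let half_mixture (sg : R) k : `|sg| = 1 -> tilt_mean sg = 0 -> (J0 < k)%N ->
  \sum_(j < k) intV (fun x => f x ^+ 2 * tilt (sg * grid j) x) <=
  (1 + 4 * B_diff) * (4 * h * N%:R / s) * (4 * expR 1) * intV (fun x => gsq x * w x).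
Proof.
move=> sg1 F0 Jk.
have B0 : 0 <= 1 + 4 * B_diff by rewrite addr_ge0 // mulr_ge0 // expR_ge0.
have c0 : 0 <= 4 * h * N%:R / s.
  by rewrite divr_ge0 ?(ltW s0) // mulr_ge0 // mulr_ge0 // ltW.
apply: (@le_trans _ _ ((1 + 4 * B_diff) * \sum_(j < k) tilt_var (sg * grid j))).
  rewrite (eq_bigr (fun j : 'I_k => tilt_var (sg * grid j) + tilt_mass (sg * grid j) * tilt_mean (sg * grid j) ^+ 2)); last first.
    by move=> j _; exact: second_moment.
  rewrite big_split /= mulrDl mul1r lerD2l.
  exact: half_hardy.
set cc := 4 * h * N%:R / s in c0 *.
rewrite -!(mulrA (1 + 4 * B_diff)); apply: ler_wpM2l => //.
apply: (@le_trans _ _ (\sum_(j < k) cc * intV (fun x => gsq x * tilt (sg * grid j) x))).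
  by apply: ler_sum => j _; exact: tilt_var_le.
rewrite -mulr_sumr -(mulrA cc); apply: ler_wpM2l => //.
have dG j : gdomV (fun x => gsq x * tilt (sg * grid j) x).
  by apply: gdomV_mul => //; exact: gdomV_tilt.
rewrite -(@intV_sum _ _ _ (index_enum 'I_k) (fun j x => gsq x * tilt (sg * grid j) x)) //.
have dw : gdomV (fun x => gsq x * w x) by apply: gdomV_mul => //; exact: gdomV_weight.
rewrite -intVZ //; apply: le_intV.
- exact: (@gdomV_sum _ _ _ (index_enum 'I_k) (fun j x => gsq x * tilt (sg * grid j) x)).
- exact: gdomVZ.
move=> x; rewrite -mulr_sumr mulrCA; apply: ler_wpM2l.
  by apply: sumr_ge0 => i _; exact: sqr_ge0.
exact: mixture_upper.
Qed.

(* The grid with [k] points covers only [|mean x| < k d]; the rest is absorbed by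
   the factor [(mean x / (k d)) ^+ 2] and vanishes as [k] grows. *)
Lemma poincare_two_constraints : tilt_mean 1 = 0 -> tilt_mean (- 1) = 0 ->
  c_mix * intV (fun x => f x ^+ 2 * w x) <=
  2 * ((1 + 4 * B_diff) * (4 * h * N%:R / s) * (4 * expR 1)) * intV (fun x => gsq x * w x).
Proof.
move=> F1 FN1; rewrite -subr_le0.
set L := c_mix * _; set K := _ * intV _.
pose Q := intV (fun x => mean x ^+ 2 * f x ^+ 2 * w x).
have sgm : subgauss (@mean R n).
  have := subgaussM (subgauss_sum (index_enum 'I_N) (@subgauss_coord R N)) (subgauss_cst _ (N%:R^-1)).
  by [].
have sgf2 : subgauss (fun x => f x ^+ 2) by exact: subgaussM.
have sgmf : subgauss (fun x => mean x ^+ 2 * f x ^+ 2).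
  by apply: subgaussM => //; exact: subgaussM.
have dw := gdomV_weight.
apply: (@le0_of_nat_multiples _ (c_mix * Q / d ^+ 2) J0) => k Jk.
have k0 : 0 < k%:R :> R by rewrite ltr0n (leq_ltn_trans _ Jk).
have k1 : 1 <= k%:R :> R by rewrite ler1n (leq_ltn_trans _ Jk).
have dG t : gdomV (fun x => f x ^+ 2 * tilt t x) by apply: gdomV_mul => //; exact: gdomV_tilt.
have main : L <= \sum_(j < k) intV (fun x => f x ^+ 2 * tilt (1 * grid j) x) +
    \sum_(j < k) intV (fun x => f x ^+ 2 * tilt (- 1 * grid j) x) + c_mix / (k%:R * d) ^+ 2 * Q.
  rewrite /L -intVZ; last exact: gdomV_mul.
  rewrite -big_split /=.
  pose S j x := f x ^+ 2 * tilt (1 * grid j) x + f x ^+ 2 * tilt (- 1 * grid j) x.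
  have dS j : gdomV (S j) by apply: gdomVD.
  have -> : \sum_(j < k) (intV (fun x => f x ^+ 2 * tilt (1 * grid j) x) +
      intV (fun x => f x ^+ 2 * tilt (- 1 * grid j) x)) = intV (fun x => \sum_(j < k) S j x).
    rewrite (@intV_sum _ _ _ (index_enum 'I_k) (fun j x => S j x)) //.
    by apply: eq_bigr => j _; rewrite intVD.
  have dSS : gdomV (fun x => \sum_(j < k) S j x).
    exact: (@gdomV_sum _ _ _ (index_enum 'I_k) (fun j x => S j x)).
  have dQ : gdomV (fun x => mean x ^+ 2 * f x ^+ 2 * w x) by exact: gdomV_mul.
  rewrite -intVZ // -intVD //; last exact: gdomVZ.
  apply: le_intV; [by apply: gdomVZ; exact: gdomV_mul | by apply: gdomVD => //; exact: gdomVZ |].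
  move=> x; have w0 : 0 <= w x by exact: expR_ge0.
  have S0 : 0 <= \sum_(j < k) S j x.
    by apply: sumr_ge0 => j _; rewrite addr_ge0 // mulr_ge0 ?sqr_ge0 ?expR_ge0.
  have c0 : 0 <= c_mix by exact: expR_ge0.
  have kd0 : 0 < k%:R * d by rewrite mulr_gt0.
  have [mk|mk] := ltP `|mean x| (k%:R * d).
    apply: (@le_trans _ _ (\sum_(j < k) S j x)); last first.
      by rewrite lerDl; apply: mulr_ge0; [by rewrite divr_ge0 ?sqr_ge0 | by apply: mulr_ge0 => //; apply: mulr_ge0; exact: sqr_ge0].
    have -> : \sum_(j < k) S j x = f x ^+ 2 * \sum_(j < k) (tilt (1 * grid j) x + tilt (- 1 * grid j) x).
      by rewrite mulr_sumr; apply: eq_bigr => j _; rewrite /S mulrDr.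
    by rewrite mulrCA; apply: ler_wpM2l; [exact: sqr_ge0 | exact: mixture_lower].
  apply: (@le_trans _ _ (c_mix / (k%:R * d) ^+ 2 * (mean x ^+ 2 * f x ^+ 2 * w x))); last by rewrite lerDr.
  have -> : c_mix / (k%:R * d) ^+ 2 * (mean x ^+ 2 * f x ^+ 2 * w x) =
    c_mix * (f x ^+ 2 * w x) * (mean x ^+ 2 / (k%:R * d) ^+ 2) by ring.
  rewrite ler_peMr //; first by apply: mulr_ge0 => //; apply: mulr_ge0 => //; exact: sqr_ge0.
  rewrite ler_pdivlMr ?exprn_gt0 // mul1r -[leRHS]real_normK ?num_real //.
  by apply: lerXn2r; rewrite ?nnegrE // ltW.
have n1 : `|1 : R| = 1 by rewrite normr1.
have n2 : `|- 1 : R| = 1 by rewrite normrN1.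
have Q0 : 0 <= Q by apply: intV_ge0 => x; apply: mulr_ge0; [by apply: mulr_ge0; exact: sqr_ge0 | exact: expR_ge0].
have LK : L - K <= c_mix / (k%:R * d) ^+ 2 * Q.
  have H1 := half_mixture n1 F1 Jk; have H2 := half_mixture n2 FN1 Jk.
  rewrite /K; lra.
(* The error is of order [1 / k^2], so it stays bounded after multiplication by [k]. *)
apply: (@le_trans _ _ (c_mix / (k%:R * d) ^+ 2 * Q * k%:R)).
  by rewrite ler_pM2r.
have -> : c_mix / (k%:R * d) ^+ 2 * Q * k%:R = c_mix * Q / d ^+ 2 * k%:R^-1.
  by field; rewrite !gt_eqF.
rewrite ler_piMr ?invf_le1 //.
by rewrite divr_ge0 ?sqr_ge0 // mulr_ge0 // expR_ge0.
Qed.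

End Mixture.

(** * The third eigenvalue *)

Section Calculus.
Variables (R : realType) (n : nat).
Local Notation N := n.+1.
Local Notation vec := 'rV[R]_N.
Implicit Types (x y d : vec) (f : vec -> R).

Lemma derive_partial f x d : differentiable f x ->
  'D_d f x = \sum_(i < N) partial i f x * d 0 i.
Proof.
move=> df; rewrite deriveE // {1}(row_sum_delta d) linear_sum.
apply: eq_bigr => i _; rewrite linearZ /= /partial deriveE // mulrC.
by [].
Qed.

Lemma mvt_line f x y : (forall z, differentiable f z) ->
  exists2 r : R, 0 <= r <= 1 &
    f x - f y = \sum_(i < N) partial i f (y + r *: (x - y)) * (x - y) 0 i.
Proof.
move=> df; set d := x - y.
pose phi (r : R) := f (y + r *: d).
have dphi (r : R) : is_derive r (1 : R) phi ('D_d f (y + r *: d)).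
  have dv : derivable f (y + r *: d) d by apply: diff_derivable; exact: df.
  have E : (fun h : R => h^-1 *: ((phi \o shift r) (h *: (1 : R)) - phi r)) =
      (fun h : R => h^-1 *: ((f \o shift (y + r *: d)) (h *: d) - f (y + r *: d))).
    apply/funext => h; rewrite /phi /=; congr (_ *: (f _ - _)).
    by rewrite scalerDl [h%:A]mulr1 addrCA.
  constructor; first by rewrite /derivable E.
  by rewrite /derive E.
have cphi : continuous phi.
  by move=> r; apply: differentiable_continuous; apply/derivable1_diffP; have [] := dphi r.
have [|c c01] := @MVT_segment R phi (fun r => 'D_d f (y + r *: d)) 0 1 ler01.
  exact: continuous_subspaceT.
rewrite /phi scale1r scale0r addr0 subr0 mulr1 {1}/d (addrC y (x - y)) subrK => ->.
by exists c; [move: c01; rewrite in_itv | rewrite derive_partial].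
Qed.

(** Mean value theorem for [f], then for its partial derivatives. The crude, [N]-dependent constant
    is harmless: [M] is absent from the conclusion of [poincare]. *)
Lemma taylor_bound f (M2 : R) : (forall z, differentiable f z) ->
  (forall i z, differentiable (partial i f) z) ->
  (forall i j z, `|partial j (partial i f) z| <= M2) ->
  forall x y, `|f x - f y - \sum_(i < N) partial i f x * (x - y) 0 i| <= M2 * N%:R * sqn (x - y).
Proof.
move=> df dg M2b x y; set d := x - y.
have M20 : 0 <= M2 by exact: le_trans (M2b ord0 ord0 0).
pose S := \sum_(i < N) `|d 0 i|.
have S2 : S ^+ 2 <= N%:R * sqn d.
  have := sum_sqr_centered (fun i => `|d 0 i|).
  rewrite -/S subr_ge0 ler_pdivrMr ?ltr0n // mulrC => /le_trans; apply.
  rewrite ler_pM2l ?ltr0n // /sqn; apply: ler_sum => i _.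
  by rewrite real_normK // num_real.
have [r /andP[r0 r1] ->] := mvt_line x y df; rewrite -/d.
rewrite -sumrB; apply: (le_trans (ler_norm_sum _ _ _)).
apply: (@le_trans _ _ (\sum_(i < N) M2 * S * `|d 0 i|)); last first.
  by rewrite -mulr_sumr -mulrA -expr2 -mulrA; apply: ler_wpM2l.
apply: ler_sum => i _; rewrite -mulrBl normrM; apply: ler_wpM2r => //.
have [r' _ ->] := mvt_line (y + r *: d) x (dg i).
apply: (le_trans (ler_norm_sum _ _ _)); rewrite /S mulr_sumr; apply: ler_sum => j _.
rewrite normrM; apply: ler_pM => //.
have -> : y + r *: d - x = (r - 1) *: d.
  by rewrite scalerBl scale1r /d opprB addrC addrA [- x + y]addrC addrC.
rewrite mxE normrM ler_piMl //.
by rewrite ler_norml; apply/andP; split; lra.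
Qed.

Lemma Cb_inf_data f : Cb_inf f ->
  [/\ continuous f, exists M0, forall x, `|f x| <= M0,
    forall i, continuous (partial i f),
    exists M1, forall i x, `|partial i f x| <= M1 &
    exists2 M, 0 <= M & forall x y,
      `|f x - f y - \sum_(i < N) partial i f x * (x - y) 0 i| <= M * sqn (x - y)].
Proof.
move=> Cf.
have df z : differentiable f z by have [] := Cf [::].
have dg i z : differentiable (partial i f) z by have [] := Cf [:: i].
split.
- by move=> x; exact: differentiable_continuous.
- by have [_] := Cf [::].
- by move=> i x; apply: differentiable_continuous; exact: dg.
- have /fin_all_exists[M HM] i : exists M : R, forall x, `|partial i f x| <= M.
    by have [_] := Cf [:: i].
  exists (\sum_(i < N) `|M i|) => i x; apply: (le_trans (HM i x)).
  by apply: (le_trans (ler_norm _)); rewrite (bigD1 i) //= lerDl sumr_ge0.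
have /fin_all_exists[M HM] (ij : 'I_N * 'I_N) :
    exists M : R, forall x, `|partial ij.2 (partial ij.1 f) x| <= M.
  by have [_] := Cf [:: ij.2; ij.1].
pose M2 := \sum_(ij : 'I_N * 'I_N) `|M ij|.
exists (M2 * N%:R); first by rewrite mulr_ge0 // sumr_ge0.
apply: taylor_bound => // i j z; apply: (le_trans (HM (i, j) z)).
by apply: (le_trans (ler_norm _)); rewrite /M2 (bigD1 (i, j)) //= lerDl sumr_ge0.
Qed.

Variables (m : nat) (G : 'I_m -> vec -> R) (c : 'I_m -> R).
Hypothesis CG : forall k, Cb_inf (G k).

Lemma partial_lincomb i x : partial i (fun x => \sum_(k < m) c k * G k x) x =
  \sum_(k < m) c k * partial i (G k) x.
Proof.
have -> : (fun x => \sum_(k < m) c k * G k x) = \sum_(k < m) (c k \*: G k).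
  by apply/funext => z; rewrite fct_sumE.
rewrite /partial derive_sum => [|k]; last first.
  by apply: derivableZ; apply: diff_derivable; have [] := CG k [::].
apply: eq_bigr => k _; rewrite deriveZ //.
by apply: diff_derivable; have [] := CG k [::].
Qed.

(** Closure of [Cb_inf] under linear combinations is bypassed: only these properties feed the
    Poincare inequality. *)
Lemma lincomb_data (F : vec -> R) : F = (fun x => \sum_(k < m) c k * G k x) ->
  [/\ continuous F, exists M0, forall x, `|F x| <= M0,
    forall i, continuous (partial i F),
    exists M1, forall i x, `|partial i F x| <= M1 &
    exists2 M, 0 <= M & forall x y,
      F x - F y <= \sum_(i < N) partial i F x * (x - y) 0 i + M / 2 * sqn (x - y)].
Proof.
move=> ->.
have CD k := Cb_inf_data (CG k).
have pE i : partial i (fun x => \sum_(k < m) c k * G k x) =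
    (fun x => \sum_(k < m) c k * partial i (G k) x).
  by apply/funext => x; exact: partial_lincomb.
split.
- apply: continuous_sum => k; apply: continuous_mul; first exact: continuous_const.
  by case: (CD k).
- have /fin_all_exists[M HM] k : exists M : R, forall x, `|G k x| <= M by case: (CD k).
  exists (\sum_(k < m) `|c k| * M k) => x.
  apply: (le_trans (ler_norm_sum _ _ _)); apply: ler_sum => k _.
  by rewrite normrM; apply: ler_wpM2l.
- move=> i; rewrite pE; apply: continuous_sum => k; apply: continuous_mul.
    exact: continuous_const.
  by case: (CD k) => _ _ + _ _; apply.
- have /fin_all_exists[M HM] k : exists M : R, forall i x, `|partial i (G k) x| <= M by case: (CD k).
  exists (\sum_(k < m) `|c k| * M k) => i x; rewrite pE.
  apply: (le_trans (ler_norm_sum _ _ _)); apply: ler_sum => k _.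
  by rewrite normrM; apply: ler_wpM2l.
have /fin_all_exists[M HM] k : exists M : R, 0 <= M /\ forall x y,
    `|G k x - G k y - \sum_(i < N) partial i (G k) x * (x - y) 0 i| <= M * sqn (x - y).
  by case: (CD k) => _ _ _ _ [M M0 HM]; exists M.
exists (2 * \sum_(k < m) `|c k| * M k).
  by rewrite mulr_ge0 // sumr_ge0 // => k _; rewrite mulr_ge0 //; case: (HM k).
move=> x y; rewrite [2 * _]mulrC mulfK // -lerBlDl.
have -> : \sum_(k < m) c k * G k x - \sum_(k < m) c k * G k y -
   \sum_(i < N) partial i (fun x0 => \sum_(k < m) c k * G k x0) x * (x - y) 0 i =
   \sum_(k < m) c k * (G k x - G k y - \sum_(i < N) partial i (G k) x * (x - y) 0 i).
  under [X in _ - X]eq_bigr do rewrite pE mulr_suml.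
  rewrite exchange_big /= -!sumrB; apply: eq_bigr => k _.
  rewrite !mulrBr mulr_sumr; congr (_ - _).
  by apply: eq_bigr => i _; rewrite mulrA.
rewrite mulr_suml; apply: ler_sum => k _.
apply: (le_trans (ler_norm _)); rewrite normrM -mulrA; apply: ler_wpM2l => //.
by case: (HM k).
Qed.

End Calculus.

Lemma exists_kernel_vector (R : realType) (A : 'M[R]_(3, 2)) :
  exists2 c : 'rV[R]_3, c != 0 & c *m A = 0.
Proof.
have : kermx A != 0.
  rewrite kermx_eq0; apply/negP => /eqP rA.
  by have := rank_leq_col A; rewrite rA.
by move=> /rowV0Pn[c /sub_kermxP cA c0]; exists c.
Qed.

(** Applied to [y = 1 / (Agrid sqrt h)], it makes 1 a grid point for a step within a factor 2 of
    [Agrid sqrt h]. With [k] the integer part of [y], [k >= 2] gives [k + 1 <= 2 k - 1]. *)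
Lemma grid_exists (R : realType) (y : R) : 2 <= y ->
  exists J0 : nat, J0%:R + 2^-1 <= y /\ y <= 2 * (J0%:R + 2^-1).
Proof.
move=> y2; have y0 : 0 <= y by lra.
have /andP[kl ku] := Num.Theory.truncn_itv y0; set k := Num.truncn y in kl ku.
have k1 : (1 < k)%N.
  rewrite ltnNge; apply/negP => k1; move: ku; rewrite ltNge => /negP; apply.
  by apply: le_trans y2; rewrite ler_nat ltnS.
exists k.-1; have E : k.-1%:R = k%:R - 1 :> R.
  by rewrite -subn1 natrB // ltnW.
have k2 : 2 <= k%:R :> R by rewrite ler_nat.
rewrite E; move: ku; rewrite -natr1; split; lra.
Qed.

Lemma energyE (R : realType) (mu h : R) n (f : 'rV[R]_n.+1 -> R) :
  gdomV (fun x => gsq (fun i => partial i f) x * weight mu h x) ->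
  energy mu h f = (h * n.+1%:R * intV (fun x => gsq (fun i => partial i f) x * weight mu h x))%:E.
Proof. by move=> d; rewrite /energy [RHS]EFinM; congr (_ * _)%E; exact: (intRN_intV d). Qed.

Lemma wnorm2E (R : realType) (mu h : R) n (f : 'rV[R]_n.+1 -> R) :
  gdomV (fun x => f x ^+ 2 * weight mu h x) ->
  wnorm2 mu h f = (intV (fun x => f x ^+ 2 * weight mu h x))%:E.
Proof. by move=> d; exact: (intRN_intV d). Qed.

(** * The lower bound on every three-dimensional space *)

Section ThirdEigenvalue.
Variables (R : realType) (mu s h : R) (n : nat).
Local Notation N := n.+1.
Hypothesis mu1 : 1 < mu.
Hypothesis s0 : 0 < s.
Hypothesis s4 : s <= 4^-1.
Hypothesis smu : s <= mu - 1.
Hypothesis h0 : 0 < h.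
Hypothesis hA : 4 * Agrid mu s ^+ 2 * h <= 1.

(** The constant of [poincare_two_constraints] stripped of its factor [h N], which is the prefactor
    of [energy]. *)
Definition K_gap : R := 8 * (1 + 4 * B_diff mu s) / s * (4 * expR 1) / c_mix mu s.

Lemma K_gap_gt0 : 0 < K_gap.
Proof.
have B0 : 0 < 1 + 4 * B_diff mu s by have := expR_gt0 (((1 + s) + (1 + s) ^+ 2 / s) * (4 * Agrid mu s ^+ 2)); rewrite /B_diff; lra.
rewrite /K_gap divr_gt0 ?expR_gt0 // mulr_gt0 ?mulr_gt0 ?expR_gt0 ?invr_gt0 //.
Qed.

Lemma kappa_ge (G : 'I_3 -> 'rV[R]_N -> R) : (forall k, Cb_inf (G k)) -> lin_indep G ->
  (K_gap^-1%:E <= kappa mu h (span_fun G))%E.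
Proof.
move=> CG LG.
pose A := \matrix_(k < 3, j < 2) intV (fun x => G k x * tilt mu s h (if j == 0 then 1 else - 1) x).
have [c c0 cA] := exists_kernel_vector A.
have dw := gdomV_weight n mu1 h0.
have dG t := gdomV_tilt n mu1 s0 smu h0 t.
have sgG k : subgauss (G k).
  by have [cG [M HM] _ _ _] := Cb_inf_data (CG k); exact: subgauss_bounded HM.
pose F0 x := \sum_(k < 3) c 0 k * G k x.
(* Linear independence makes the combination nonzero somewhere, hence of positive norm. *)
have [x0 Fx0] : exists x0, F0 x0 != 0.
  apply: contrapT => H; case/negP: c0; apply/eqP/rowP => k; rewrite mxE.
  apply: (LG (fun k => c 0 k)) => x; apply/eqP/negPn/negP => Fx.
  by apply: H; exists x.
have sgF0 : subgauss F0 by apply: subgauss_sum => k; apply: subgaussM => //; exact: subgauss_cst.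
have dF0 : gdomV (fun x => F0 x ^+ 2 * weight mu h x) by apply: gdomV_mul => //; exact: subgaussM.
pose Z := intV (fun x => F0 x ^+ 2 * weight mu h x).
have Z0 : 0 < Z.
  apply: (intV_gt0 (x := x0) dF0) => [x|].
    by rewrite mulr_ge0 ?sqr_ge0 ?expR_ge0.
  by rewrite mulr_gt0 ?expR_gt0 // exprn_even_gt0.
pose z := (Num.sqrt Z)^-1.
have z2 : z ^+ 2 * Z = 1 by rewrite /z exprVn sqr_sqrtr ?(ltW Z0) // mulVf // gt_eqF.
pose F x := \sum_(k < 3) (z * c 0 k) * G k x.
have FE x : F x = z * F0 x.
  by rewrite /F /F0 mulr_sumr; apply: eq_bigr => k _; rewrite mulrA.
have [cF [M0 HM0] cg [M1 HM1] [M Mge0 HM]] := lincomb_data CG (erefl F).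
have sgF : subgauss F by exact: subgauss_bounded HM0.
have dF : gdomV (fun x => F x ^+ 2 * weight mu h x) by apply: gdomV_mul => //; exact: subgaussM.
have norm1 : intV (fun x => F x ^+ 2 * weight mu h x) = 1.
  rewrite -z2 -intVZ //; apply: eq_intV => x; rewrite FE; ring.
have FG (t : R) (j : 'I_2) : t = (if j == 0 then 1 else - 1) -> tilt_mean mu s h F t = 0.
  move=> ->; set t' := if _ then _ else _.
  rewrite /tilt_mean (_ : intV _ = 0) ?mul0r //.
  have dk k : gdomV (fun x => (z * c 0 k) * (G k x * tilt mu s h t' x)).
    by apply: gdomVZ; exact: gdomV_mul.
  transitivity (intV (fun x => \sum_(k < 3) (z * c 0 k) * (G k x * tilt mu s h t' x))).
    by apply: eq_intV => x; rewrite /F mulr_suml; apply: eq_bigr => k _; rewrite mulrA.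
  rewrite (@intV_sum _ _ _ (index_enum 'I_3) (fun k x => (z * c 0 k) * (G k x * tilt mu s h t' x))) //.
  have := congr1 (fun B : 'rV[R]_2 => z * B 0 j) cA.
  rewrite !mxE mulr0 mulr_sumr => cA0; rewrite -[RHS]cA0; apply: eq_bigr => k _.
  by rewrite intVZ ?mulrA; [rewrite mxE -mulrA | exact: gdomV_mul].
have F1 : tilt_mean mu s h F 1 = 0 by apply: (FG _ 0).
have FN1 : tilt_mean mu s h F (- 1) = 0 by apply: (FG _ 1).
have c8 := C_mass_gt0 mu s.
have A8 : 8 <= Agrid mu s by rewrite /Agrid; lra.
have A0 : 0 < Agrid mu s by lra.
have h1 : h <= 1.
  have A2 : 64 <= Agrid mu s ^+ 2 by nra.
  have := ler_wpM2r (ltW h0) A2; have := hA; have := h0; lra.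
have sh0 : 0 < Num.sqrt h by rewrite sqrtr_gt0.
(* The smallness of [h] guarantees a step at most 1/2 in the target range, as [grid_exists] needs
   [y >= 2]. *)
have Ash : 2 * (Agrid mu s * Num.sqrt h) <= 1.
  rewrite -(@expr_le1 _ 2) //; last by rewrite mulr_ge0 // mulr_ge0 ?ltW.
  have -> : (2 * (Agrid mu s * Num.sqrt h)) ^+ 2 = 4 * Agrid mu s ^+ 2 * Num.sqrt h ^+ 2 by ring.
  by rewrite sqr_sqrtr // ltW.
have Ash0 : 0 < Agrid mu s * Num.sqrt h by rewrite mulr_gt0.
have y2 : 2 <= (Agrid mu s * Num.sqrt h)^-1.
  by rewrite -[leRHS]mul1r ler_pdivlMr.
have [J0 [J1 J2]] := grid_exists y2.
set e := J0%:R + 2^-1 in J1 J2.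
have e0 : 0 < e by rewrite /e; apply: ltr_wpDl => //; rewrite invr_gt0.
have dE : e^-1 * (J0%:R + 2^-1) = 1 by rewrite -/e mulVf // gt_eqF.
have dlo : Agrid mu s * Num.sqrt h <= e^-1.
  by rewrite -[leLHS]invrK lef_pV2 ?posrE // invr_gt0.
have dhi : e^-1 <= 2 * (Agrid mu s * Num.sqrt h).
  rewrite -[leLHS]mul1r ler_pdivrMr // mulrAC -ler_pdivrMr //.
  by rewrite mul1r.
have main := poincare_two_constraints mu1 s0 s4 smu h0 cF HM0 cg HM1 Mge0 HM h1 dE dlo dhi F1 FN1.
have sgg : subgauss (gsq (fun i => partial i F)).
  apply: subgauss_sum => i.
  have sg := subgauss_bounded (cg i) (HM1 i); exact: (subgaussM sg sg).
have dg : gdomV (fun x => gsq (fun i => partial i F) x * weight mu h x) by exact: gdomV_mul.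
rewrite norm1 mulr1 in main.
have cl0 : 0 < c_mix mu s by exact: expR_gt0.
apply: (@le_trans _ _ (energy mu h F)).
  rewrite (energyE dg) lee_fin -[leLHS]mul1r ler_pdivrMr ?K_gap_gt0 //.
  rewrite -(ler_pM2l cl0) mulr1; apply: (le_trans main).
  rewrite le_eqVlt; apply/orP; left; apply/eqP; rewrite /K_gap.
  by field; rewrite !gt_eqF.
apply: ereal_sup_ubound; exists F => //; split; last by rewrite (wnorm2E dF) norm1.
by exists (fun k => z * c 0 k).
Qed.

End ThirdEigenvalue.

Theorem theorem2p1 (R : realType) (mu : R) (hmu : 1 < mu) :
  exists C h0 : R, 0 < C /\ 0 < h0 /\
    forall (h : R) (N : nat), 0 < h -> h <= h0 -> (0 < N)%N ->
      (C%:E <= lambda mu h N 2)%E.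
Proof.
pose s := Num.min (mu - 1) 4^-1.
have s0 : 0 < s by rewrite lt_min invr_gt0 subr_gt0 hmu /=.
have s4 : s <= 4^-1 by rewrite ge_min lexx orbT.
have smu : s <= mu - 1 by rewrite ge_min lexx.
have A0 : 0 < Agrid mu s by rewrite mulr_gt0 // addr_gt0 // C_mass_gt0.
have A20 : 0 < 4 * Agrid mu s ^+ 2 by rewrite mulr_gt0 // exprn_gt0.
exists (K_gap mu s)^-1, (4 * Agrid mu s ^+ 2)^-1; split; [|split].
- by rewrite invr_gt0; exact: K_gap_gt0.
- by rewrite invr_gt0.
move=> h [//|n] h0 hh _.
have hA : 4 * Agrid mu s ^+ 2 * h <= 1.
  by rewrite mulrC -ler_pdivlMr // mul1r.
apply: le_ereal_inf_tmp => _ [S [G [CG [LG ->]]] <-].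
exact: kappa_ge.
Qed.
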